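(* Let $\mathbf{u}\in H^1(\mathcal{D})$ be a helical vector field. Then $$\|\mathbf{u}\|_{L^4(\mathcal{D})}\leq\sqrt[4]{\tfrac{2}{\pi}}\,\Big[\|\mathbf{u}\|_{L^2(\mathcal{D})}^{\frac12}\|\nabla_h\mathbf{u}\|_{L^2(\mathcal{D})}^{\frac12}+\|\mathbf{u}\|_{L^2(\mathcal{D})}\Big].$$ Moreover, there is a constant $C$, independent of $\mathbf{u}$, such that if in addition $\mathbf{u}=0$ on the lateral boundary $\partial B_1\times[0,2\pi]$, then $$\|\mathbf{u}\|_{L^4(\mathcal{D})}\leq C\,\|\mathbf{u}\|_{L^2(\mathcal{D})}^{\frac12}\|\nabla_h\mathbf{u}\|_{L^2(\mathcal{D})}^{\frac12}.$$
   Context: Domain: $B_1=\{(x_1,x_2)\in\mathbb{R}^2: x_1^2+x_2^2<1\}$ and $\mathcal{D}=B_1\times[0,2\pi]\subset\mathbb{R}^3$, with $2\pi$-periodicity in $x_3$; functions on $\mathcal D$ are identified with functions on $B_1\times\mathbb{R}$ that are $2\pi$-periodic in $x_3$. $\nabla_h=(\partial_{x_1},\partial_{x_2})$. Helical: for $\theta\in\mathbb{R}$ let $R_\theta=\begin{pmatrix}\cos\theta&\sin\theta&0\\-\sin\theta&\cos\theta&0\\0&0&1\end{pmatrix}$ and $S_\theta(x)=R_\theta x+(0,0,\theta)^{\top}$. A vector field $\mathbf{u}$ with values in $\mathbb{R}^3$ is helical if $\mathbf{u}(S_\theta(x))=R_\theta\mathbf{u}(x)$ for all $\theta\in\mathbb{R}$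 (a.e. $x$). *)

(* Defs.v *)
From HB Require Import structures.
From mathcomp Require Import all_boot all_order all_algebra.
From mathcomp Require Import all_classical all_reals all_analysis.

Set Implicit Arguments.
Unset Strict Implicit.
Unset Printing Implicit Defensive.

Import Order.TTheory GRing.Theory Num.Theory.
Import numFieldNormedType.Exports.

Local Open Scope classical_set_scope.
Local Open Scope ring_scope.

(* A point (x1, x2, x3) of the space is ((x1, x2), x3); coordinates are indexed
   from 0, so that x3 is the coordinate of index 2. *)
Notation R3 R := (R * R * R)%type.

Section R3.
Context {R : realType}.
Implicit Types (x : R3 R) (i j : 'I_3).

Definition crd i x : R := [:: x.1.1; x.1.2; x.2]`_i.

Definition basis3 j : R3 R :=
  ((j == 0%N :> nat)%:R, (j == 1%N :> nat)%:R, (j == 2%N :> nat)%:R).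

Definition lebesgue3 : {measure set (R3 (measurableTypeR R)) -> \bar R} :=
  ((lebesgue_measure \x lebesgue_measure) \x lebesgue_measure)%E.

(* The infinite cylinder B_1 * R and the period cell B_1 * [0, 2 pi]. *)
Definition cylinder : set (R3 R) := [set x | x.1.1 ^+ 2 + x.1.2 ^+ 2 < 1].

Definition cell : set (R3 R) :=
  [set x | x.1.1 ^+ 2 + x.1.2 ^+ 2 < 1 /\ 0 <= x.2 <= 2 * pi].

Definition shift3 (t : R) x : R3 R := (x.1, x.2 + t).

Definition rotation (t : R) x : R3 R :=
  (cos t * x.1.1 + sin t * x.1.2, - sin t * x.1.1 + cos t * x.1.2, x.2).

Definition screw (t : R) x : R3 R := shift3 t (rotation t x).

(* The exceptional null set may depend on the angle t. *)
Definition helical (u : R3 R -> R3 R) : Prop :=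
  forall t : R, {ae lebesgue3, forall x, cylinder x ->
    u (screw t x) = rotation t (u x)}.

Definition LpD (p : R) (f : R3 R -> R) : \bar R :=
  Lnorm lebesgue3 p%:E ((EFin \o f) \_ cell).

(* The space L^2 of the cell, its elements being seen as functions on the
   cylinder that are 2 pi-periodic in x3. *)
Definition L2per (f : R3 R -> R) : Prop :=
  [/\ measurable_fun (cylinder : set (R3 (measurableTypeR R))) f,
      {ae lebesgue3, forall x, cylinder x -> f (shift3 (2 * pi) x) = f x} &
      (LpD 2 f < +oo)%E].

Fixpoint Ck (k : nat) (f : R3 R -> R) : Prop :=
  continuous f /\
  if k is k'.+1 then
    forall j, (forall x, derivable f x (basis3 j)) /\
              Ck k' (fun x => 'D_(basis3 j) f x)
  else True.

Definition smooth (f : R3 R -> R) : Prop := forall k, Ck k f.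

Definition test_fun (phi : R3 R -> R) : Prop :=
  [/\ smooth phi, compact (closure [set x | phi x != 0]) &
      closure [set x | phi x != 0] `<=` cylinder].

Definition weak_pderiv (j : 'I_3) (f g : R3 R -> R) : Prop :=
  forall phi, test_fun phi ->
    Rintegral lebesgue3 cylinder (fun x => f x * 'D_(basis3 j) phi x) =
    - Rintegral lebesgue3 cylinder (fun x => g x * phi x).

(* f belongs to H^1 and (df j) is its weak derivative along x_j; df is unique
   up to a null set of the cylinder. *)
Definition in_H1 (f : R3 R -> R) (df : 'I_3 -> R3 R -> R) : Prop :=
  L2per f /\ forall j, L2per (df j) /\ weak_pderiv j f (df j).

(* f (with weak gradient df) has zero trace on the lateral boundary: f is an
   H^1-limit of functions that are smooth up to the boundary and periodic, and
   whose boundary values tend to 0 in L^2 of the lateral boundary, the latter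
   being parametrized by (cos t, sin t, z), of surface element dt dz. *)
Definition zero_trace (f : R3 R -> R) (df : 'I_3 -> R3 R -> R) : Prop :=
  exists v : nat -> R3 R -> R,
    [/\ forall n, smooth (v n) /\ forall x, v n (shift3 (2 * pi) x) = v n x,
        LpD 2 (fun x => v n x - f x) @[n --> \oo] --> 0%E,
        forall j,
          LpD 2 (fun x => 'D_(basis3 j) (v n) x - df j x) @[n --> \oo] --> 0%E &
        Lnorm (@lebesgue_measure R \x @lebesgue_measure R)%E 2%:E
          ((fun tz : R * R => (v n (cos tz.1, sin tz.1, tz.2))%:E)
             \_ (`[0, 2 * pi] `*` `[0, 2 * pi])) @[n --> \oo] --> 0%E].

(* Vector fields u, with du i j the weak derivative of the i-th component
   along x_j. *)
Implicit Types (u : R3 R -> R3 R) (du : 'I_3 -> 'I_3 -> R3 R -> R).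

Definition in_H1v u du : Prop := forall i, in_H1 (crd i \o u) (du i).

Definition zero_trace_v u du : Prop :=
  forall i, zero_trace (crd i \o u) (du i).

(* Pointwise Euclidean norms of the field and of its horizontal gradient. *)
Definition enorm u x : R := Num.sqrt (\sum_(i < 3) crd i (u x) ^+ 2).

Definition hgrad_norm du x : R :=
  Num.sqrt (\sum_(i < 3) \sum_(j < 3 | (j < 2)%N) du i j x ^+ 2).

End R3.

(* Main.v *)
(* Testing the weak derivative against products of one-dimensional bumps shows that
   on almost every line parallel to x1 or x2, a component f of u with derivative d
   satisfies |f(s)^2 - f(t)^2| <= 2 \int |f d|. Averaging over t in the chord bounds
   g = |u|^2 on a horizontal slice of the cell by a function of x2 alone and by a
   function of x1 alone; hence (Loomis-Whitney) the slice integral of g^2 is at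
   most K(z)^2, where K is linear in the slice integrals of g and of |u| |grad_h u|.
   As |u|^4 is invariant under the rotations of the disc, which preserve the
   measure, helicity makes the slice integral of |u|^4 a constant c for almost
   every z. Therefore 2 pi sqrt c <= \int K, and
   2 pi \int |u|^4 = (2 pi sqrt c)^2 <= (\int K)^2 is bounded by Cauchy-Schwarz.

   For fields with zero trace, integrating along x2 up to the upper arc of the
   circle (parametrized by x1 = cos t) gives the Poincare inequality
   ||u|| <= 4 ||d_2 u||, which absorbs the last term of the first estimate. *)
Require Import Defs.
From HB Require Import structures.
From mathcomp Require Import all_boot all_order all_algebra.
From mathcomp Require Import all_classical all_reals all_analysis.
From mathcomp Require Import measurable_realfun ring lra.

Set Implicit Arguments.
Unset Strict Implicit.
Unset Printing Implicit Defensive.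

Import Order.TTheory GRing.Theory Num.Theory.
Import numFieldNormedType.Exports.

Local Open Scope classical_set_scope.
Local Open Scope ring_scope.

(** * Product test functions *)

(** The obstacle is the weight 1 / (2 sqrt (1 - y^2)) that the mean over the chord at height y
    carries: it is unbounded at the poles, so the integral of the averaged bound is not controlled
    by that of g. Beyond |y| = 12/13 the function g is therefore bounded through the other
    direction: such a point of the disc has |x| < 5/13, where the chords along x2 are long and have
    weight at most 13/24. The price is the integral of the weight over the two caps, arccos (12/13)
    < 2/5. With D1, D2 the integrals of the variations and M that of g, the bounds of the two
    directions average to 7/10 (D1 + D2) + 91/60 M, where 7/10 = (1 + 2/5) / 2 and 91/60 = 13/10 +
    2/5 * 13/24. The constant (2 / pi)^(1/4) is reached once the second coefficient is at most 2
    and, because |d_1 u| + |d_2 u| <= sqrt 2 |grad_h u|, the first at most 1 / sqrt 2: the caps may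
    weigh sqrt 2 - 1, and 2/5 is just below. The other concern is null sets. Conditions are imposed
    for rational parameters only, before anything is said almost everywhere, and the null set in
    helicity depends on the angle, so invariance of the slice integrals is exploited through
    Fubini. *)

Section smooth_1d.
Context {R : realType}.
Implicit Types (f g : R -> R) (x : R) (k m : nat).

Lemma is_derive1_continuous f (df : R -> R) :
  (forall x, is_derive x 1 f (df x)) -> continuous f.
Proof.
move=> fd x; apply: differentiable_continuous.
by apply/derivable1_diffP; case: (fd x).
Qed.

(** The derivative is an existential witness instead of [derive1 f], so that smoothness is proved by
    exhibiting derivatives. *)
Fixpoint Ck1 k f : Prop :=
  continuous f /\
  if k is k'.+1 then
    exists2 df : R -> R, (forall x, is_derive x 1 f (df x)) & Ck1 k' df
  else True.

Definition smooth1 f := forall k, Ck1 k f.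

Lemma Ck1S k f (df : R -> R) :
  (forall x, is_derive x 1 f (df x)) -> Ck1 k df -> Ck1 k.+1 f.
Proof.
by move=> fd dfk; split; [exact: is_derive1_continuous fd|exists df].
Qed.

Lemma Ck1W k f : Ck1 k.+1 f -> Ck1 k f.
Proof.
elim: k f => [|k IH] f [fc [df fd dfk]]; first by split.
by split=> //; exists df => //; exact: IH.
Qed.

Lemma Ck1D k f g : Ck1 k f -> Ck1 k g -> Ck1 k (fun x => f x + g x).
Proof.
elim: k f g => [|k IH] f g [fc fk] [gc gk].
  by split=> // x; apply: continuousD; [exact: fc|exact: gc].
case: fk gk => [df fd dfk] [dg gd dgk].
by apply: (@Ck1S _ _ (fun x => df x + dg x)); exact: IH.
Qed.

Lemma Ck1M k f g : Ck1 k f -> Ck1 k g -> Ck1 k (fun x => f x * g x).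
Proof.
elim: k f g => [|k IH] f g.
  by move=> [fc _] [gc _]; split=> // x; apply: continuousM; [exact: fc|exact: gc].
move=> fk gk; have fk' := Ck1W fk; have gk' := Ck1W gk.
case: fk gk => [fc [df fd dfk]] [gc [dg gd dgk]].
apply: (@Ck1S _ _ (fun x => f x * dg x + g x * df x)).
by apply: Ck1D; apply: IH.
Qed.

Lemma Ck1_cst k (c : R) : Ck1 k (fun=> c).
Proof.
elim: k c => [|k IH] c; first by split=> // x; exact: cst_continuous.
by apply: (@Ck1S _ _ (fun=> 0)); exact: IH.
Qed.

Lemma Ck1_affine k f (a b : R) : Ck1 k f -> Ck1 k (fun x => f (a * x + b)).
Proof.
have aff x : is_derive x 1 (fun x : R => a * x + b) a.
  by apply: is_derive_eq; rewrite addr0 -[a *: 1]/(a * 1) mulr1.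
elim: k f => [|k IH] f.
  move=> [fc _]; split=> // x; apply: continuous_comp; last exact: fc.
  exact: (is_derive1_continuous aff).
move=> [fc [df fd dfk]].
apply: (@Ck1S _ _ (fun x => df (a * x + b) * a)).
by apply: Ck1M; [exact: IH|exact: Ck1_cst].
Qed.

(** The classical flat function exp (-1/x) is the case m = 0. The powers of 1/x close the family
    under differentiation up to linear combinations, which turns smoothness into an induction on the
    order, uniform in m. *)
Definition flat m x : R := if 0 < x then x^-1 ^+ m * expR (- x^-1) else 0.

Lemma flat_ge0 m x : 0 <= flat m x.
Proof. by rewrite /flat; case: ifPn => // x0; rewrite mulr_ge0 ?expR_ge0 ?exprn_ge0 ?invr_ge0 ?ltW. Qed.

(** The exponential exp (1/x) dominates the term of degree m + 2 of its series, which absorbs the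
    factor x^(-m) and leaves x^2. A quadratic bound is what makes the derivative at 0 vanish. *)
Lemma flat_le m x : `|flat m x| <= (m.+2)`!%:R * x ^+ 2.
Proof.
rewrite ger0_norm ?flat_ge0// /flat; case: ifPn => [x0|_]; last first.
  by rewrite mulr_ge0 ?sqr_ge0.
have y0 : 0 < x^-1 by rewrite invr_gt0.
have := expR_ge1Dxn m.+1 (ltW y0); set F := _%:R => le1.
have F0 : 0 < F by rewrite ltr0n fact_gt0.
have le2 : x^-1 ^+ m.+2 <= F * expR x^-1.
  by rewrite mulrC -ler_pdivrMr//; apply: le_trans le1; rewrite lerDr.
rewrite expRN ler_pdivrMr ?expR_gt0// mulrAC.
by rewrite -ler_pdivrMr ?exprn_gt0// -exprVn -exprD addn2.
Qed.

Lemma flat_derive m x :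
  is_derive x 1 (flat m) (flat m.+2 x - m%:R * flat m.+1 x).
Proof.
have [x0|x0|x0] := ltgtP x 0.
- rewrite /flat ltNge (ltW x0)/= mulr0 subr0.
  apply: (@near_eq_is_derive _ _ _ (cst 0)).
  near=> y; rewrite /= ltNge ltW//.
  by near: y; exact: lt_nbhsl.
- apply: (@near_eq_is_derive _ _ _ (fun y : R => y^-1 ^+ m * expR (- y^-1))).
    by near=> y; rewrite /flat ifT//; near: y; exact: lt_nbhsr.
  rewrite /flat x0.
  have xN0 : x != 0 by rewrite gt_eqF.
  have dV : is_derive x 1 (fun y : R => y^-1) (- x ^- 2).
    have := @is_deriveV R id x 1 1 xN0 (is_derive_id _ _).
    by move=> h; apply: (is_derive_eq h); rewrite -[_ *: 1]/(_ * 1) mulr1.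
  have dE : is_derive x 1 (fun y : R => expR (- y^-1)) (expR (- x^-1) * x ^- 2).
    have dNV : is_derive x 1 (fun y : R => - y^-1) (x ^- 2).
      by apply: is_derive_eq; rewrite opprK.
    exact: (@is_derive1_comp _ expR (fun y : R => - y^-1) _ _ _ (is_derive_expR _) dNV).
  case: m => [|m].
    rewrite mul0r subr0 exprVn mulrC.
    by rewrite [f in is_derive _ _ f _](_ : _ = fun y : R => expR (- y^-1))//; apply/funext => y; rewrite mul1r.
  have dX : is_derive x 1 (fun y : R => y^-1 ^+ m.+1) (m.+1%:R * x^-1 ^+ m * - x ^- 2).
    have h := @is_deriveX R R (fun y : R => y^-1) m.+1 x 1 _ dV.
    rewrite [f in is_derive _ _ f _](_ : _ = ((fun y : R => y^-1) ^+ m.+1)); last first.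
      by apply/funext => y; rewrite exprfctE.
    exact: (is_derive_eq h).
  apply: (is_derive_eq (is_deriveM dX dE)).
  rewrite -![_ *: _]/(_ * _) /= -!exprVn !exprS expr0; set y := x^-1; set e := expR _.
  by rewrite !mulr_natl; ring.
- rewrite x0 /flat ltxx mulr0 subr0.
  (* At 0 the difference quotient is at most (m + 2)! |h| in absolute value, by the quadratic
     bound. *)
  suff : (h^-1 *: (flat m (h *: (1 : R) + 0) - flat m 0)) @[h --> (0 : R)^'] --> (0 : R).
    move=> cv; apply: DeriveDef.
      by apply/cvg_ex; exists 0; rewrite /flat in cv *.
    by rewrite /derive; apply: cvg_lim => //; rewrite /flat in cv *.
  rewrite {2}/flat ltxx.
  apply/cvgr0Pnorm_le => e e0; near=> h.
  rewrite subr0 addr0 -[h *: 1]/(h * 1) mulr1 -[_ *: _]/(_ * _) normrM normfV.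
  have hN0 : h != 0 by near: h; exact: nbhs_dnbhs_neq.
  rewrite mulrC ler_pdivrMr ?normr_gt0//.
  apply: (le_trans (flat_le _ _)).
  rewrite -[h ^+ 2]real_normK ?num_real// expr2 mulrA.
  rewrite ler_wpM2r// mulrC -ler_pdivlMr ?ltr0n ?fact_gt0//.
  near: h; apply: dnbhs0_le; rewrite divr_gt0// ltr0n fact_gt0//.
Unshelve. all: by end_near. Qed.

Lemma smooth1_flat m : smooth1 (flat m).
Proof.
move=> k; elim: k m => [|k IH] m.
  by split=> //; exact: is_derive1_continuous (flat_derive m).
apply: (Ck1S (flat_derive m)).
have -> : (fun x => flat m.+2 x - m%:R * flat m.+1 x) =
          (fun x => flat m.+2 x + - m%:R * flat m.+1 x).
  by apply/funext => x; rewrite mulNr.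
by apply: Ck1D => //; apply: Ck1M => //; exact: Ck1_cst.
Qed.

(** The scaling by n + 1 replaces a mollification: for every n the function vanishes off (p, q) and
    lies between 0 and 1, and it tends pointwise to the indicator of (p, q), so dominated
    convergence applies. *)
Definition bump (p q : R) (n : nat) x : R :=
  flat 0 (n.+1%:R * (x - p)) * flat 0 (n.+1%:R * (q - x)).

Lemma smooth1_bump p q n : smooth1 (bump p q n).
Proof.
move=> k; apply: Ck1M.
  rewrite [X in Ck1 k X](_ : _ = (fun x => flat 0 (n.+1%:R * x + - (n.+1%:R * p)))).
    by apply: Ck1_affine; exact: smooth1_flat.
  by apply/funext => x; rewrite mulrBr.
rewrite [X in Ck1 k X](_ : _ = (fun x => flat 0 (- n.+1%:R * x + n.+1%:R * q))).
  by apply: Ck1_affine; exact: smooth1_flat.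
by apply/funext => x; rewrite mulrBr mulNr addrC.
Qed.

Lemma flat0_le1 x : flat 0 x <= 1.
Proof.
by rewrite /flat; case: ifPn => // x0; rewrite mul1r expR_le1 oppr_le0 invr_ge0 ltW.
Qed.

Lemma bump_ge0 p q n x : 0 <= bump p q n x.
Proof. by rewrite mulr_ge0 ?flat_ge0. Qed.

Lemma bump_le1 p q n x : bump p q n x <= 1.
Proof. by rewrite mulr_ile1 ?flat_ge0 ?flat0_le1. Qed.

Lemma bump_out p q n x : ~~ (p < x < q) -> bump p q n x = 0.
Proof.
rewrite negb_and -!leNgt => /orP[h|h].
  by rewrite /bump /flat pmulr_rgt0 ?ltr0n// subr_gt0 ltNge h mul0r.
by rewrite /bump /flat [in X in _ * X]pmulr_rgt0 ?ltr0n// subr_gt0 [x < q]ltNge h mulr0.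
Qed.

Lemma flat0_cvg x : 0 < x -> flat 0 (n.+1%:R * x) @[n --> \oo] --> (1 : R).
Proof.
move=> x0.
rewrite (_ : (fun n => _) = (fun n => expR (- (n.+1%:R^-1 * x^-1)))); last first.
  by apply/funext => n; rewrite /flat pmulr_rgt0 ?ltr0n// x0 mul1r invfM.
have h : (- (n.+1%:R^-1 * x^-1)) @[n --> \oo] --> (0 : R).
  rewrite -[X in _ --> X]oppr0 -[X in _ --> - X](mul0r x^-1); apply: cvgN.
  by apply: cvgM; [exact: cvg_harmonic|exact: cvg_cst].
rewrite -[X in _ --> X]expR0.
exact: (cvg_comp _ _ h (@continuous_expR R 0)).
Qed.

Lemma bump_cvg p q x : bump p q n x @[n --> \oo] --> (\1_(`]p, q[) x : R).
Proof.
have [|h] := boolP (p < x < q); last first.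
  rewrite indicE memNset; last by rewrite /= in_itv/= (negbTE h).
  rewrite (_ : (fun n => _) = cst 0); first exact: cvg_cst.
  by apply/funext => n; rewrite bump_out.
move=> /andP[px xq]; rewrite indicE mem_set; last by rewrite /= in_itv/= px xq.
rewrite -[1%:R](mulr1 1).
by apply: cvgM; apply: flat0_cvg; rewrite subr_gt0.
Qed.

End smooth_1d.

Section product_test_functions.
Context {R : realType}.
Implicit Types (A B C : R -> R) (k : nat).

(** A directional derivative sees only the restriction to a line; with [s] the parameter of the base
    point, the two difference quotients are the same function of h. *)
Lemma is_derive_line (V : normedModType R) (f : V -> R) (x v : V) (a : R -> R) (s da : R) :
  (forall h, f (h *: v + x) = a (h + s)) -> is_derive s 1 a da ->
  derivable f x v /\ 'D_v f x = da.
Proof.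
move=> fa [dera <-].
have e : (fun h : R => h^-1 *: ((f \o shift x) (h *: v) - f x)) =
         (fun h : R => h^-1 *: ((a \o shift s) (h *: 1) - a s)).
  apply/funext => h /=; rewrite fa -[h *: 1]/(h * 1) mulr1; congr (_ *: (_ - _)).
  by rewrite -[x]add0r -(scale0r v) fa add0r.
by rewrite /derivable /derive e.
Qed.

Lemma continuous_crd1 : continuous (fun x : R3 R => x.1.1).
Proof. by move=> x; apply: continuous_comp; [exact: cvg_fst|exact: cvg_fst]. Qed.

Lemma continuous_crd2 : continuous (fun x : R3 R => x.1.2).
Proof. by move=> x; apply: continuous_comp; [exact: cvg_fst|exact: cvg_snd]. Qed.

Lemma continuous_crd3 : continuous (fun x : R3 R => x.2).
Proof. by move=> x; exact: cvg_snd. Qed.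

Definition prod3 A B C (x : R3 R) : R := A x.1.1 * B x.1.2 * C x.2.

Lemma prod3_cont A B C : continuous A -> continuous B -> continuous C ->
  continuous (prod3 A B C).
Proof.
move=> Ac Bc Cc x; rewrite /prod3; apply: cvgM.
  apply: cvgM.
    by apply: (@continuous_comp _ _ _ (fun x : R3 R => x.1.1) A); [exact: continuous_crd1|exact: Ac].
  by apply: (@continuous_comp _ _ _ (fun x : R3 R => x.1.2) B); [exact: continuous_crd2|exact: Bc].
by apply: (@continuous_comp _ _ _ (fun x : R3 R => x.2) C); [exact: continuous_crd3|exact: Cc].
Qed.

Lemma prod3_derive1 A B C (dA : R -> R) (x : R3 R) : is_derive x.1.1 1 A (dA x.1.1) ->
  derivable (prod3 A B C) x (basis3 0) /\ 'D_(basis3 0) (prod3 A B C) x = prod3 dA B C x.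
Proof.
move=> dAx; apply: (@is_derive_line _ _ x _ (fun s => A s * B x.1.2 * C x.2) x.1.1).
  move=> h; rewrite /prod3 /basis3 /= -![h *: _]/(h * _) mulr1 !mulr0 !add0r.
  by case: x {dAx} => [[]].
rewrite /prod3; apply: is_derive_eq.
by rewrite !scaler0 !add0r -![_ *: _]/(_ * _) mulrC [B _ * _]mulrC.
Qed.

Lemma prod3_derive2 A B C (dB : R -> R) (x : R3 R) : is_derive x.1.2 1 B (dB x.1.2) ->
  derivable (prod3 A B C) x (basis3 1) /\ 'D_(basis3 1) (prod3 A B C) x = prod3 A dB C x.
Proof.
move=> dBx; apply: (@is_derive_line _ _ x _ (fun s => A x.1.1 * B s * C x.2) x.1.2).
  move=> h; rewrite /prod3 /basis3 /= -![h *: _]/(h * _) mulr1 !mulr0 !add0r.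
  by case: x {dBx} => [[]].
rewrite /prod3; apply: is_derive_eq.
by rewrite !scaler0 !add0r -![_ *: _]/(_ * _) mulrC.
Qed.

Lemma prod3_derive3 A B C (dC : R -> R) (x : R3 R) : is_derive x.2 1 C (dC x.2) ->
  derivable (prod3 A B C) x (basis3 (lift 0 1)) /\
  'D_(basis3 (lift 0 1)) (prod3 A B C) x = prod3 A B dC x.
Proof.
move=> dCx; apply: (@is_derive_line _ _ x _ (fun s => A x.1.1 * B x.1.2 * C s) x.2).
  move=> h; rewrite /prod3 /basis3 /= -![h *: _]/(h * _) mulr1 !mulr0 !add0r.
  by case: x {dCx} => [[]].
Qed.

Lemma ord3P (P : 'I_3 -> Prop) : P 0 -> P 1 -> P (lift 0 1) -> forall j, P j.
Proof.
move=> p0 p1 p2 [[|[|[|//]]] h].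
- by rewrite (_ : Ordinal h = 0)//; exact: val_inj.
- by rewrite (_ : Ordinal h = 1)//; exact: val_inj.
- by rewrite (_ : Ordinal h = lift 0 1)//; exact: val_inj.
Qed.

Lemma Ck_prod3 k A B C : Ck1 k A -> Ck1 k B -> Ck1 k C -> Ck k (prod3 A B C).
Proof.
elim: k A B C => [|k IH] A B C.
  by move=> [Ac _] [Bc _] [Cc _]; split=> //; apply: prod3_cont.
move=> Ak Bk Dk; have Ak' := Ck1W Ak; have Bk' := Ck1W Bk; have Dk' := Ck1W Dk.
case: Ak Bk Dk => [Ac [dA Ad dAk]] [Bc [dB Bd dBk]] [Cc [dC Cd dCk]].
split; first by apply: prod3_cont.
apply: ord3P; split.
- by move=> x; apply: (proj1 (@prod3_derive1 _ _ _ dA x _)); exact: Ad.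
- rewrite (_ : (fun x => _) = prod3 dA B C); first exact: IH.
  by apply/funext => x; apply: (proj2 (@prod3_derive1 _ _ _ dA x _)); exact: Ad.
- by move=> x; apply: (proj1 (@prod3_derive2 _ _ _ dB x _)); exact: Bd.
- rewrite (_ : (fun x => _) = prod3 A dB C); first exact: IH.
  by apply/funext => x; apply: (proj2 (@prod3_derive2 _ _ _ dB x _)); exact: Bd.
- by move=> x; apply: (proj1 (@prod3_derive3 _ _ _ dC x _)); exact: Cd.
- rewrite (_ : (fun x => _) = prod3 A B dC); first exact: IH.
  by apply/funext => x; apply: (proj2 (@prod3_derive3 _ _ _ dC x _)); exact: Cd.
Qed.

(** The support lies in a closed box, hence is compact, and the last hypothesis keeps the horizontal
    base of the box inside the open disc. *)
Lemma prod3_test_fun A B C (a1 b1 a2 b2 a3 b3 : R) :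
  smooth1 A -> smooth1 B -> smooth1 C ->
  (forall s, ~~ (a1 <= s <= b1) -> A s = 0) ->
  (forall s, ~~ (a2 <= s <= b2) -> B s = 0) ->
  (forall s, ~~ (a3 <= s <= b3) -> C s = 0) ->
  (forall s t, a1 <= s <= b1 -> a2 <= t <= b2 -> s ^+ 2 + t ^+ 2 < 1) ->
  test_fun (prod3 A B C).
Proof.
move=> As Bs Cs A0 B0 C0 cyl.
have sub : closure [set x | prod3 A B C x != 0] `<=`
    (`[a1, b1] `*` `[a2, b2]) `*` `[a3, b3].
  rewrite [X in _ `<=` X](closure_id _).1; last first.
    rewrite [X in closed X](_ : _ = [set x : R3 R | a1 <= x.1.1 <= b1] `&`
        [set x : R3 R | a2 <= x.1.2 <= b2] `&` [set x : R3 R | a3 <= x.2 <= b3]); last first.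
      by apply/seteqP; split=> x /= [[]]; rewrite !in_itv.
    have e (f : R3 R -> R) a b : [set x | a <= f x <= b] = f @^-1` `[a, b].
      by apply/seteqP; split=> x /=; rewrite in_itv.
    rewrite !e; apply: closedI; first apply: closedI.
    - by apply: (preimage_closed (f := fun x : R3 R => x.1.1) (D := `[a1, b1])) => [x _|]; [exact: continuous_crd1|exact: itv_closed].
    - by apply: (preimage_closed (f := fun x : R3 R => x.1.2) (D := `[a2, b2])) => [x _|]; [exact: continuous_crd2|exact: itv_closed].
    - by apply: (preimage_closed (f := fun x : R3 R => x.2) (D := `[a3, b3])) => [x _|]; [exact: continuous_crd3|exact: itv_closed].
  apply: closure_subset => x /=; rewrite /prod3 => x0.
  split; [split|]; rewrite /= in_itv /=; apply: contra_neqT x0.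
  - by move=> /A0 ->; rewrite !mul0r.
  - by move=> /B0 ->; rewrite mulr0 mul0r.
  - by move=> /C0 ->; rewrite mulr0.
split.
- by move=> k; apply: Ck_prod3.
- apply: (subclosed_compact _ _ sub); first exact: closed_closure.
  by apply: compact_setX; [apply: compact_setX|]; exact: segment_compact.
- by move=> x /sub [[/=]]; rewrite !in_itv/= /cylinder/= => + + _; exact: cyl.
Qed.

End product_test_functions.

(** * Weak derivatives on the line *)

Section ae_tools.

Lemma ae_imply d (T : measurableType d) (R : realType)
    (mu : {measure set T -> \bar R}) (P Q : T -> Prop) :
  (forall x, P x -> Q x) -> {ae mu, forall x, P x} -> {ae mu, forall x, Q x}.
Proof. by move=> PQ; apply: filterS. Qed.

Lemma ae_imply2 d (T : measurableType d) (R : realType)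
    (mu : {measure set T -> \bar R}) (P Q S : T -> Prop) :
  (forall x, P x -> Q x -> S x) ->
  {ae mu, forall x, P x} -> {ae mu, forall x, Q x} -> {ae mu, forall x, S x}.
Proof. by move=> PQS; apply: filterS2. Qed.

Lemma ae_forall_count d (T : measurableType d) (R : realType)
    (mu : {measure set T -> \bar R}) (I : countType) (P : I -> T -> Prop) :
  (forall i, {ae mu, forall x, P i x}) -> {ae mu, forall x, forall i, P i x}.
Proof.
move=> aeP.
have /ae_foralln : forall n, {ae mu, forall x, if @unpickle I n is Some i then P i x else True}.
  by move=> n; case: unpickle => [i|]; [exact: aeP|exact: aeW].
by apply: filterS => x Px i; have := Px (pickle i); rewrite pickleK.
Qed.

Context d1 d2 (T1 : measurableType d1) (T2 : measurableType d2) (R : realType).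
Variables (m1 : {sigma_finite_measure set T1 -> \bar R}).
Variables (m2 : {sigma_finite_measure set T2 -> \bar R}).
Local Open Scope ereal_scope.

(** The product measure is defined by integrating the measures of the sections at fixed x; Tonelli
    for an indicator gives the other order. *)
Lemma product_measure_ysection (N : set (T1 * T2)) : measurable N ->
  (m1 \x m2) N = \int[m2]_y (m1 (ysection N y)).
Proof.
move=> mN.
have := @indic_fubini_tonelli2 _ _ _ _ _ m1 m2 N mN.
have := @indic_fubini_tonelli _ _ _ _ _ m1 m2 N mN.
have := @indic_fubini_tonelli1 _ _ _ _ _ m1 m2 N mN.
rewrite integral_indic// setIT => -> -> _.
by rewrite indic_fubini_tonelli_GE.
Qed.

Lemma ae_ysection (P : T1 * T2 -> Prop) : {ae m1 \x m2, forall x, P x} ->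
  {ae m2, forall y, {ae m1, forall x, P (x, y)}}.
Proof.
move=> [N [mN N0 PN]].
have m0 : \int[m2]_y (m1 (ysection N y)) = 0.
  by rewrite -product_measure_ysection.
have : ae_eq m2 setT (fun y => m1 (ysection N y)) (cst 0).
  apply/ae_eq_integral_abs => //; first exact: measurable_fun_ysection.
  by under eq_integral do rewrite gee0_abs//.
apply: filterS => y /= /(_ I) yN; exists (ysection N y); split=> //.
  exact: measurable_ysection.
by move=> x /= Px; rewrite /ysection/= inE; exact: PN.
Qed.

Lemma ae_xsection (P : T1 * T2 -> Prop) : {ae m1 \x m2, forall x, P x} ->
  {ae m1, forall x, {ae m2, forall y, P (x, y)}}.
Proof.
move=> [N [mN N0 PN]].
have : ae_eq m1 setT (fun x => m2 (xsection N x)) (cst 0).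
  apply/ae_eq_integral_abs => //; first exact: measurable_fun_xsection.
  by under eq_integral do rewrite gee0_abs//.
apply: filterS => x /= /(_ I) xN; exists (xsection N x); split=> //.
  exact: measurable_xsection.
by move=> y /= Py; rewrite /xsection/= inE; exact: PN.
Qed.

End ae_tools.

Section primitives.
Context {R : realType}.
Local Notation lam := (@lebesgue_measure R).
Implicit Types (v w h : R -> R).

Definition prim v (r : R) : R := \int[lam]_(q in `]-oo, r]) v q.

Lemma integrable_itvT v (i : interval R) :
  lam.-integrable setT (EFin \o v) -> lam.-integrable [set` i] (EFin \o v).
Proof. by apply: integrableS. Qed.

Lemma primE v r : prim v r = \int[lam]_q (v q * (q <= r)%R%:R).
Proof.
rewrite /prim Rintegral_mkcond; apply: eq_Rintegral => q _.
by rewrite patchE mem_setE in_itv/=; case: ifP; rewrite ?mulr1 ?mulr0.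
Qed.

Lemma prim_ltE v r : lam.-integrable setT (EFin \o v) ->
  prim v r = \int[lam]_q (v q * (q < r)%R%:R).
Proof.
move=> vi; rewrite /prim -Rintegral_itv_bndo_bndc; last exact: integrable_itvT.
rewrite Rintegral_mkcond; apply: eq_Rintegral => q _.
by rewrite patchE mem_setE in_itv/=; case: ifP; rewrite ?mulr1 ?mulr0.
Qed.

Lemma integrable_prod v w :
  lam.-integrable setT (EFin \o v) -> lam.-integrable setT (EFin \o w) ->
  (lam \x lam)%E.-integrable setT (fun x => (v x.1 * w x.2)%:E).
Proof.
move=> vi wi.
have mv : measurable_fun setT v by apply/measurable_EFinP; exact: measurable_int vi.
have mw : measurable_fun setT w by apply/measurable_EFinP; exact: measurable_int wi.
apply/integrable12ltyP.
  by apply/measurable_EFinP; apply: measurable_funM; apply: measurableT_comp.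
under eq_integral => x _.
  under eq_integral => y _ do rewrite /= normrM EFinM.
  rewrite ge0_integralZl//; last by apply/measurable_EFinP; apply: measurableT_comp.
  over.
rewrite ge0_integralZr//; last 2 first.
  - by apply/measurable_EFinP; apply: measurableT_comp.
  - exact: integral_ge0.
by apply: lte_mul_pinfty; [exact: integral_ge0| |];
  [rewrite ge0_fin_numE; [by case/integrableP: vi|exact: integral_ge0]|case/integrableP: wi].
Qed.

Lemma measurable_le2 : measurable [set x : R * R | x.1 <= x.2].
Proof.
rewrite (_ : [set x | _] = (fun x : R * R => x.2 - x.1) @^-1` `[0, +oo[).
  by rewrite -[X in measurable X]setTI; apply: measurable_funB => //.
by apply/seteqP; split=> x /=; rewrite in_itv/= andbT subr_ge0.
Qed.

(* Fubini on the two halves of the plane cut along the diagonal. *)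
Lemma prim_by_parts v w :
  lam.-integrable setT (EFin \o v) -> lam.-integrable setT (EFin \o w) ->
  \int[lam]_r (prim v r * w r) + \int[lam]_r (v r * prim w r) =
  (\int[lam]_r v r) * (\int[lam]_r w r).
Proof.
move=> vi wi; have vwi := integrable_prod vi wi.
have mv : measurable_fun setT v by apply/measurable_EFinP; exact: measurable_int vi.
have mw : measurable_fun setT w by apply/measurable_EFinP; exact: measurable_int wi.
pose f1 (x : R * R) := v x.1 * w x.2 * (x.1 <= x.2)%R%:R.
pose f2 (x : R * R) := v x.1 * w x.2 * (x.2 < x.1)%R%:R.
have ind1 : (fun x : R * R => (x.1 <= x.2)%R%:R) = \1_[set x : R * R | x.1 <= x.2] :> (_ -> R).
  apply/funext => x; rewrite indicE; case: (boolP (x.1 <= x.2)) => h.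
    by rewrite mem_set.
  by rewrite memNset//; exact/negP.
have ind2 : (fun x : R * R => (x.2 < x.1)%R%:R) = \1_(~` [set x : R * R | x.1 <= x.2]) :> (_ -> R).
  apply/funext => x; rewrite indicE ltNge; case: (boolP (x.1 <= x.2)) => h.
    by rewrite memNset.
  by rewrite mem_set//; exact/negP.
have mf1 : measurable_fun setT f1.
  apply: measurable_funM.
    by apply: measurable_funM; apply: measurableT_comp.
  rewrite ind1; apply: measurable_indic; exact: measurable_le2.
have mf2 : measurable_fun setT f2.
  apply: measurable_funM.
    by apply: measurable_funM; apply: measurableT_comp.
  rewrite ind2; apply: measurable_indic; apply: measurableC; exact: measurable_le2.
have f1i : (lam \x lam)%E.-integrable setT (EFin \o f1).
  apply: (le_integrable measurableT _ _ vwi).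
    exact/measurable_EFinP.
  by move=> x _ /=; rewrite lee_fin /f1; case: (x.1 <= x.2); rewrite ?mulr1 ?mulr0 ?normr0 ?normr_ge0.
have f2i : (lam \x lam)%E.-integrable setT (EFin \o f2).
  apply: (le_integrable measurableT _ _ vwi).
    exact/measurable_EFinP.
  by move=> x _ /=; rewrite lee_fin /f2; case: (_ < _); rewrite ?mulr1 ?mulr0 ?normr0 ?normr_ge0.
have e1 : \int[lam]_r (prim v r * w r) = \int[(lam \x lam)%E]_x f1 x.
  rewrite /Rintegral; apply: (congr1 fine); rewrite -integral21_prod_meas1//.
  apply: eq_integral => r _; rewrite /fubini_G /f1/= primE EFinM.
  have vri : lam.-integrable setT (EFin \o (fun q => v q * (q <= r)%R%:R)).
    apply: (le_integrable measurableT _ _ vi) => //=.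
      apply/measurable_EFinP; apply: measurable_funM => //.
      rewrite (_ : (fun q => _) = \1_`]-oo, r]) ?measurable_indic//.
      by apply/funext => q; rewrite indicE mem_setE in_itv.
    by move=> x _ /=; rewrite lee_fin; case: (x <= r); rewrite ?mulr1 ?mulr0 ?normr0 ?normr_ge0.
  rewrite /Rintegral fineK ?(integrable_fin_num _ vri)//.
  rewrite -integralZr//; apply: eq_integral => q _; rewrite -EFinM; congr EFin.
  by rewrite mulrAC.
have e2 : \int[lam]_r (v r * prim w r) = \int[(lam \x lam)%E]_x f2 x.
  rewrite /Rintegral; apply: (congr1 fine); rewrite -integral12_prod_meas1//.
  apply: eq_integral => r _; rewrite /fubini_F /f2/= prim_ltE// EFinM.
  have wri : lam.-integrable setT (EFin \o (fun q => w q * (q < r)%R%:R)).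
    apply: (le_integrable measurableT _ _ wi) => //=.
      apply/measurable_EFinP; apply: measurable_funM => //.
      rewrite (_ : (fun q => _) = \1_`]-oo, r[) ?measurable_indic//.
      by apply/funext => q; rewrite indicE mem_setE in_itv.
    by move=> x _ /=; rewrite lee_fin; case: (_ < _); rewrite ?mulr1 ?mulr0 ?normr0 ?normr_ge0.
  rewrite /Rintegral fineK ?(integrable_fin_num _ wri)//.
  rewrite -integralZl//; apply: eq_integral => q _; rewrite -EFinM; congr EFin.
  by rewrite mulrA.
rewrite e1 e2 -RintegralD//.
rewrite (_ : (fun x => f1 x + f2 x) = fun x => v x.1 * w x.2); last first.
  apply/funext => x; rewrite /f1 /f2 -mulrDr ltNge.
  by case: (x.1 <= x.2); rewrite ?addr0 ?add0r mulr1.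
rewrite /Rintegral -integral12_prod_meas1// -fineM ?(integrable_fin_num _ vi) ?(integrable_fin_num _ wi)//.
apply: (congr1 fine).
have wf := integrable_fin_num measurableT wi.
rewrite -[in RHS](fineK wf) -integralZr//.
apply: eq_integral => x _; rewrite /fubini_F/= (fineK wf) -integralZl//.
Qed.

End primitives.

(* The library's canonical sigma-finite structure on [\x] is keyed on products of
   sub-probabilities only. *)
Section product_sigma_finite.
Context d1 d2 (T1 : measurableType d1) (T2 : measurableType d2) (R : realType).
Variable m1 : {sigma_finite_measure set T1 -> \bar R}.
Variable m2 : {sigma_finite_measure set T2 -> \bar R}.
Local Open Scope ereal_scope.

Lemma sigma_finite_prod : sigma_finite setT (m1 \x m2).
Proof.
have /sigma_finiteP[F [FT Fnd Foo]] := sigma_finiteT m1.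
have /sigma_finiteP[G [GT Gnd Goo]] := sigma_finiteT m2.
exists (fun n => F n `*` G n); last first.
  move=> n; have [mF Fy] := Foo n; have [mG Gy] := Goo n.
  split; first exact: measurableX.
  by rewrite product_measure1E// lte_mul_pinfty// ge0_fin_numE.
apply/seteqP; split=> // -[x y] _.
have [i _ Fx] : (\bigcup_n F n) x by rewrite -FT.
have [j _ Gy] : (\bigcup_n G n) y by rewrite -GT.
exists (maxn i j) => //; split=> /=.
  by have /subsetPset := Fnd _ _ (leq_maxl i j); apply.
by have /subsetPset := Gnd _ _ (leq_maxr i j); apply.
Qed.

Definition prod_sf : {sigma_finite_measure set (T1 * T2)%type -> \bar R} :=
  HB.pack_for {sigma_finite_measure set (T1 * T2)%type -> \bar R} (m1 \x m2)
   (Measure_isSigmaFinite.Build _ _ _ (m1 \x m2) sigma_finite_prod).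
End product_sigma_finite.

Definition plane_measure (R : realType) :
    {sigma_finite_measure set (measurableTypeR R * measurableTypeR R)%type -> \bar R} :=
  prod_sf (@lebesgue_measure R) (@lebesgue_measure R).

Section primitives_of_integrable.
Context {R : realType}.
Local Notation lam := (@lebesgue_measure R).
Implicit Types (v w h : R -> R).

Lemma prim_sub v p q : p <= q -> lam.-integrable setT (EFin \o v) ->
  prim v q - prim v p = \int[lam]_x (v x * \1_`]p, q[ x).
Proof.
move=> pq vi.
rewrite /prim Rintegral_itvB; first last.
- by rewrite bnd_simp.
- by [].
- exact: integrable_itvT.
rewrite -Rintegral_itv_bndo_bndc; last exact: integrable_itvT.
rewrite Rintegral_mkcond; apply: eq_Rintegral => x _.
by rewrite patchE indicE; case: ifP; rewrite ?mulr1 ?mulr0.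
Qed.

Lemma prim_continuous v : lam.-integrable setT (EFin \o v) -> continuous (prim v).
Proof.
move=> vi x.
have xx : x - 1 < x + 1 by rewrite ltrBlDr -addrA ltrDl addr_gt0.
have := parameterized_integral_continuous (ltW xx) (integrable_itvT `[x - 1, x + 1] vi).
move/(continuous_within_itvP _ xx) => [+ _ _] => /(_ x).
rewrite in_itv/= ltrBlDr ltrDl ltr01 => /(_ isT) cx.
have : {for x, continuous (fun y => prim v (x - 1) + parameterized_integral lam (x - 1) y v)}.
  by apply: continuousD; [exact: cst_continuous|exact: cx].
have e y : x - 1 <= y -> prim v y = prim v (x - 1) + parameterized_integral lam (x - 1) y v.
  move=> xy; apply/eqP; rewrite addrC -subr_eq; apply/eqP.
  rewrite /prim Rintegral_itvB; first last.
  - by rewrite bnd_simp.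
  - by [].
  - exact: integrable_itvT.
  by rewrite Rintegral_itv_obnd_cbnd//; exact: integrable_itvT.
rewrite /continuous_at => cp; rewrite (e x); last by rewrite lerBlDr lerDl.
apply: cvg_trans cp.
apply: near_eq_cvg; near=> y; apply/esym/e.
by apply: ltW; near: y; apply: lt_nbhsr; rewrite ltrBlDr ltrDl.
Unshelve. all: by end_near. Qed.

Lemma prim_ae_derive v : lam.-integrable setT (EFin \o v) ->
  {ae lam, forall x, derivable (prim v) x 1 /\ derive1 (prim v) x = v x}.
Proof.
move=> vi; apply: FTC1Ny; first by move=> y; exact: integrable_itvT.
by have := integrable_locally measurableT vi; rewrite patch_setT.
Qed.

(** The continuous primitive of [h] takes one value at all rationals of (a, b), hence is constant
    there by density, and Lebesgue differentiation recovers [h] almost everywhere as its derivative.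
    Rational endpoints keep the hypothesis a countable family of conditions. *)
Lemma ae_eq0_rat_itv h (a b : R) : lam.-integrable setT (EFin \o h) ->
  (forall p q : rat, a < ratr p -> ratr p < ratr q :> R -> ratr q < b ->
     \int[lam]_x (h x * \1_`]ratr p, ratr q[ x) = 0) ->
  {ae lam, forall x, a < x < b -> h x = 0}.
Proof.
move=> hi h0; have hc := prim_continuous hi.
have hrat (p q : rat) : a < ratr p < b -> a < ratr q < b -> prim h (ratr p) = prim h (ratr q).
  wlog pq : p q / ratr p <= ratr q :> R.
    move=> H pab qab; have [|/ltW] := leP (ratr p : R) (ratr q); first by move/H; exact.
    by move/H => ->.
  move=> /andP[ap _] /andP[_ qb]; apply/esym/eqP; rewrite -subr_eq0 prim_sub//.
  move: pq; rewrite le_eqVlt => /orP[/eqP ->|pq]; last by rewrite h0.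
  rewrite set_itvoo0 indic0; apply/eqP; rewrite (_ : (fun x => _) = cst 0).
    by rewrite Rintegral_cst// mul0r.
  by apply/funext => x; rewrite mulr0.
have hcst (p : rat) x : a < ratr p < b -> a < x < b -> prim h x = prim h (ratr p).
  (* A value at x different from that at p would persist on a neighbourhood of x, which contains a
     rational. *)
  move=> pab xab; apply: contrapT => /eqP ne.
  case/andP: (xab) => ax xb.
  have nz : \forall y \near x, prim h y - prim h (ratr p) != 0.
    have hcx : (prim h y - prim h (ratr p)) @[y --> x] --> prim h x - prim h (ratr p).
      by apply: cvgB; [exact: hc|exact: cvg_cst].
    by apply: (cvgr_neq0 _ hcx); rewrite subr_eq0.
  have : \forall y \near x, (a < y < b) /\ prim h y != prim h (ratr p).
    near=> y; split; last by rewrite -subr_eq0; near: y; exact: nz.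
    by apply/andP; split; near: y; [exact: lt_nbhsr|exact: lt_nbhsl].
  move/nbhs_interior => /nbhs_singleton xU.
  have [y [/interior_subset[qab nq] [q _ qE]]] := dense_rat (ex_intro _ x xU) (open_interior _).
  by move: nq; rewrite -qE (hrat q p) ?eqxx// qE.
apply: ae_imply (prim_ae_derive hi) => x [_ <-] xab.
have [p pab] : exists p : rat, a < ratr p < b.
  have [q /itvP qx] := @rat_in_itvoo R a b (lt_trans (proj1 (andP xab)) (proj2 (andP xab))).
  by exists q; rewrite !qx.
rewrite derive1E.
case/andP: (xab) => ax xb.
have : is_derive x 1 (prim h) 0.
  apply: (@near_eq_is_derive _ _ _ (cst (prim h (ratr p)))).
  near=> y; rewrite (hcst p)//.
  by apply/andP; split; near: y; [exact: lt_nbhsr|exact: lt_nbhsl].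
by move=> hd; rewrite derive_val.
Unshelve. all: by end_near. Qed.

End primitives_of_integrable.

Section lines.
Context {R : realType}.
Local Notation lam := (@lebesgue_measure R).
Implicit Types (f v w h : R -> R) (rho t : R).

Definition haar rho t (x : R) : R :=
  2 * rho * \1_`]- rho, t[ x - (t + rho) * \1_`]- rho, rho[ x.

Lemma Rintegrable_indic (a b : R) : lam.-integrable setT (EFin \o \1_`]a, b[).
Proof. exact: integrable_indic_itv. Qed.

Lemma Rintegral_indic (a b : R) : a <= b -> \int[lam]_x \1_`]a, b[ x = b - a.
Proof.
move=> ab; transitivity (fine (lam `]a, b[)).
  by rewrite /Rintegral integral_indic// setIT.
rewrite lebesgue_measure_itv/= lte_fin.
by move: ab; rewrite le_eqVlt => /orP[/eqP ->|->//]; rewrite ltxx subrr.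
Qed.

Lemma RintegrableZl (k : R) v : lam.-integrable setT (EFin \o v) ->
  lam.-integrable setT (EFin \o (fun x => k * v x)).
Proof. by move=> vi; have := integrableZl measurableT k vi. Qed.

Lemma RintegrableB v w : lam.-integrable setT (EFin \o v) ->
  lam.-integrable setT (EFin \o w) -> lam.-integrable setT (EFin \o (fun x => v x - w x)).
Proof. by move=> vi wi; have := integrableB measurableT vi wi. Qed.

Lemma RintegrableMb v w (M : R) : lam.-integrable setT (EFin \o v) ->
  measurable_fun setT w -> (forall x, `|w x| <= M) ->
  lam.-integrable setT (EFin \o (fun x => v x * w x)).
Proof.
move=> vi mw wM.
have mv : measurable_fun setT v by apply/measurable_EFinP; exact: measurable_int vi.
apply: (le_integrable measurableT _ _ (RintegrableZl M vi)).
- by apply/measurable_EFinP; exact: measurable_funM.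
- move=> x _ /=; rewrite lee_fin !normrM mulrC; apply: ler_wpM2r => //.
  by apply: le_trans (wM x) (ler_norm _).
Qed.

Lemma integrable_haar rho t : lam.-integrable setT (EFin \o haar rho t).
Proof. by apply: RintegrableB; apply: RintegrableZl; exact: Rintegrable_indic. Qed.

Lemma haar_le rho t x : - rho <= t <= rho -> `|haar rho t x| <= 4 * rho.
Proof.
move=> /andP[rt tr]; have r0 : 0 <= rho by lra.
rewrite /haar; rewrite !indicE; do 2 case: (_ \in _); rewrite ?mulr1 ?mulr0 ler_norml; lra.
Qed.

Lemma haar_integral0 rho t : - rho <= t <= rho -> \int[lam]_x haar rho t x = 0.
Proof.
move=> /andP[rt tr]; have r0 : 0 <= rho by lra.
have := integrable_haar rho t.
rewrite /haar => _; rewrite RintegralB//; last 2 first.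
- by apply: RintegrableZl; exact: Rintegrable_indic.
- by apply: RintegrableZl; exact: Rintegrable_indic.
rewrite !RintegralZl//; [|exact: Rintegrable_indic|exact: Rintegrable_indic].
rewrite !Rintegral_indic//; [ring|lra].
Qed.

Lemma prim_le v r : lam.-integrable setT (EFin \o v) ->
  `|prim v r| <= \int[lam]_x `|v x|.
Proof.
move=> vi; rewrite primE.
have i : lam.-integrable setT (EFin \o (fun q => v q * (q <= r)%R%:R)).
  apply: (@RintegrableMb _ _ 1) => //.
    rewrite (_ : (fun q => _) = \1_`]-oo, r]) ?measurable_indic//.
    by apply/funext => q; rewrite indicE mem_setE in_itv.
  by move=> x; case: (x <= r); rewrite ?normr1 ?normr0.
apply: (le_trans (le_normr_Rintegral _ i)) => //.
apply: le_Rintegral => //; [exact: integrable_norm i|exact: integrable_norm vi|].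
by move=> x _; case: (x <= r); rewrite ?mulr1// mulr0 normr0.
Qed.

(* [haar rho t] is, up to scaling, the derivative of the tent function with
   vertex t on (-rho, rho), so that the hypothesis is the weak form of f' = v. *)
Lemma line_representation f v rho : 0 < rho ->
  lam.-integrable setT (EFin \o f) -> lam.-integrable setT (EFin \o v) ->
  (forall t : rat, - rho < ratr t < rho ->
     \int[lam]_x (f x * haar rho (ratr t) x + v x * prim (haar rho (ratr t)) x) = 0) ->
  exists c, {ae lam, forall x, - rho < x < rho -> f x = c + prim v x}.
Proof.
move=> rho0 fi vi fv.
have mv : measurable_fun setT (prim v).
  by apply: continuous_measurable_fun; exact: prim_continuous.
pose J : R -> R := \1_`]- rho, rho[.
have mJ : measurable_fun setT J by apply: measurable_indic.
have Jle x : `|J x| <= 1 by rewrite /J indicE; case: (_ \in _); rewrite ?normr1 ?normr0.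
(* Once the primitive of [v] is subtracted, the weak equation says that [k] is orthogonal to every
   Haar function, that is, has the same mean on each (-rho, t); [c] below is this mean. *)
pose k x := (f x - prim v x) * J x.
have PJi : lam.-integrable setT (EFin \o (fun x => J x * prim v x)).
  apply: (RintegrableMb _ mv) => [|x]; [exact: Rintegrable_indic|exact: prim_le].
have ki : lam.-integrable setT (EFin \o k).
  rewrite (_ : k = fun x => f x * J x - J x * prim v x).
    apply: RintegrableB => //; exact: (RintegrableMb fi mJ Jle).
  by apply/funext => x; rewrite /k mulrBl [J x * _]mulrC.
pose c := (\int[lam]_x k x) / (2 * rho).
have kcJi : lam.-integrable setT (EFin \o (fun x => k x - c * J x)).
  by apply: RintegrableB => //; apply: RintegrableZl; exact: Rintegrable_indic.
have kt (t : rat) : - rho < ratr t < rho ->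
    \int[lam]_x ((k x - c * J x) * \1_`]- rho, ratr t[ x) = 0.
  move=> tr; have tr' : - rho <= ratr t <= rho by case/andP: tr => /ltW -> /ltW ->.
  have hi := integrable_haar rho (ratr t).
  have mh : measurable_fun setT (haar rho (ratr t)).
    by apply/measurable_EFinP; exact: measurable_int hi.
  have mph : measurable_fun setT (prim (haar rho (ratr t))).
    by apply: continuous_measurable_fun; exact: prim_continuous.
  (* The zero mean of the Haar function kills the product term of the integration by parts, so
     pairing [v] with the tent is minus pairing [prim v] with the Haar function. *)
  have := fv t tr; have := prim_by_parts vi hi.
  rewrite haar_integral0// mulr0.
  have pvi : lam.-integrable setT (EFin \o (fun x => prim v x * haar rho (ratr t) x)).
    rewrite (_ : (fun x => _) = (fun x => haar rho (ratr t) x * prim v x)).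
      by apply: (RintegrableMb hi mv) => x; exact: prim_le.
    by apply/funext => x; rewrite mulrC.
  have vpi : lam.-integrable setT (EFin \o (fun x => v x * prim (haar rho (ratr t)) x)).
    by apply: (RintegrableMb vi mph) => x; exact: prim_le.
  have fhi : lam.-integrable setT (EFin \o (fun x => f x * haar rho (ratr t) x)).
    by apply: (RintegrableMb fi mh) => x; exact: haar_le.
  rewrite RintegralD// => e1 e2.
  have {e1 e2} : \int[lam]_x (f x * haar rho (ratr t) x - prim v x * haar rho (ratr t) x) = 0.
    rewrite RintegralB//; lra.
  have It : lam.-integrable setT (EFin \o \1_`]- rho, ratr t[) by exact: Rintegrable_indic.
  have kti : lam.-integrable setT (EFin \o (fun x => (k x - c * J x) * \1_`]- rho, ratr t[ x)).
    apply: (@RintegrableMb _ _ 1) => // x.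
    by rewrite indicE; case: (_ \in _); rewrite ?normr1 ?normr0.
  rewrite (_ : (fun x => _) =
      (fun x => 2 * rho * ((k x - c * J x) * \1_`]- rho, ratr t[ x) +
         (2 * rho * c * \1_`]- rho, ratr t[ x - (ratr t + rho) * k x))); last first.
    apply/funext => x; rewrite /haar -/(J x) /k.
    have : \1_`]- rho, ratr t[ x = 0 :> R \/ (\1_`]- rho, ratr t[ x = 1 :> R /\ J x = 1).
      rewrite /J !indicE; case: (boolP (x \in `]- rho, ratr t[%classic)) => h; last by left.
      right; split=> //; rewrite mem_set//.
      move: h; rewrite inE/= !in_itv/= => /andP[-> /lt_trans]; apply.
      by case/andP: tr.
    by case=> [->|[-> ->]]; ring.
  rewrite RintegralD//; last 2 first.
  - exact: RintegrableZl.
  - by apply: RintegrableB; exact: RintegrableZl.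
  rewrite RintegralB//; [|exact: RintegrableZl|exact: RintegrableZl].
  rewrite !RintegralZl// Rintegral_indic; last by case/andP: tr'.
  have -> : 2 * rho * c = \int[lam]_x k x by rewrite /c mulrC divfK// mulf_neq0// gt_eqF.
  rewrite opprK [X in _ + X](_ : _ = 0) ?addr0; last by ring.
  by move/eqP; rewrite mulf_eq0 mulf_eq0 pnatr_eq0/= (gt_eqF rho0)/= => /eqP.
exists c.
have := @ae_eq0_rat_itv _ (fun x => k x - c * J x) (- rho) rho kcJi.
have tmp : forall p q : rat, - rho < ratr p -> ratr p < ratr q :> R -> ratr q < rho ->
     \int[lam]_x ((k x - c * J x) * \1_`]ratr p, ratr q[ x) = 0.
  move=> p q rp pq qr.
  rewrite -prim_sub ?ltW//.
  have := kt p; rewrite rp (lt_trans pq qr) => /(_ isT).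
  have := kt q; rewrite qr (lt_trans rp pq) => /(_ isT).
  rewrite -!prim_sub//; [lra|exact: ltW|by apply: ltW; exact: lt_trans rp pq].
move/(_ tmp); apply: ae_imply => x /[swap] xr /(_ xr).
rewrite /k /J indicE mem_set; last by rewrite /= in_itv.
by rewrite !mulr1 => /eqP; rewrite subr_eq0 subr_eq => /eqP.
Qed.

(** The fundamental theorem for f^2 without a chain rule: with w = v on (s, t) and 0 elsewhere,
    integrating w by parts against itself gives (f t - f s)^2 = 2 \int w (f - f s), and expanding
    leaves f t^2 - f s^2 = 2 \int w f. The bound is an extended real because integrability of [f]
    and [v] does not give that of their product. *)
Lemma line_sqr_le f v (rho c s t : R) :
  lam.-integrable setT (EFin \o f) -> lam.-integrable setT (EFin \o v) ->
  {ae lam, forall x, - rho < x < rho -> f x = c + prim v x} ->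
  - rho < s < rho -> - rho < t < rho -> f s = c + prim v s -> f t = c + prim v t ->
  (`|f t ^+ 2 - f s ^+ 2|%:E <= 2%:E * \int[lam]_x `|f x * v x|%:E)%E.
Proof.
move=> fi vi fv; have mf : measurable_fun setT f by apply/measurable_EFinP; exact: measurable_int fi.
have mv : measurable_fun setT v by apply/measurable_EFinP; exact: measurable_int vi.
have mpv : measurable_fun setT (prim v).
  by apply: continuous_measurable_fun; exact: prim_continuous.
wlog st : s t / s <= t.
  move=> H sr tr fs ft; have [|/ltW] := leP s t; first by move/H => /(_ sr tr fs ft).
  by move/H => /(_ tr sr ft fs); rewrite distrC.
move=> /andP[rs _] /andP[_ tr] -> ->.
pose w x := v x * \1_`]s, t[ x.
have wi : lam.-integrable setT (EFin \o w).
  apply: (@RintegrableMb _ _ 1) => // x.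
  by rewrite indicE; case: (_ \in _); rewrite ?normr1 ?normr0.
have mw : measurable_fun setT w by apply/measurable_EFinP; exact: measurable_int wi.
have := prim_by_parts wi wi; rewrite {3 4}/w -prim_sub//.
have pw r : prim w r * w r = (prim v r - prim v s) * w r.
  rewrite /w indicE; case: (boolP (r \in _)) => [|_]; last by rewrite !mulr0.
  rewrite inE/= in_itv/= => /andP[sr rt]; congr (_ * _).
  rewrite prim_sub ?(ltW sr)// prim_ltE//; apply: eq_Rintegral => q _.
  rewrite -mulrA; congr (_ * _); rewrite !indicE !mem_setE !in_itv/=.
  have [qr|] := ltP q r; last by rewrite andbF mulr0.
  by rewrite (lt_trans qr rt) !andbT mulr1.
have wpi : lam.-integrable setT (EFin \o (fun x => w x * (c + prim v x))).
  apply: (@RintegrableMb _ _ (`|c| + \int[lam]_x `|v x|)) => //.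
    by apply: measurable_funD.
  by move=> x; apply: (le_trans (ler_normD _ _)); rewrite lerD2l prim_le.
rewrite [X in X + _](_ : _ = \int[lam]_x (w x * (c + prim v x) - (c + prim v s) * w x)); last first.
  by apply: eq_Rintegral => x _; rewrite pw; ring.
rewrite [X in _ + X](_ : _ = \int[lam]_x (w x * (c + prim v x) - (c + prim v s) * w x)); last first.
  by apply: eq_Rintegral => x _; rewrite mulrC pw; ring.
rewrite RintegralB//; last exact: RintegrableZl.
rewrite RintegralZl// [X in _ - _ * X](_ : _ = prim v t - prim v s); last by rewrite prim_sub.
move=> e.
have -> : (c + prim v t) ^+ 2 - (c + prim v s) ^+ 2 = 2 * \int[lam]_x (w x * (c + prim v x)).
  by move: e; lra.
rewrite normrM (ger0_norm (_ : 0 <= 2))// EFinM; apply: lee_wpmul2l => //.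
rewrite EFin_normr_Rintegral//.
apply: (le_trans (le_abse_integral _ _ (measurable_int _ wpi))) => //.
apply: ae_ge0_le_integral => //.
- by apply/measurable_EFinP; apply: measurableT_comp => //; apply/measurable_EFinP; exact: measurable_int wpi.
- by apply/measurable_EFinP; apply: measurableT_comp => //; exact: measurable_funM.
apply: ae_imply fv => x fx _ /=; rewrite lee_fin /w indicE.
case: (boolP (x \in _)) => [|_]; last by rewrite mulr0 mul0r normr0.
rewrite inE/= in_itv/= mulr1 mulrC => /andP[sx xt].
by rewrite fx// (lt_trans rs sx) (lt_trans xt tr).
Qed.

End lines.

Section planar_slices.
Context {R : realType}.
Local Notation lam := (@lebesgue_measure R).
Implicit Types f v : R -> R -> R.

Definition haar_pairing f v (rho t y : R) : R :=
  \int[lam]_x (f x y * haar rho t x + v x y * prim (haar rho t) x).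

Lemma rat_between (a b : R) : a < b -> exists q : rat, a < ratr q < b.
Proof. by move=> /rat_in_itvoo[q /itvP qab]; exists q; rewrite !qab. Qed.

(** In [f x y] the variable x runs along the line and y labels it. The almost everywhere quantifiers
    are nested, as Fubini delivers them, so the statement makes sense without joint measurability in
    (y, s, t). *)
Definition line_bound f v :=
  {ae lam, forall y, {ae lam, forall s, {ae lam, forall t,
    s ^+ 2 + y ^+ 2 < 1 -> t ^+ 2 + y ^+ 2 < 1 ->
    (`|f t y ^+ 2 - f s y ^+ 2|%:E <= 2%:E * \int[lam]_x `|f x y * v x y|%:E)%E}}}.

(** A half-width rho is admissible at height y when rho^2 + y^2 < 1. Each rational pair (rho, t)
    excludes a null set of heights y; on the remaining lines [line_representation] holds for all
    admissible rational rho, and these intervals exhaust the chord. The constants for different rho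
    are never compared, since [s] and [t] are caught in one common interval. *)
Lemma planar_lines f v :
  {ae lam, forall y, lam.-integrable setT (EFin \o f^~ y)} ->
  {ae lam, forall y, lam.-integrable setT (EFin \o v^~ y)} ->
  (forall rho t : R, - rho < t < rho -> lam.-integrable setT (EFin \o haar_pairing f v rho t)) ->
  (forall rho t p q : rat, - (ratr rho : R) < ratr t < (ratr rho : R) ->
     ratr p < ratr q :> R ->
     (ratr rho : R) ^+ 2 + ratr p ^+ 2 < 1 -> (ratr rho : R) ^+ 2 + ratr q ^+ 2 < 1 ->
     \int[lam]_y (haar_pairing f v (ratr rho) (ratr t) y * \1_`]ratr p, ratr q[ y) = 0) ->
  line_bound f v.
Proof.
move=> fi vi ki k0.
have kae : {ae lam, forall y, forall (i : rat * rat),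
    - (ratr i.1 : R) < ratr i.2 < (ratr i.1 : R) -> (ratr i.1 : R) ^+ 2 + y ^+ 2 < 1 ->
    haar_pairing f v (ratr i.1) (ratr i.2) y = 0}.
  apply: ae_forall_count => -[rho t] /=.
  have [tr|ntr] := boolP (- (ratr rho : R) < ratr t < (ratr rho : R)); last first.
    by apply: aeW.
  have [r1|r1] := leP 1 ((ratr rho : R) ^+ 2).
    by apply: aeW => y _; have := sqr_ge0 y; lra.
  set b := Num.sqrt (1 - (ratr rho : R) ^+ 2).
  have bE y : ((ratr rho : R) ^+ 2 + y ^+ 2 < 1) = (- b < y < b).
    rewrite -ltr_norml -[in RHS](@ltr_pXn2r _ 2)// ?nnegrE ?sqrtr_ge0//.
    by rewrite /b sqr_sqrtr ?subr_ge0 ?ltW// real_normK ?num_real// ltrBrDl.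
  have := @ae_eq0_rat_itv _ _ (- b) b (ki _ _ tr).
  have h p q : - b < ratr p -> ratr p < ratr q :> R -> ratr q < b ->
      \int[lam]_x (haar_pairing f v (ratr rho) (ratr t) x * \1_`]ratr p, ratr q[ x) = 0.
    move=> bp pq qb; apply: k0 => //.
      by rewrite bE bp (lt_trans pq qb).
    by rewrite bE qb (lt_trans bp pq).
  by move/(_ h); apply: ae_imply => y yb _; rewrite bE => /yb.
apply: ae_imply2 (kae) (_ : {ae lam, forall y, lam.-integrable setT (EFin \o f^~ y) /\
    lam.-integrable setT (EFin \o v^~ y)}); last first.
  exact: ae_imply2 fi vi.
move=> y ky [fyi vyi].
have rep (rho : rat) : 0 < (ratr rho : R) -> (ratr rho : R) ^+ 2 + y ^+ 2 < 1 ->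
    exists c, {ae lam, forall x, - ratr rho < x < ratr rho -> f x y = c + prim (v^~ y) x}.
  move=> r0 ry; apply: (@line_representation _ (f^~ y) (v^~ y)) => // t tr.
  exact: (ky (rho, t)).
have /choice[c cP] : forall rho : rat, exists c : R,
    0 < (ratr rho : R) -> (ratr rho : R) ^+ 2 + y ^+ 2 < 1 ->
    {ae lam, forall x, - ratr rho < x < ratr rho -> f x y = c + prim (v^~ y) x}.
  move=> rho; have [[r0 ry]|n] := pselect (0 < (ratr rho : R) /\ (ratr rho : R) ^+ 2 + y ^+ 2 < 1).
    by have [c cP] := rep rho r0 ry; exists c.
  by exists 0 => r0 ry; exfalso; apply: n.
pose G s := forall rho : rat, 0 < (ratr rho : R) -> (ratr rho : R) ^+ 2 + y ^+ 2 < 1 ->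
  - ratr rho < s < ratr rho -> f s y = c rho + prim (v^~ y) s.
have Gae : {ae lam, forall s, G s}.
  apply: ae_forall_count => rho.
  have [[r0 ry]|n] := pselect (0 < (ratr rho : R) /\ (ratr rho : R) ^+ 2 + y ^+ 2 < 1).
    by apply: ae_imply (cP rho r0 ry) => s fs _ _.
  by apply: aeW => s r0 ry; exfalso; apply: n.
apply: ae_imply (Gae) => s Gs; apply: ae_imply (Gae) => t Gt sy ty.
have [rho /andP[lr rl]] : exists rho : rat, Num.max `|s| `|t| < ratr rho < Num.sqrt (1 - y ^+ 2).
  apply: rat_between; rewrite gt_max; apply/andP.
  have y1 : y ^+ 2 < 1 by have := sqr_ge0 s; lra.
  have e x : x ^+ 2 + y ^+ 2 < 1 -> `|x| < Num.sqrt (1 - y ^+ 2).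
    move=> xy; rewrite -(@ltr_pXn2r _ 2)// ?nnegrE ?sqrtr_ge0//.
    rewrite sqr_sqrtr ?subr_ge0 ?ltW// real_normK ?num_real//; lra.
  by rewrite !e.
have [sr tr] : `|s| < ratr rho /\ `|t| < ratr rho by move: lr; rewrite gt_max => /andP[].
have r0 : 0 < (ratr rho : R) by apply: le_lt_trans sr.
have ry : (ratr rho : R) ^+ 2 + y ^+ 2 < 1.
  have s0 : 0 < Num.sqrt (1 - y ^+ 2) by apply: lt_trans rl.
  move: rl; rewrite -(@ltr_pXn2r _ 2)// ?nnegrE ?(ltW r0) ?sqrtr_ge0//.
  by rewrite sqr_sqrtr; [lra|apply: ltW; rewrite -sqrtr_gt0].
rewrite ltr_norml in sr; rewrite ltr_norml in tr.
exact: (line_sqr_le fyi vyi (cP rho r0 ry) sr tr (Gs _ r0 ry sr) (Gt _ r0 ry tr)).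
Qed.

End planar_slices.

(** * Smooth approximation of the Haar functions *)

Section dominated.
Context d (T : measurableType d) (R : realType) (mu : {measure set T -> \bar R}).

Lemma Rintegral_cvg_bounded (g : T -> R) (phi_ : nat -> T -> R) (phi : T -> R) (M : R) :
  mu.-integrable setT (EFin \o g) -> (forall n, measurable_fun setT (phi_ n)) ->
  (forall n x, `|phi_ n x| <= M) -> (forall x, phi_ n x @[n --> \oo] --> phi x) ->
  \int[mu]_x (g x * phi_ n x) @[n --> \oo] --> \int[mu]_x (g x * phi x).
Proof.
move=> gi mphi phiM phicvg.
have mg : measurable_fun setT g by apply/measurable_EFinP; exact: measurable_int gi.
have mphiT : measurable_fun setT phi.
  by apply: (measurable_fun_cvg mphi) => x _; exact: phicvg.
have dom : mu.-integrable setT (EFin \o (fun x => M * `|g x|)).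
  by have := integrableZl measurableT M (integrable_norm gi).
have [gphii _ cv] := @dominated_convergence _ T R mu setT measurableT
  (fun n => EFin \o (fun x => g x * phi_ n x)) (EFin \o (fun x => g x * phi x))
  (EFin \o (fun x => M * `|g x|))
  ltac:(by move=> n; apply/measurable_EFinP; exact: measurable_funM)
  ltac:(by apply/measurable_EFinP; exact: measurable_funM)
  ltac:(by apply: aeW => x _; apply: cvg_EFin; [exact: nearW|apply: cvgM; [exact: cvg_cst|exact: phicvg]])
  dom
  ltac:(by apply: aeW => x n _ /=; rewrite lee_fin normrM mulrC; apply: ler_wpM2r).
rewrite /Rintegral; apply: fine_cvg; rewrite fineK//.
exact: (integrable_fin_num measurableT gphii).
Qed.

End dominated.

Section haar_approximation.
Context {R : realType}.
Local Notation lam := (@lebesgue_measure R).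

Lemma smooth1_cont (f : R -> R) : smooth1 f -> continuous f.
Proof. by move=> /(_ 0%N) []. Qed.

Lemma smooth1_prim (f : R -> R) : smooth1 f -> lam.-integrable setT (EFin \o f) ->
  (forall x : R, is_derive x 1 (prim f) (f x)) /\ smooth1 (prim f).
Proof.
move=> fs fi.
have d (x : R) : is_derive x 1 (prim f) (f x).
  have [||||dx fx] := @continuous_FTC1 R f -oo%O x (x + 1).
  - by rewrite ltrDl.
  - exact: integrable_itvT.
  - by rewrite ltNyr.
  - exact: smooth1_cont.
  by apply: DeriveDef; rewrite -?derive1E.
by split=> // -[|k]; [split=> //; exact: is_derive1_continuous d|exact: Ck1S d (fs k)].
Qed.

Lemma integrable_bump (p q : R) n : lam.-integrable setT (EFin \o bump p q n).
Proof.
rewrite (_ : bump p q n = fun x => \1_`]p, q[ x * bump p q n x).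
  apply: (@RintegrableMb _ _ _ 1); first exact: Rintegrable_indic.
    by apply: continuous_measurable_fun; apply: smooth1_cont; exact: smooth1_bump.
  by move=> x; rewrite ger0_norm ?bump_ge0 ?bump_le1.
apply/funext => x; rewrite indicE mem_setE in_itv/=.
by case: (boolP (p < x < q)) => h; rewrite ?mul1r// mul0r bump_out.
Qed.

Lemma bump_integral_cvg (p q : R) : p <= q ->
  \int[lam]_x bump p q n x @[n --> \oo] --> q - p.
Proof.
move=> pq; rewrite -(Rintegral_indic pq).
rewrite (_ : (fun n => _) = (fun n => \int[lam]_x (\1_`]p, q[ x * bump p q n x))); last first.
  apply/funext => n; apply: eq_Rintegral => x _.
  rewrite indicE mem_setE in_itv/=.
  by case: (boolP (p < x < q)) => h; rewrite ?mul1r// mul0r bump_out.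
rewrite [X in _ --> X](_ : _ = \int[lam]_x (\1_`]p, q[ x * \1_`]p, q[ x)); last first.
  by apply: eq_Rintegral => x _; rewrite indicE; case: (_ \in _); rewrite ?mulr1 ?mulr0.
apply: (@Rintegral_cvg_bounded _ _ _ _ _ _ _ 1); first exact: Rintegrable_indic.
- by move=> n; apply: continuous_measurable_fun; apply: smooth1_cont; exact: smooth1_bump.
- by move=> n x; rewrite ger0_norm ?bump_ge0 ?bump_le1.
- by move=> x; exact: bump_cvg.
Qed.

Lemma bump_integral_bounds (p q : R) n : p <= q -> 0 <= \int[lam]_x bump p q n x <= q - p.
Proof.
move=> pq; apply/andP; split; first by apply: Rintegral_ge0 => x _; exact: bump_ge0.
rewrite -(Rintegral_indic pq); apply: le_Rintegral => //.
- exact: integrable_bump.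
- exact: Rintegrable_indic.
move=> x _; rewrite indicE mem_setE in_itv/=.
by case: (boolP (p < x < q)) => h; [exact: bump_le1|rewrite bump_out].
Qed.

(** The coefficients 2 rho and t + rho of [haar] become the integrals of the bumps themselves, so
    that the mean is exactly 0 for every n. This is what makes the primitive vanish off [-rho, rho]
    and serve as a factor of a test function. *)
Definition haar_ (rho t : R) n x :=
  (\int[lam]_y bump (- rho) rho n y) * bump (- rho) t n x -
  (\int[lam]_y bump (- rho) t n y) * bump (- rho) rho n x.

Variables (rho t : R).
Hypothesis tr : - rho < t < rho.

Let le1 : - rho <= t. Proof. by case/andP: tr => /ltW. Qed.
Let le2 : t <= rho. Proof. by case/andP: tr => _ /ltW. Qed.
Let le3 : - rho <= rho. Proof. exact: le_trans le1 le2. Qed.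

Lemma integrable_haar_ n : lam.-integrable setT (EFin \o haar_ rho t n).
Proof. by apply: RintegrableB; apply: RintegrableZl; exact: integrable_bump. Qed.

Lemma smooth1_haar_ n : smooth1 (haar_ rho t n).
Proof.
move=> k; rewrite (_ : haar_ rho t n = (fun x =>
  (\int[lam]_y bump (- rho) rho n y) * bump (- rho) t n x +
  (- \int[lam]_y bump (- rho) t n y) * bump (- rho) rho n x)).
  by apply: Ck1D; apply: Ck1M; [exact: Ck1_cst|exact: smooth1_bump|exact: Ck1_cst|exact: smooth1_bump].
by apply/funext => x; rewrite mulNr.
Qed.

Lemma haar__out n x : ~~ (- rho < x < rho) -> haar_ rho t n x = 0.
Proof.
move=> h; rewrite /haar_ !bump_out ?mulr0 ?subr0//; apply: contra h => /andP[->].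
by move=> /lt_le_trans; apply.
Qed.

Lemma prim_haar__out n x : ~~ (- rho <= x <= rho) -> prim (haar_ rho t n) x = 0.
Proof.
rewrite negb_and -!ltNge => /orP[h|h].
  rewrite primE (_ : (fun q => _) = cst 0); first by rewrite Rintegral_cst// mul0r.
  apply/funext => q /=; case: (leP q x) => qx; last by rewrite mulr0.
  by rewrite haar__out ?mul0r// negb_and -!leNgt (le_trans qx (ltW h)).
rewrite primE (_ : (fun q => _) = haar_ rho t n).
  rewrite /haar_ RintegralB//; last 2 first.
  - by apply: RintegrableZl; exact: integrable_bump.
  - by apply: RintegrableZl; exact: integrable_bump.
  rewrite !RintegralZl//; [|exact: integrable_bump|exact: integrable_bump].
  by rewrite mulrC subrr.
apply/funext => q /=; case: (leP q x) => qx; first by rewrite mulr1.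
by rewrite mulr0 haar__out// negb_and -!leNgt (ltW (lt_trans h qx)) orbT.
Qed.

Lemma haar__le n x : `|haar_ rho t n x| <= 4 * rho.
Proof.
have r0 : 0 <= rho by move: le3; lra.
have := bump_integral_bounds n le3; have := bump_integral_bounds n le1; rewrite /haar_.
set I := Rintegral _ _ _; set J := Rintegral _ _ _ => /andP[I0 I1] /andP[J0 J1].
have := bump_ge0 (- rho) t n x; have := bump_le1 (- rho) t n x.
have := bump_ge0 (- rho) rho n x; have := bump_le1 (- rho) rho n x.
move: (bump _ _ n x) (bump (- rho) t n x) => a b a1 a0 b1 b0.
have : 0 <= J * b <= J by rewrite mulr_ge0//= ler_piMr.
have : 0 <= I * a <= I by rewrite mulr_ge0//= ler_piMr.
rewrite ler_norml; move: le1 le2 => ? ? /andP[? ?] /andP[? ?]; apply/andP; split; lra.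
Qed.

Lemma haar__cvg x : haar_ rho t n x @[n --> \oo] --> haar rho t x.
Proof.
rewrite /haar_ /haar.
have -> : 2 * rho = rho - - rho by ring.
have -> : t + rho = t - - rho by ring.
by apply: cvgB; apply: cvgM; [exact: bump_integral_cvg|exact: bump_cvg|exact: bump_integral_cvg|exact: bump_cvg].
Qed.

Lemma prim_haar__cvg x : prim (haar_ rho t n) x @[n --> \oo] --> prim (haar rho t) x.
Proof.
(* All the functions involved vanish off (-rho, rho), so their primitives at x are integrals against
   this single integrable function, and bounded pointwise convergence suffices. *)
pose g (y : R) : R := \1_`]- rho, rho[ y * (y <= x)%R%:R.
have gi : lam.-integrable setT (EFin \o g).
  apply: (@RintegrableMb _ _ _ 1); first exact: Rintegrable_indic.
    rewrite (_ : (fun q => _) = \1_`]-oo, x]) ?measurable_indic//.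
    by apply/funext => q; rewrite indicE mem_setE in_itv.
  by move=> y; case: (y <= x); rewrite ?normr1 ?normr0.
have e (h : R -> R) : (forall y, ~~ (- rho < y < rho) -> h y = 0) ->
    prim h x = \int[lam]_y (g y * h y).
  move=> h0; rewrite primE; apply: eq_Rintegral => y _; rewrite /g indicE mem_setE in_itv/=.
  by case: (boolP (- rho < y < rho)) => [_|/h0 ->]; rewrite ?mul1r ?mul0r// mulrC.
have lt y : - rho < y < t -> - rho < y < rho.
  by move=> /andP[-> /lt_le_trans]; apply.
rewrite e; last first.
  move=> y ny; rewrite /haar !indicE !mem_setE !in_itv/= (negbTE ny).
  by rewrite (negbTE (contra (@lt y) ny)) !mulr0 subr0.
rewrite (_ : (fun n => _) = (fun n => \int[lam]_y (g y * haar_ rho t n y))); last first.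
  by apply/funext => n; apply: e => y; exact: haar__out.
apply: (@Rintegral_cvg_bounded _ _ _ _ _ _ _ (4 * rho)) => //.
- move=> n; apply: continuous_measurable_fun; apply: smooth1_cont; exact: smooth1_haar_.
- exact: haar__le.
- exact: haar__cvg.
Qed.

Lemma prim_haar__le n x : `|prim (haar_ rho t n) x| <= 4 * rho * (2 * rho).
Proof.
apply: (le_trans (prim_le _ (integrable_haar_ n))).
have -> : 2 * rho = rho - - rho by ring.
rewrite -(Rintegral_indic le3) -RintegralZl//; last exact: Rintegrable_indic.
apply: le_Rintegral => //.
- exact: integrable_norm (integrable_haar_ n).
- by apply: RintegrableZl; exact: Rintegrable_indic.
move=> y _; rewrite indicE mem_setE in_itv/=.
case: (boolP (- rho < y < rho)) => h; first by rewrite mulr1 haar__le.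
by rewrite mulr0 haar__out ?normr0.
Qed.

End haar_approximation.

(** * Slices of functions with weak derivatives *)

Section cell_measure.
Context {R : realType}.
Local Notation lam := (@lebesgue_measure R).
Local Notation T3 := (R3 (measurableTypeR R)).

Lemma measurable_crd1 : measurable_fun [set: T3] (fun x : T3 => x.1.1 : R).
Proof. exact: (measurableT_comp measurable_fst measurable_fst). Qed.

Lemma measurable_crd2 : measurable_fun [set: T3] (fun x : T3 => x.1.2 : R).
Proof. exact: (measurableT_comp measurable_snd measurable_fst). Qed.

Lemma measurable_crd3 : measurable_fun [set: T3] (fun x : T3 => x.2 : R).
Proof. exact: measurable_snd. Qed.

Lemma measurable_cylinder : measurable (cylinder : set T3).
Proof.
rewrite (_ : cylinder = (fun x : T3 => x.1.1 ^+ 2 + x.1.2 ^+ 2 : R) @^-1` `]-oo, 1[).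
  rewrite -[X in measurable X]setTI.
  suff m : measurable_fun [set: T3] (fun x : T3 => x.1.1 ^+ 2 + x.1.2 ^+ 2 : R).
    by apply: m => //.
  apply: measurable_funD; apply: measurable_funX;
    [exact: measurable_crd1|exact: measurable_crd2].
by apply/seteqP; split=> x; rewrite /cylinder/= in_itv.
Qed.

Lemma cellE : cell = cylinder `&` [set x : T3 | 0 <= x.2 <= 2 * pi] :> set T3.
Proof. by []. Qed.

Lemma measurable_cell : measurable (cell : set T3).
Proof.
rewrite cellE; apply: measurableI; first exact: measurable_cylinder.
rewrite (_ : [set x | _] = (fun x : T3 => x.2 : R) @^-1` `[0, 2 * pi]).
  by rewrite -[X in measurable X]setTI; apply: measurable_crd3.
by apply/seteqP; split=> x /=; rewrite in_itv.
Qed.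

Lemma cell_lty : (lebesgue3 (cell : set T3) < +oo)%E.
Proof.
pose B : set T3 := (`[-1, 1]%classic `*` `[-1, 1]%classic) `*` `[0, 2 * pi]%classic.
have mB : measurable B by apply: measurableX => //; apply: measurableX.
apply: (@le_lt_trans _ _ (lebesgue3 B)).
  apply: le_measure; rewrite ?inE//; first exact: measurable_cell.
  move=> -[[x y] z] [/= xy zp]; rewrite /B/= !in_itv/= zp; split=> //.
  have := sqr_ge0 x; have := sqr_ge0 y => y0 x0.
  have e (a : R) : a ^+ 2 < 1 -> -1 <= a <= 1.
    move=> a1; rewrite -ler_norml -(@ler_pXn2r _ 2)// ?nnegrE//.
    by rewrite expr1n real_normK ?num_real// ltW.
  by split; apply: e; lra.
have -> : lebesgue3 B = (lam `[(-1)%R, 1%R]%classic * lam `[(-1)%R, 1%R]%classic *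
    lam `[0%R, (2 * pi)%R]%classic)%E.
  rewrite -(product_measure1E lam lam)//.
  by apply: product_measure1E => //; exact: measurableX.
rewrite !lebesgue_measure_itv/= !lte_fin.
by do ! case: ifP => _; rewrite -?EFinB -?EFinM ?mule0 ?mul0e ?ltry.
Qed.

Lemma measurable_cell_restrict (f : T3 -> R) :
  measurable_fun (cylinder : set T3) f -> measurable_fun [set: T3] (f \_ cell).
Proof.
move=> mf; apply: (measurable_restrictT _ measurable_cell).1.
by apply: (measurable_funS measurable_cylinder _ mf) => x [].
Qed.

Lemma LpDE (p : R) (f : T3 -> R) : p != 0 ->
  (LpD p f `^ p = \int[lebesgue3]_x (`|(f \_ cell) x| `^ p)%:E)%E.
Proof.
move=> p0; rewrite /LpD powR_Lnorm//; apply: eq_integral => x _.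
by rewrite restrict_EFin.
Qed.

Lemma LpD2E (f : T3 -> R) :
  (LpD 2 f `^ 2 = \int[lebesgue3]_x ((f \_ cell) x ^+ 2)%:E)%E.
Proof.
rewrite LpDE ?pnatr_eq0//; apply: eq_integral => x _.
by rewrite powR_mulrn// real_normK ?num_real.
Qed.

Lemma L2per_sqr_lty (f : R3 R -> R) : L2per f ->
  (\int[lebesgue3]_x ((f \_ cell) x ^+ 2)%:E < +oo)%E.
Proof. by case=> _ _ ?; rewrite -LpD2E poweR_lty. Qed.

Lemma L2per_measurable (f : R3 R -> R) : L2per f ->
  measurable_fun [set: T3] (f \_ cell).
Proof. by case=> mf _ _; exact: measurable_cell_restrict. Qed.

(** The cell has finite measure and |f| <= 1 + f^2. *)
Lemma L2per_integrable (f : R3 R -> R) : L2per f ->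
  lebesgue3.-integrable [set: T3] (EFin \o (f \_ cell)).
Proof.
move=> fL; have mf := L2per_measurable fL.
have mc : measurable_fun [set: T3] (\1_(cell : set T3) : T3 -> R).
  exact: (measurable_indic measurable_cell).
have ci : lebesgue3.-integrable [set: T3] (fun x => (\1_(cell : set T3) x)%:E).
  apply/integrableP; split; first exact/measurable_EFinP.
  under eq_integral do rewrite gee0_abs ?lee_fin//.
  rewrite integral_indic//; last exact: measurable_cell.
  by rewrite setIT cell_lty.
have si : lebesgue3.-integrable [set: T3] (fun x => ((f \_ cell) x ^+ 2)%:E).
  apply/integrableP; split; first by apply/measurable_EFinP; exact: measurable_funX.
  under eq_integral do rewrite gee0_abs ?lee_fin ?sqr_ge0//.
  exact: L2per_sqr_lty.
apply: (le_integrable measurableT _ _ (integrableD measurableT ci si)).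
  exact/measurable_EFinP.
move=> x _ /=; rewrite lee_fin patchE indicE; case: ifP => _; last first.
  by rewrite normr0.
rewrite [leRHS]ger0_norm ?addr_ge0 ?sqr_ge0//.
have := sqr_ge0 (`|f x| - 1); rewrite sqrrB1 real_normK ?num_real//=.
by have := normr_ge0 (f x); lra.
Qed.

Lemma measurable_prod3 (A B C : R -> R) :
  measurable_fun setT A -> measurable_fun setT B -> measurable_fun setT C ->
  measurable_fun [set: T3] (prod3 A B C).
Proof.
move=> mA mB mC; apply: measurable_funM; first apply: measurable_funM.
- exact: measurableT_comp mA measurable_crd1.
- exact: measurableT_comp mB measurable_crd2.
- exact: measurableT_comp mC measurable_crd3.
Qed.

End cell_measure.

Section weak_derivative.
Context {R : realType}.
Local Notation lam := (@lebesgue_measure R).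
Local Notation T3 := (R3 (measurableTypeR R)).
Implicit Types (f g : R3 R -> R).

(** Weak derivatives are defined on the infinite cylinder, norms on the cell; a test function that
    vanishes for x3 outside [0, 2 pi] gives the same identity on both. *)
Lemma weak_pderiv_cell j f g (phi psi : R3 R -> R) : weak_pderiv j f g ->
  test_fun phi -> (forall x, 'D_(basis3 j) phi x = psi x) ->
  (forall x : R3 R, ~~ (0 <= x.2 <= 2 * pi) -> phi x = 0 /\ psi x = 0) ->
  \int[lebesgue3]_x ((f \_ cell) x * psi x) = - \int[lebesgue3]_x ((g \_ cell) x * phi x).
Proof.
move=> fg phit Dphi phi0; have e := fg phi phit.
have cut (h k : R3 R -> R) : (forall x : R3 R, ~~ (0 <= x.2 <= 2 * pi) -> k x = 0) ->
    \int[lebesgue3]_x ((h \_ cell) x * k x) = \int[lebesgue3]_(x in cylinder) (h x * k x).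
  move=> k0; rewrite [RHS]Rintegral_mkcond; apply: eq_Rintegral => x _; rewrite !patchE.
  have [xc|xc] := pselect (cylinder x); last first.
    by rewrite (memNset xc) memNset ?mul0r//= => -[].
  rewrite (mem_set xc); have [/k0 ->|] := boolP (~~ (0 <= x.2 <= 2 * pi)).
    by rewrite !mulr0.
  by rewrite negbK => z; rewrite mem_set.
rewrite !cut; [|by move=> x /phi0[]..].
by rewrite -e; apply: eq_Rintegral => x _; rewrite Dphi.
Qed.

Section haar_formula.
Variables (f g : R3 R -> R) (rho t p q r s : R).
Hypotheses (fL : L2per f) (gL : L2per g).
Hypotheses (tr : - rho < t < rho).
Hypotheses (rp : rho ^+ 2 + p ^+ 2 < 1) (rq : rho ^+ 2 + q ^+ 2 < 1).
Hypotheses (r0 : 0 < r) (s2pi : s < 2 * pi).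

(** The corners of the rectangle lie in the disc, and so does the rectangle. The signs of p and q
    are unknown: y^2 is compared with q^2 when y >= 0 and with p^2 otherwise. *)
Let square_in_disc (x y : R) : - rho <= x <= rho -> p <= y <= q -> x ^+ 2 + y ^+ 2 < 1.
Proof.
move=> /andP[x1 x2] /andP[y1 y2].
have h1 : x ^+ 2 <= rho ^+ 2 by rewrite -subr_ge0 subr_sqr; apply: mulr_ge0; lra.
have [y0|y0] := leP 0 y.
  have h2 : y ^+ 2 <= q ^+ 2 by rewrite -subr_ge0 subr_sqr; apply: mulr_ge0; lra.
  by move: rq; lra.
have h2 : y ^+ 2 <= p ^+ 2.
  by rewrite -subr_ge0 -sqrrN -[y ^+ 2]sqrrN subr_sqr; apply: mulr_ge0; lra.
by move: rp; lra.
Qed.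

Let bump_closed_out (a b : R) n x : ~~ (a <= x <= b) -> bump a b n x = 0.
Proof. by move=> h; apply: bump_out; apply: contra h => /andP[/ltW -> /ltW ->]. Qed.

Let bump_le (a b : R) n x : `|bump a b n x| <= 1.
Proof. by rewrite ger0_norm ?bump_ge0 ?bump_le1. Qed.

Let mbump (a b : R) n : measurable_fun setT (bump a b n).
Proof. by apply: continuous_measurable_fun; apply: smooth1_cont; exact: smooth1_bump. Qed.

Let prod3_cvg_int (h : R3 R -> R) (A_ B_ C_ : nat -> R -> R) (A B C : R -> R) (a b c : R) :
  L2per h ->
  (forall n, measurable_fun setT (A_ n)) -> (forall n, measurable_fun setT (B_ n)) ->
  (forall n, measurable_fun setT (C_ n)) ->
  (forall n x, `|A_ n x| <= a) -> (forall n x, `|B_ n x| <= b) -> (forall n x, `|C_ n x| <= c) ->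
  (forall x, A_ n x @[n --> \oo] --> A x) -> (forall x, B_ n x @[n --> \oo] --> B x) ->
  (forall x, C_ n x @[n --> \oo] --> C x) ->
  \int[lebesgue3]_x ((h \_ cell) x * prod3 (A_ n) (B_ n) (C_ n) x) @[n --> \oo] -->
  \int[lebesgue3]_x ((h \_ cell) x * prod3 A B C x).
Proof.
move=> hL mA mB mC Aa Bb Cc Ac Bc Cc'.
apply: (@Rintegral_cvg_bounded _ _ _ lebesgue3 (h \_ cell) _ _ (a * b * c)).
- exact: L2per_integrable.
- by move=> n; exact: measurable_prod3.
- move=> n x; rewrite /prod3 !normrM; apply: ler_pM => //.
  by apply: ler_pM.
- by move=> x; rewrite /prod3; apply: cvgM; [apply: cvgM|].
Qed.

Let mhaar_ n : measurable_fun setT (haar_ rho t n).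
Proof. by apply: continuous_measurable_fun; apply: smooth1_cont; exact: smooth1_haar_. Qed.

Let mphaar_ n : measurable_fun setT (prim (haar_ rho t n)).
Proof. by apply: continuous_measurable_fun; apply: prim_continuous; exact: integrable_haar_. Qed.

Let bump_rs_out n (x : R) : ~~ (0 <= x <= 2 * pi) -> bump r s n x = 0.
Proof.
move=> h; apply: bump_out; apply: contra h => /andP[h1 h2].
by rewrite (ltW (lt_trans r0 h1)) (ltW (lt_trans h2 s2pi)).
Qed.

(** Limit of the weak identity along smooth products: the bumps become the indicators of (p, q) and
    (r, s), and the smoothed Haar function becomes [haar]. *)
Lemma weak_haar1 : weak_pderiv 0 f g ->
  \int[lebesgue3]_x ((f \_ cell) x * prod3 (haar rho t) \1_`]p, q[ \1_`]r, s[ x) =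
  - \int[lebesgue3]_x ((g \_ cell) x * prod3 (prim (haar rho t)) \1_`]p, q[ \1_`]r, s[ x).
Proof.
move=> fg.
have H n : \int[lebesgue3]_x ((f \_ cell) x * prod3 (haar_ rho t n) (bump p q n) (bump r s n) x) =
  - \int[lebesgue3]_x ((g \_ cell) x * prod3 (prim (haar_ rho t n)) (bump p q n) (bump r s n) x).
  have [dA sA] := smooth1_prim (smooth1_haar_ rho t n) (integrable_haar_ rho t n).
  apply: (weak_pderiv_cell fg).
  - apply: (@prod3_test_fun _ _ _ _ (- rho) rho p q r s) => //; try exact: smooth1_bump.
    + by move=> x; exact: prim_haar__out.
    + by move=> x; exact: bump_closed_out.
    + by move=> x; exact: bump_closed_out.
  - by move=> x; apply: (proj2 (@prod3_derive1 _ _ (bump p q n) (bump r s n) (haar_ rho t n) x (dA x.1.1))).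
  - by move=> x /bump_rs_out h; rewrite /prod3 h !mulr0.
have c1 := prod3_cvg_int fL mhaar_ (mbump p q) (mbump r s) (haar__le tr) (bump_le p q) (bump_le r s)
  (@haar__cvg _ _ _ tr) (@bump_cvg _ p q) (@bump_cvg _ r s).
have c2 := prod3_cvg_int gL mphaar_ (mbump p q) (mbump r s) (prim_haar__le tr) (bump_le p q) (bump_le r s)
  (@prim_haar__cvg _ _ _ tr) (@bump_cvg _ p q) (@bump_cvg _ r s).
have c3 : (- \int[lebesgue3]_x ((g \_ cell) x * prod3 (prim (haar_ rho t n)) (bump p q n) (bump r s n) x)) @[n --> \oo] -->
    - \int[lebesgue3]_x ((g \_ cell) x * prod3 (prim (haar rho t)) \1_`]p, q[ \1_`]r, s[ x) by apply: cvgN; exact: c2.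
have c4 : \int[lebesgue3]_x ((f \_ cell) x * prod3 (haar_ rho t n) (bump p q n) (bump r s n) x) @[n --> \oo] -->
    - \int[lebesgue3]_x ((g \_ cell) x * prod3 (prim (haar rho t)) \1_`]p, q[ \1_`]r, s[ x).
  by apply: cvg_trans c3; apply: near_eq_cvg; apply: nearW => n; rewrite H.
exact: (cvg_unique _ c1 c4).
Qed.

Lemma weak_haar2 : weak_pderiv 1 f g ->
  \int[lebesgue3]_x ((f \_ cell) x * prod3 \1_`]p, q[ (haar rho t) \1_`]r, s[ x) =
  - \int[lebesgue3]_x ((g \_ cell) x * prod3 \1_`]p, q[ (prim (haar rho t)) \1_`]r, s[ x).
Proof.
move=> fg.
have H n : \int[lebesgue3]_x ((f \_ cell) x * prod3 (bump p q n) (haar_ rho t n) (bump r s n) x) =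
  - \int[lebesgue3]_x ((g \_ cell) x * prod3 (bump p q n) (prim (haar_ rho t n)) (bump r s n) x).
  have [dA sA] := smooth1_prim (smooth1_haar_ rho t n) (integrable_haar_ rho t n).
  apply: (weak_pderiv_cell fg).
  - apply: (@prod3_test_fun _ _ _ _ p q (- rho) rho r s) => //; try exact: smooth1_bump.
    + by move=> x; exact: bump_closed_out.
    + by move=> x; exact: prim_haar__out.
    + by move=> x; exact: bump_closed_out.
    + by move=> x y xp yr; rewrite addrC; exact: square_in_disc.
  - by move=> x; apply: (proj2 (@prod3_derive2 _ (bump p q n) _ (bump r s n) (haar_ rho t n) x (dA x.1.2))).
  - by move=> x /bump_rs_out h; rewrite /prod3 h !mulr0.
have c1 := prod3_cvg_int fL (mbump p q) mhaar_ (mbump r s) (bump_le p q) (haar__le tr) (bump_le r s)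
  (@bump_cvg _ p q) (@haar__cvg _ _ _ tr) (@bump_cvg _ r s).
have c2 := prod3_cvg_int gL (mbump p q) mphaar_ (mbump r s) (bump_le p q) (prim_haar__le tr) (bump_le r s)
  (@bump_cvg _ p q) (@prim_haar__cvg _ _ _ tr) (@bump_cvg _ r s).
have c3 : (- \int[lebesgue3]_x ((g \_ cell) x * prod3 (bump p q n) (prim (haar_ rho t n)) (bump r s n) x)) @[n --> \oo] -->
    - \int[lebesgue3]_x ((g \_ cell) x * prod3 \1_`]p, q[ (prim (haar rho t)) \1_`]r, s[ x) by apply: cvgN; exact: c2.
have c4 : \int[lebesgue3]_x ((f \_ cell) x * prod3 (bump p q n) (haar_ rho t n) (bump r s n) x) @[n --> \oo] -->
    - \int[lebesgue3]_x ((g \_ cell) x * prod3 \1_`]p, q[ (prim (haar rho t)) \1_`]r, s[ x).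
  by apply: cvg_trans c3; apply: near_eq_cvg; apply: nearW => n; rewrite H.
exact: (cvg_unique _ c1 c4).
Qed.

End haar_formula.

End weak_derivative.

Lemma integrable_mulb d (T : measurableType d) (R : realType) (mu : {measure set T -> \bar R})
    (v w : T -> R) (M : R) : mu.-integrable setT (EFin \o v) ->
  measurable_fun setT w -> (forall x, `|w x| <= M) ->
  mu.-integrable setT (EFin \o (fun x => v x * w x)).
Proof.
move=> vi mw wM.
have mv : measurable_fun setT v by apply/measurable_EFinP; exact: measurable_int vi.
apply: (le_integrable measurableT _ _ (integrableZl measurableT M vi)).
  by apply/measurable_EFinP; exact: measurable_funM.
move=> x _ /=; rewrite lee_fin !normrM mulrC; apply: ler_wpM2r => //.
by apply: le_trans (wM x) (ler_norm _).
Qed.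

Section real_fubini.
Context d1 d2 (T1 : measurableType d1) (T2 : measurableType d2) (R : realType).
Variables (m1 : {sigma_finite_measure set T1 -> \bar R}).
Variables (m2 : {sigma_finite_measure set T2 -> \bar R}).
Variable (H : T1 * T2 -> R).
Hypothesis Hi : (m1 \x m2)%E.-integrable setT (EFin \o H).

Lemma integrable_Rfubini1 : m1.-integrable setT (EFin \o (fun x => \int[m2]_y H (x, y))).
Proof.
have Fi := integrable_fubini_F Hi.
apply: (le_integrable measurableT _ _ Fi).
  by apply/measurable_EFinP; apply: measurableT_comp => //; exact: measurable_int Fi.
by move=> x _ /=; rewrite /Rintegral /fubini_F /=; case: (integral _ _ _) => [r| |] //=; rewrite normr0 leey.
Qed.

Lemma integrable_Rfubini2 : m2.-integrable setT (EFin \o (fun y => \int[m1]_x H (x, y))).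
Proof.
have mH := measurable_int _ Hi.
have Gi : m2.-integrable setT (fubini_G m1 (EFin \o H)).
  apply/integrableP; split; first exact: measurable_fubini_G Hi.
  apply: le_lt_trans ((integrable21ltyP _ _ mH).1 Hi).
  apply: ge0_le_integral => //.
  - by apply: measurableT_comp => //; exact: measurable_fubini_G Hi.
  - apply: (@measurable_fun_fubini_tonelli_G _ _ _ _ _ m1 (abse \o (EFin \o H))).
      exact: measurableT_comp.
    by move=> x; exact: abse_ge0.
  move=> y _; apply: le_abse_integral => //; exact: measurableT_comp.
apply: (le_integrable measurableT _ _ Gi).
  by apply/measurable_EFinP; apply: measurableT_comp => //; exact: measurable_int Gi.
by move=> x _ /=; rewrite /Rintegral /fubini_G /=; case: (integral _ _ _) => [r| |] //=; rewrite normr0 leey.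
Qed.

Lemma Rfubini1 (w : T1 -> R) (M : R) : measurable_fun setT w -> (forall x, `|w x| <= M) ->
  \int[(m1 \x m2)%E]_x (H x * w x.1) = \int[m1]_x ((\int[m2]_y H (x, y)) * w x).
Proof.
move=> mw wM.
have mw1 : measurable_fun setT (fun x : T1 * T2 => w x.1) by exact: measurableT_comp.
have Hwi : (m1 \x m2)%E.-integrable setT (EFin \o (fun x => H x * w x.1)).
  exact: (integrable_mulb Hi mw1 (fun x => wM x.1)).
rewrite /Rintegral; apply: (congr1 fine); rewrite -(integral12_prod_meas1 Hwi).
apply: ae_eq_integral => //.
- exact: measurable_fubini_F Hwi.
- apply/measurable_EFinP; apply: measurable_funM => //.
  by apply/measurable_EFinP; exact: measurable_int integrable_Rfubini1.
apply: ae_imply (ae_integrable1 Hi) => x xi _; rewrite /fubini_F/=.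
rewrite EFinM fineK; last exact: (integrable_fin_num measurableT xi).
by rewrite -integralZr.
Qed.

Lemma Rfubini2 (w : T2 -> R) (M : R) : measurable_fun setT w -> (forall x, `|w x| <= M) ->
  \int[(m1 \x m2)%E]_x (H x * w x.2) = \int[m2]_y ((\int[m1]_x H (x, y)) * w y).
Proof.
move=> mw wM.
have mw2 : measurable_fun setT (fun x : T1 * T2 => w x.2) by exact: measurableT_comp.
have Hwi : (m1 \x m2)%E.-integrable setT (EFin \o (fun x => H x * w x.2)).
  exact: (integrable_mulb Hi mw2 (fun x => wM x.2)).
rewrite /Rintegral; apply: (congr1 fine); rewrite -(integral21_prod_meas1 Hwi).
apply: ae_eq_integral => //.
- exact: measurable_fubini_G Hwi.
- apply/measurable_EFinP; apply: measurable_funM => //.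
  by apply/measurable_EFinP; exact: measurable_int integrable_Rfubini2.
apply: ae_imply (ae_integrable2 Hi) => y yi _; rewrite /fubini_G/=.
rewrite EFinM fineK; last exact: (integrable_fin_num measurableT yi).
by rewrite -integralZr.
Qed.

End real_fubini.

Section slices.
Context {R : realType}.
Local Notation lam := (@lebesgue_measure R).
Local Notation lam2 := (lam \x lam)%E.
Local Notation T2 := (measurableTypeR R * measurableTypeR R)%type.
Local Notation T3 := (R3 (measurableTypeR R)).

Lemma indic_le1 (A : set R) x : `|\1_A x : R| <= 1.
Proof. by rewrite indicE; case: (_ \in _); rewrite ?normr1 ?normr0. Qed.

Lemma slice_zero (H : T3 -> R) : lebesgue3.-integrable [set: T3] (EFin \o H) ->
  (forall r s : R, 0 < r -> r < s -> s < 2 * pi ->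
    \int[lebesgue3]_x (H x * \1_`]r, s[ x.2) = 0) ->
  {ae lam, forall z, 0 < z < 2 * pi -> \int[lam2]_x H (x, z) = 0}.
Proof.
move=> Hi H0; pose k z := \int[lam2]_x H (x, z).
have ki : lam.-integrable setT (EFin \o k) by exact: (@integrable_Rfubini2 _ _ _ _ R (plane_measure R) lam H Hi).
apply: (@ae_eq0_rat_itv _ k 0 (2 * pi) ki) => p q p0 pq q2.
rewrite -[RHS](H0 _ _ p0 pq q2); apply/esym.
by apply: (@Rfubini2 _ _ _ _ R (plane_measure R) lam H Hi _ 1) => // x; exact: indic_le1.
Qed.

Lemma planar1 (F G : T2 -> R) :
  lam2.-integrable [set: T2] (EFin \o F) -> lam2.-integrable [set: T2] (EFin \o G) ->
  (forall rho t p q : rat, - (ratr rho : R) < ratr t < (ratr rho : R) ->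
     ratr p < ratr q :> R ->
     (ratr rho : R) ^+ 2 + ratr p ^+ 2 < 1 -> (ratr rho : R) ^+ 2 + ratr q ^+ 2 < 1 ->
     \int[lam2]_x ((F x * haar (ratr rho) (ratr t) x.1 +
       G x * prim (haar (ratr rho) (ratr t)) x.1) * \1_`]ratr p, ratr q[ x.2) = 0) ->
  line_bound (fun x y => F (x, y)) (fun x y => G (x, y)).
Proof.
move=> Fi Gi FG0.
have mhaar (rho t : R) : measurable_fun setT (haar rho t).
  by apply/measurable_EFinP; exact: measurable_int (integrable_haar rho t).
have mphaar (rho t : R) : measurable_fun setT (prim (haar rho t)).
  by apply: continuous_measurable_fun; apply: prim_continuous; exact: integrable_haar.
have Ki (rho t : R) : - rho < t < rho -> lam2.-integrable [set: T2] (EFin \o (fun x =>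
    F x * haar rho t x.1 + G x * prim (haar rho t) x.1)).
  move=> /andP[/ltW r1 /ltW r2].
  have i1 : lam2.-integrable [set: T2] (EFin \o (fun x => F x * haar rho t x.1)).
    apply: (@integrable_mulb _ _ _ _ F (fun x => haar rho t x.1) (4 * rho)) => //.
      exact: measurableT_comp (mhaar _ _) measurable_fst.
    by move=> x; apply: haar_le; rewrite r1 r2.
  have i2 : lam2.-integrable [set: T2] (EFin \o (fun x => G x * prim (haar rho t) x.1)).
    apply: (@integrable_mulb _ _ _ _ G (fun x => prim (haar rho t) x.1) (\int[lam]_y `|haar rho t y|)) => //.
      exact: measurableT_comp (mphaar _ _) measurable_fst.
    by move=> x; apply: prim_le; exact: integrable_haar.
  exact: (integrableD measurableT i1 i2).
apply: planar_lines.
- exact: (ae_integrable2 Fi).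
- exact: (ae_integrable2 Gi).
- by move=> rho t tr; exact: (integrable_Rfubini2 (Ki rho t tr)).
- move=> rho t p q tr pq rp rq; rewrite -[RHS](FG0 rho t p q tr pq rp rq); apply/esym.
  by apply: (Rfubini2 (M := 1) (Ki _ _ tr)) => // x; exact: indic_le1.
Qed.

Lemma planar2 (F G : T2 -> R) :
  lam2.-integrable [set: T2] (EFin \o F) -> lam2.-integrable [set: T2] (EFin \o G) ->
  (forall rho t p q : rat, - (ratr rho : R) < ratr t < (ratr rho : R) ->
     ratr p < ratr q :> R ->
     (ratr rho : R) ^+ 2 + ratr p ^+ 2 < 1 -> (ratr rho : R) ^+ 2 + ratr q ^+ 2 < 1 ->
     \int[lam2]_x ((F x * haar (ratr rho) (ratr t) x.2 +
       G x * prim (haar (ratr rho) (ratr t)) x.2) * \1_`]ratr p, ratr q[ x.1) = 0) ->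
  line_bound (fun x y => F (y, x)) (fun x y => G (y, x)).
Proof.
move=> Fi Gi FG0.
have mhaar (rho t : R) : measurable_fun setT (haar rho t).
  by apply/measurable_EFinP; exact: measurable_int (integrable_haar rho t).
have mphaar (rho t : R) : measurable_fun setT (prim (haar rho t)).
  by apply: continuous_measurable_fun; apply: prim_continuous; exact: integrable_haar.
have Ki (rho t : R) : - rho < t < rho -> lam2.-integrable [set: T2] (EFin \o (fun x =>
    F x * haar rho t x.2 + G x * prim (haar rho t) x.2)).
  move=> /andP[/ltW r1 /ltW r2].
  have i1 : lam2.-integrable [set: T2] (EFin \o (fun x => F x * haar rho t x.2)).
    apply: (@integrable_mulb _ _ _ _ F (fun x => haar rho t x.2) (4 * rho)) => //.
      exact: measurableT_comp (mhaar _ _) measurable_snd.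
    by move=> x; apply: haar_le; rewrite r1 r2.
  have i2 : lam2.-integrable [set: T2] (EFin \o (fun x => G x * prim (haar rho t) x.2)).
    apply: (@integrable_mulb _ _ _ _ G (fun x => prim (haar rho t) x.2) (\int[lam]_y `|haar rho t y|)) => //.
      exact: measurableT_comp (mphaar _ _) measurable_snd.
    by move=> x; apply: prim_le; exact: integrable_haar.
  exact: (integrableD measurableT i1 i2).
apply: planar_lines.
- exact: (ae_integrable1 Fi).
- exact: (ae_integrable1 Gi).
- by move=> rho t tr; exact: (integrable_Rfubini1 (Ki rho t tr)).
- move=> rho t p q tr pq rp rq; rewrite -[RHS](FG0 rho t p q tr pq rp rq); apply/esym.
  by apply: (Rfubini1 (M := 1) (Ki _ _ tr)) => // x; exact: indic_le1.
Qed.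

(** The disintegration in x3 comes first: for each rational (rho, t, p, q) the planar integral
    vanishes for almost every z in (0, 2 pi), and the countable union of these null sets is
    discarded before the planar argument runs inside one slice. *)
Lemma slice_lines1 (f g : R3 R -> R) : L2per f -> L2per g -> weak_pderiv 0 f g ->
  {ae lam, forall z, 0 < z < 2 * pi ->
    line_bound (fun x y => (f \_ cell) (x, y, z)) (fun x y => (g \_ cell) (x, y, z))}.
Proof.
move=> fL gL fg; have fi := L2per_integrable fL; have gi := L2per_integrable gL.
have mhaar (rho t : R) : measurable_fun setT (haar rho t).
  by apply/measurable_EFinP; exact: measurable_int (integrable_haar rho t).
have mphaar (rho t : R) : measurable_fun setT (prim (haar rho t)).
  by apply: continuous_measurable_fun; apply: prim_continuous; exact: integrable_haar.
have H0 : {ae lam, forall z, forall i : (rat * rat) * (rat * rat), 0 < z < 2 * pi ->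
    - (ratr i.1.1 : R) < ratr i.1.2 < (ratr i.1.1 : R) -> ratr i.2.1 < ratr i.2.2 :> R ->
    (ratr i.1.1 : R) ^+ 2 + ratr i.2.1 ^+ 2 < 1 -> (ratr i.1.1 : R) ^+ 2 + ratr i.2.2 ^+ 2 < 1 ->
    \int[lam2]_x (((f \_ cell) (x, z) * haar (ratr i.1.1) (ratr i.1.2) x.1 +
       (g \_ cell) (x, z) * prim (haar (ratr i.1.1) (ratr i.1.2)) x.1) *
         \1_`]ratr i.2.1, ratr i.2.2[ x.2) = 0}.
  apply: ae_forall_count => -[[rho' t'] [p' q']] /=.
  move: (ratr rho') (ratr t') (ratr p') (ratr q') => {rho' t' p' q'} rho t p q.
  have [[tr pq rp rq]|n] := pselect [/\ - rho < t < rho, p < q,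
    rho ^+ 2 + p ^+ 2 < 1 & rho ^+ 2 + q ^+ 2 < 1]; last first.
    by apply: aeW => z _ tr pq rp rq; exfalso; apply: n.
  have mh1 : measurable_fun [set: T3] (fun x : T3 => haar rho t x.1.1).
    exact: measurableT_comp (mhaar _ _) measurable_crd1.
  have mh2 : measurable_fun [set: T3] (fun x : T3 => prim (haar rho t) x.1.1).
    exact: measurableT_comp (mphaar _ _) measurable_crd1.
  have mI : measurable_fun [set: T3] (fun x : T3 => \1_`]p, q[ x.1.2 : R).
    by apply: (measurableT_comp _ measurable_crd2); exact: measurable_indic.
  have i1 : lebesgue3.-integrable [set: T3] (EFin \o (fun x : T3 => (f \_ cell) x * haar rho t x.1.1)).
    by apply: (integrable_mulb fi mh1 (M := 4 * rho)) => x; apply: haar_le; case/andP: tr => /ltW -> /ltW ->.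
  have i2 : lebesgue3.-integrable [set: T3] (EFin \o (fun x : T3 => (g \_ cell) x * prim (haar rho t) x.1.1)).
    by apply: (integrable_mulb gi mh2) => x; apply: prim_le; exact: integrable_haar.
  have i1' := integrable_mulb i1 mI (fun x => indic_le1 _ _).
  have i2' := integrable_mulb i2 mI (fun x => indic_le1 _ _).
  have Hi := integrable_mulb (integrableD measurableT i1 i2) mI (fun x => indic_le1 _ _).
  apply: ae_imply (slice_zero Hi _) => [z Hz z2 _ _ _ _|r s r0 rs s2]; first exact: Hz.
  have mJ : measurable_fun [set: T3] (fun x : T3 => \1_`]r, s[ x.2 : R).
    by apply: (measurableT_comp _ measurable_crd3); exact: measurable_indic.
  have i1'' := integrable_mulb i1' mJ (fun x => indic_le1 _ _).
  have i2'' := integrable_mulb i2' mJ (fun x => indic_le1 _ _).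
  have := weak_haar1 fL gL tr rp rq r0 s2 fg; move/eqP; rewrite -addr_eq0 => /eqP <-.
  rewrite (_ : Rintegral _ _ _ = \int[lebesgue3]_x
    ((f \_ cell) x * haar rho t x.1.1 * \1_`]p, q[ x.1.2 * \1_`]r, s[ x.2 +
     (g \_ cell) x * prim (haar rho t) x.1.1 * \1_`]p, q[ x.1.2 * \1_`]r, s[ x.2)).
    rewrite RintegralD//; congr (_ + _); apply: eq_Rintegral => x _; rewrite /prod3; ring.
  by apply: eq_Rintegral => x _; ring.
have fiz := @ae_integrable2 _ _ _ _ R (plane_measure R) lam _ fi.
have giz := @ae_integrable2 _ _ _ _ R (plane_measure R) lam _ gi.
apply: ae_imply2 (H0) (ae_imply2 (fun z a b => conj a b) fiz giz) => z Hz [fz gz] z2.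
apply: (planar1 fz gz) => rho t p q tr pq rp rq.
exact: (Hz ((rho, t), (p, q))).
Qed.

Lemma slice_lines2 (f g : R3 R -> R) : L2per f -> L2per g -> weak_pderiv 1 f g ->
  {ae lam, forall z, 0 < z < 2 * pi ->
    line_bound (fun x y => (f \_ cell) (y, x, z)) (fun x y => (g \_ cell) (y, x, z))}.
Proof.
move=> fL gL fg; have fi := L2per_integrable fL; have gi := L2per_integrable gL.
have mhaar (rho t : R) : measurable_fun setT (haar rho t).
  by apply/measurable_EFinP; exact: measurable_int (integrable_haar rho t).
have mphaar (rho t : R) : measurable_fun setT (prim (haar rho t)).
  by apply: continuous_measurable_fun; apply: prim_continuous; exact: integrable_haar.
have H0 : {ae lam, forall z, forall i : (rat * rat) * (rat * rat), 0 < z < 2 * pi ->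
    - (ratr i.1.1 : R) < ratr i.1.2 < (ratr i.1.1 : R) -> ratr i.2.1 < ratr i.2.2 :> R ->
    (ratr i.1.1 : R) ^+ 2 + ratr i.2.1 ^+ 2 < 1 -> (ratr i.1.1 : R) ^+ 2 + ratr i.2.2 ^+ 2 < 1 ->
    \int[lam2]_x (((f \_ cell) (x, z) * haar (ratr i.1.1) (ratr i.1.2) x.2 +
       (g \_ cell) (x, z) * prim (haar (ratr i.1.1) (ratr i.1.2)) x.2) *
         \1_`]ratr i.2.1, ratr i.2.2[ x.1) = 0}.
  apply: ae_forall_count => -[[rho' t'] [p' q']] /=.
  move: (ratr rho') (ratr t') (ratr p') (ratr q') => {rho' t' p' q'} rho t p q.
  have [[tr pq rp rq]|n] := pselect [/\ - rho < t < rho, p < q,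
    rho ^+ 2 + p ^+ 2 < 1 & rho ^+ 2 + q ^+ 2 < 1]; last first.
    by apply: aeW => z _ tr pq rp rq; exfalso; apply: n.
  have mh1 : measurable_fun [set: T3] (fun x : T3 => haar rho t x.1.2).
    exact: measurableT_comp (mhaar _ _) measurable_crd2.
  have mh2 : measurable_fun [set: T3] (fun x : T3 => prim (haar rho t) x.1.2).
    exact: measurableT_comp (mphaar _ _) measurable_crd2.
  have mI : measurable_fun [set: T3] (fun x : T3 => \1_`]p, q[ x.1.1 : R).
    by apply: (measurableT_comp _ measurable_crd1); exact: measurable_indic.
  have i1 : lebesgue3.-integrable [set: T3] (EFin \o (fun x : T3 => (f \_ cell) x * haar rho t x.1.2)).
    by apply: (integrable_mulb fi mh1 (M := 4 * rho)) => x; apply: haar_le; case/andP: tr => /ltW -> /ltW ->.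
  have i2 : lebesgue3.-integrable [set: T3] (EFin \o (fun x : T3 => (g \_ cell) x * prim (haar rho t) x.1.2)).
    by apply: (integrable_mulb gi mh2) => x; apply: prim_le; exact: integrable_haar.
  have i1' := integrable_mulb i1 mI (fun x => indic_le1 _ _).
  have i2' := integrable_mulb i2 mI (fun x => indic_le1 _ _).
  have Hi := integrable_mulb (integrableD measurableT i1 i2) mI (fun x => indic_le1 _ _).
  apply: ae_imply (slice_zero Hi _) => [z Hz z2 _ _ _ _|r s r0 rs s2]; first exact: Hz.
  have mJ : measurable_fun [set: T3] (fun x : T3 => \1_`]r, s[ x.2 : R).
    by apply: (measurableT_comp _ measurable_crd3); exact: measurable_indic.
  have i1'' := integrable_mulb i1' mJ (fun x => indic_le1 _ _).
  have i2'' := integrable_mulb i2' mJ (fun x => indic_le1 _ _).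
  have := weak_haar2 fL gL tr rp rq r0 s2 fg; move/eqP; rewrite -addr_eq0 => /eqP <-.
  rewrite (_ : Rintegral _ _ _ = \int[lebesgue3]_x
    ((f \_ cell) x * haar rho t x.1.2 * \1_`]p, q[ x.1.1 * \1_`]r, s[ x.2 +
     (g \_ cell) x * prim (haar rho t) x.1.2 * \1_`]p, q[ x.1.1 * \1_`]r, s[ x.2)).
    rewrite RintegralD//; congr (_ + _); apply: eq_Rintegral => x _; rewrite /prod3; ring.
  by apply: eq_Rintegral => x _; ring.
have fiz := @ae_integrable2 _ _ _ _ R (plane_measure R) lam _ fi.
have giz := @ae_integrable2 _ _ _ _ R (plane_measure R) lam _ gi.
apply: ae_imply2 (H0) (ae_imply2 (fun z a b => conj a b) fiz giz) => z Hz [fz gz] z2.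
apply: (planar2 fz gz) => rho t p q tr pq rp rq.
exact: (Hz ((rho, t), (p, q))).
Qed.

End slices.

(** * The planar inequality *)

Section section_averages.
Context {R : realType}.
Local Notation lam := (@lebesgue_measure R).
Implicit Types g d : R -> R -> R.
Local Open Scope ereal_scope.

(** [Num.sqrt] is 0 on negative arguments, so the half-chord vanishes for |x| >= 1 and
    [half_chord_bound] holds for all x. *)
Definition half_chord (x : R) : R := Num.sqrt (1 - x ^+ 2)%R.

(* [/ 0 = 0] makes this weight vanish outside (-1, 1). *)
Definition chord_weight (x : R) : R := (2 * half_chord x)^-1%R.

Lemma half_chord_gt0 x : (0 < half_chord x)%R = (x ^+ 2 < 1)%R.
Proof. by rewrite sqrtr_gt0 subr_gt0. Qed.

Lemma half_chord_bound (s x : R) :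
  (s ^+ 2 + x ^+ 2 < 1)%R = (- half_chord x < s < half_chord x)%R.
Proof.
have [x1|x1] := ltP (x ^+ 2)%R 1%R; last first.
  rewrite [half_chord x](_ : _ = 0%R); last by apply: ler0_sqrtr; rewrite subr_le0.
  rewrite oppr0; apply/idP/idP; last by move=> /andP[/lt_trans h /h]; rewrite ltxx.
  by have := sqr_ge0 s; lra.
rewrite -ltr_norml -[in RHS](@ltr_pXn2r _ 2)// ?nnegrE ?sqrtr_ge0//.
by rewrite sqr_sqrtr ?subr_ge0 ?ltW// real_normK ?num_real// ltrBrDr.
Qed.

Lemma chord_weight_ge0 x : (0 <= chord_weight x)%R.
Proof. by rewrite invr_ge0 mulr_ge0 ?sqrtr_ge0. Qed.

Lemma sqr_lt1 (x : R) : (x ^+ 2 < 1)%R = (-1 < x < 1)%R.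
Proof. by have := half_chord_bound x 0; rewrite /half_chord expr0n/= addr0 subr0 sqrtr1. Qed.

Lemma measurable_chord_weight : measurable_fun setT chord_weight.
Proof.
rewrite (_ : chord_weight = chord_weight \_ `](-1)%R, 1%R[%classic).
  apply: (measurable_restrictT _ _).1 => //.
  apply: open_continuous_measurable_fun; first exact: itv_open.
  move=> x; rewrite inE/= in_itv/= -sqr_lt1 -half_chord_gt0 => x0.
  rewrite /chord_weight; apply: cvgV; first by rewrite mulf_neq0// gt_eqF.
  apply: cvgM; first exact: cst_continuous.
  apply: (@continuous_comp _ _ _ (fun x : R => 1 - x ^+ 2)%R (@Num.sqrt R)); last exact: sqrt_continuous.
  by apply: cvgB; [exact: cst_continuous|exact: exprn_continuous].
apply/funext => x; rewrite patchE; case: ifPn => //.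
rewrite notin_setE/= in_itv/= -sqr_lt1 => /negP; rewrite -leNgt => x1.
by rewrite /chord_weight /half_chord ler0_sqrtr ?subr_le0// mulr0 invr0.
Qed.

(* Mean plus variation: an almost everywhere bound for g on the chord at x. *)
Definition sec_avg g d (x : R) : \bar R :=
  (\1_`](-1)%R, 1%R[ x)%:E * \int[lam]_y (d x y)%:E +
  (chord_weight x)%:E * \int[lam]_y (g x y)%:E.

(** Here the first argument labels the line and the second runs along it, the opposite of
    [line_bound]. *)
Definition section_lines g d :=
  {ae lam, forall x, {ae lam, forall s, {ae lam, forall t,
    (s ^+ 2 + x ^+ 2 < 1)%R -> (t ^+ 2 + x ^+ 2 < 1)%R ->
    (g x s)%:E <= (g x t)%:E + \int[lam]_y (d x y)%:E}}}.

(** The inequality g(s) <= g(t) + D is integrated over t in the chord and divided by the length 2 l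
    of the chord; since g >= 0, the integral of g over the chord may be enlarged to the whole line.
    Off the disc g vanishes. *)
Lemma sec_avg_bound g d :
  (forall x, measurable_fun setT (g x)) -> (forall x, measurable_fun setT (d x)) ->
  (forall x y, (0 <= g x y)%R) -> (forall x y, (0 <= d x y)%R) ->
  (forall x y, (1 <= y ^+ 2 + x ^+ 2)%R -> g x y = 0%R) ->
  section_lines g d -> {ae lam, forall x, {ae lam, forall s, (g x s)%:E <= sec_avg g d x}}.
Proof.
move=> mg md g0 d0 gout; apply: ae_imply => x; apply: ae_imply => s ts.
have D0 : 0 <= \int[lam]_y (d x y)%:E by apply: integral_ge0 => y _; rewrite lee_fin.
have M0 : 0 <= \int[lam]_y (g x y)%:E by apply: integral_ge0 => y _; rewrite lee_fin.
have S0 : 0 <= sec_avg g d x.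
  apply: adde_ge0; apply: mule_ge0 => //.
  by rewrite lee_fin chord_weight_ge0.
have [sx|/gout ->//] := ltP (s ^+ 2 + x ^+ 2)%R 1%R.
have x1 : (x ^+ 2 < 1)%R by have := sqr_ge0 s; lra.
have l0 : (0 < half_chord x)%R by rewrite half_chord_gt0.
set l := half_chord x in l0.
have mI : lam `](- l)%R, l[%classic = (2 * l)%:E.
  rewrite lebesgue_measure_itv/= lte_fin ifT; last lra.
  by rewrite -EFinB; congr EFin; ring.
have cI (c : \bar R) : \int[lam]_(t in `](- l)%R, l[%classic) c = c * (2 * l)%:E.
  by rewrite integral_cst// -mI.
have : \int[lam]_(t in `](- l)%R, l[%classic) (g x s)%:E <=
    \int[lam]_(t in `](- l)%R, l[%classic) ((g x t)%:E + \int[lam]_y (d x y)%:E).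
  apply: ae_ge0_le_integral => //.
  - by move=> t _; rewrite lee_fin.
  - by move=> t _; rewrite adde_ge0// lee_fin.
  - apply: emeasurable_funD => //; apply/measurable_EFinP; exact: (measurable_funTS (mg x)).
  apply: ae_imply ts => t h; rewrite /= in_itv/= -half_chord_bound; exact: h.
rewrite ge0_integralD//; last 2 first.
- by move=> t _; rewrite lee_fin.
- by apply/measurable_EFinP; exact: (measurable_funTS (mg x)).
rewrite !cI => h.
have {h} : (g x s)%:E * (2 * l)%:E <= \int[lam]_y (g x y)%:E + (\int[lam]_y (d x y)%:E) * (2 * l)%:E.
  apply: (le_trans h); apply: leeD => //; apply: ge0_subset_integral => //.
    by apply/measurable_EFinP; exact: mg.
  by move=> y _; rewrite lee_fin.
have l20 : (0 < 2 * l)%R by rewrite mulr_gt0.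
rewrite -lee_pdivlMr// muleDl; last 2 first.
- by [].
- by rewrite ge0_adde_def// inE// mule_ge0// lee_fin ltW.
rewrite -muleA -EFinM divff ?gt_eqF// mule1 addeC /sec_avg indicE mem_set; last first.
  by rewrite /= in_itv/= -sqr_lt1.
by rewrite mul1e [in X in _ -> _ <= _ + X]muleC.
Qed.

End section_averages.

Section polar_caps.
Context {R : realType}.
Local Notation lam := (@lebesgue_measure R).

Lemma chord_weight_le (x h : R) : x ^+ 2 <= h ^+ 2 -> h ^+ 2 < 1 ->
  chord_weight x <= chord_weight h.
Proof.
move=> xh h1; rewrite lef_pV2 ?posrE ?mulr_gt0 ?half_chord_gt0//; last lra.
apply: ler_wpM2l => //; rewrite /half_chord ler_sqrt; lra.
Qed.

(* The chord weight is unbounded near the poles. Beyond the threshold 12/13 the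
   function g is bounded by its average along the other direction, so that only
   the integral of the weight over a polar cap matters; the Pythagorean triple
   (5, 12, 13) keeps the half-chords rational. *)
Lemma half_chord_12_13 : half_chord (12 / 13 : R) = 5 / 13.
Proof.
rewrite /half_chord (_ : 1 - _ = (5 / 13) ^+ 2); last by field.
by rewrite sqrtr_sqr ger0_norm// divr_ge0.
Qed.

Lemma half_chord_5_13 : half_chord (5 / 13 : R) = 12 / 13.
Proof.
rewrite /half_chord (_ : 1 - _ = (12 / 13) ^+ 2); last by field.
by rewrite sqrtr_sqr ger0_norm// divr_ge0.
Qed.

Lemma chord_weight_central (x : R) : x ^+ 2 <= (12 / 13) ^+ 2 -> chord_weight x <= 13 / 10.
Proof.
move=> /chord_weight_le h; apply: (le_trans (h _)).
  by rewrite expr_div_n; lra.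
by rewrite /chord_weight half_chord_12_13 [leLHS](_ : _ = 13 / 10)//; field.
Qed.

Lemma chord_weight_long (x : R) : x ^+ 2 <= (5 / 13) ^+ 2 -> chord_weight x <= 13 / 24.
Proof.
move=> /chord_weight_le h; apply: (le_trans (h _)).
  by rewrite expr_div_n; lra.
by rewrite /chord_weight half_chord_5_13 [leLHS](_ : _ = 13 / 24)//; field.
Qed.

Lemma within_inv_sqrt (h b : R) : b < 1 ->
  {within `[h, b], continuous (fun y : R => (Num.sqrt (1 - y))^-1)}.
Proof.
move=> b1; apply: continuous_in_subspaceT => y; rewrite inE/= in_itv/= => /andP[_ yb].
apply: cvgV; first by rewrite gt_eqF// sqrtr_gt0 subr_gt0 (le_lt_trans yb).
apply: (@continuous_comp _ _ _ (fun y : R => 1 - y) (@Num.sqrt R)); last exact: sqrt_continuous.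
by apply: cvgB; [exact: cst_continuous|].
Qed.

Lemma integral_inv_sqrt (h b : R) : h < b -> b < 1 ->
  (\int[lam]_(y in `[h, b]) ((Num.sqrt (1 - y))^-1)%:E =
   (2 * Num.sqrt (1 - h) - 2 * Num.sqrt (1 - b))%:E)%E.
Proof.
move=> hb b1; pose F y : R := - 2 * Num.sqrt (1 - y).
have dF (y : R) : y < 1 -> is_derive y 1 F (Num.sqrt (1 - y))^-1.
  move=> y1; have y0 : 0 < 1 - y by rewrite subr_gt0.
  have d1 : is_derive y 1 (fun y : R => 1 - y) (- 1).
    by apply: is_derive_eq; rewrite add0r mul1r.
  have d2 := @is_derive1_comp _ (@Num.sqrt R) (fun y : R => 1 - y) y _ _ (is_derive1_sqrt y0) d1.
  have := @is_deriveZ _ _ _ (Num.sqrt \o (fun y : R => 1 - y)) (- 2) y 1 _ d2.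
  move=> d; apply: (is_derive_eq d); rewrite -[_ *: _]/(_ * _).
  by rewrite invfM; field; rewrite gt_eqF// sqrtr_gt0.
have cF (y : R) : y < 1 -> {for y, continuous F}.
  by move=> y1; apply: differentiable_continuous; apply/derivable1_diffP; case: (dF y y1).
rewrite (@continuous_FTC2 _ _ F h b)//.
- by rewrite /F -EFinB; congr EFin; ring.
- exact: within_inv_sqrt.
- split.
  + by move=> y; rewrite in_itv/= => /andP[_ yb]; case: (dF y (lt_trans yb b1)).
  + by apply: cvg_at_right_filter; apply: cF; exact: lt_trans b1.
  + by apply: cvg_at_left_filter; apply: cF.
- move=> y; rewrite in_itv/= => /andP[_ yb].
  by rewrite derive1E; case: (dF y (lt_trans yb b1)).
Qed.

Definition polar_weight (x y : R) : R :=
  chord_weight y * \1_[set y : R | (12 / 13) ^+ 2 < y ^+ 2] y * \1_[set y : R | y ^+ 2 + x ^+ 2 < 1] y.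

Lemma measurable_polar_weight2 :
  measurable_fun [set: measurableTypeR R * measurableTypeR R]
    (fun x : R * R => polar_weight x.1 x.2).
Proof.
have msq : measurable_fun [set: measurableTypeR R] (fun y : R => y ^+ 2) by exact: measurable_funX.
have m1 : measurable [set y : measurableTypeR R | (12 / 13) ^+ 2 < y ^+ 2].
  rewrite (_ : [set y | _] = (fun y : R => y ^+ 2) @^-1` `](12 / 13) ^+ 2, +oo[).
    by rewrite -[X in measurable X]setTI; apply: msq.
  by apply/seteqP; split=> y /=; rewrite in_itv/= andbT.
have m2 : measurable [set x : measurableTypeR R * measurableTypeR R | x.2 ^+ 2 + x.1 ^+ 2 < 1].
  rewrite (_ : [set y | _] = (fun x : R * R => x.2 ^+ 2 + x.1 ^+ 2) @^-1` `]-oo, 1[).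
    rewrite -[X in measurable X]setTI.
    suff m : measurable_fun [set: measurableTypeR R * measurableTypeR R] (fun x : R * R => x.2 ^+ 2 + x.1 ^+ 2) by exact: m.
    apply: measurable_funD; apply: (measurableT_comp msq) => //.
  by apply/seteqP; split=> y /=; rewrite in_itv/=.
rewrite /polar_weight; apply: measurable_funM; first apply: measurable_funM.
- exact: (measurableT_comp measurable_chord_weight measurable_snd).
- by apply: (measurableT_comp _ measurable_snd); exact: measurable_indic.
- rewrite (_ : (fun x => _) = \1_[set x : R * R | x.2 ^+ 2 + x.1 ^+ 2 < 1]).
    exact: measurable_indic.
  by apply/funext => x; rewrite !indicE; congr (_%:R); congr nat_of_bool; apply/idP/idP; rewrite !inE.
Qed.

Lemma measurable_polar_weight (x : R) : measurable_fun setT (polar_weight x).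
Proof.
exact: (measurableT_comp measurable_polar_weight2 (pair1_measurable x)).
Qed.

(** On the upper cap 1 - y^2 >= (1 + h) (1 - y), so the weight lies below an explicit integrable
    singularity and each cap contributes at most sqrt ((1 - h) / (1 + h)), which is 1/5 for h =
    12/13. The indicator records that the chord at x meets the caps only if |x| < 5/13. At x = 0 the
    chord would reach the singularity, where the integrand is not continuous up to the endpoint;
    this is a single value of x. *)
Lemma polar_weight_integral (x : R) : x != 0 ->
  (\int[lam]_y (polar_weight x y)%:E <= (2 / 5 * \1_[set x : R | x ^+ 2 < (5 / 13) ^+ 2] x)%:E)%E.
Proof.
move=> x0; have x20 : 0 < x ^+ 2 by rewrite exprn_even_gt0.
have e1 : (12 / 13) ^+ 2 = 144 / 169 :> R by field.
have e2 : (5 / 13) ^+ 2 = 25 / 169 :> R by field.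
have [xs|xs] := ltP (x ^+ 2) ((5 / 13) ^+ 2); last first.
  rewrite integral0_eq ?lee_fin; first by rewrite mulr_ge0// divr_ge0.
  move=> y _; rewrite /polar_weight !indicE.
  case: (boolP (y \in [set y : R | (12 / 13) ^+ 2 < y ^+ 2])); last by rewrite mulr0 mul0r.
  rewrite inE/= => yh; rewrite memNset ?mulr0//=; apply/negP; rewrite -leNgt.
  by move: yh xs; rewrite e1 e2; lra.
rewrite [X in (_ <= X)%E](_ : _ = (2 / 5)%:E); last first.
  by rewrite indicE mem_set// mulr1.
pose h : R := 12 / 13; pose b := half_chord x.
have hb : h < b.
  rewrite -(@ltr_pXn2r _ 2)// ?nnegrE ?sqrtr_ge0 ?divr_ge0//.
  rewrite /b /half_chord sqr_sqrtr; last by move: xs; rewrite e2; lra.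
  by move: xs; rewrite /h e1 e2; lra.
have h0 : 0 < h by rewrite divr_gt0.
have b1 : b < 1.
  rewrite -(@ltr_pXn2r _ 2)// ?nnegrE ?sqrtr_ge0// expr1n.
  by rewrite /b /half_chord sqr_sqrtr; move: xs; rewrite ?e2; lra.
pose c : R := (2 * Num.sqrt (1 + h))^-1.
have c0 : 0 < c by rewrite invr_gt0 mulr_gt0// sqrtr_gt0; lra.
have sq (y : R) : (12 / 13) ^+ 2 < y ^+ 2 -> 0 <= y -> h < y.
  by move=> hy y0; rewrite -(@ltr_pXn2r _ 2)// nnegrE// ltW.
have wle y : h < y -> y < 1 -> chord_weight y <= c * (Num.sqrt (1 - y))^-1.
  move=> hy y1; have y0 : 0 < 1 - y by rewrite subr_gt0.
  rewrite /c -invfM lef_pV2 ?posrE ?mulr_gt0 ?sqrtr_gt0//; [|by rewrite subr_gt0; nra|lra].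
  rewrite -mulrA ler_wpM2l// -sqrtrM; last lra.
  by rewrite ler_sqrt; nra.
pose G1 (y : R) := c * (Num.sqrt (1 - y))^-1.
pose G2 (y : R) := c * (Num.sqrt (1 + y))^-1.
have G10 y : 0 <= G1 y by apply: mulr_ge0; [exact: ltW|rewrite invr_ge0 sqrtr_ge0].
have G20 y : 0 <= G2 y by apply: mulr_ge0; [exact: ltW|rewrite invr_ge0 sqrtr_ge0].
have cG1 : {within `[h, b], continuous G1}.
  move=> y; apply: cvgM; first exact: cvg_cst.
  exact: within_inv_sqrt.
have cG2 : {within `[- b, - h], continuous G2}.
  apply: continuous_in_subspaceT => y; rewrite inE/= in_itv/= => /andP[yb _].
  apply: cvgM; first exact: cst_continuous.
  apply: cvgV; first by rewrite gt_eqF// sqrtr_gt0; lra.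
  apply: (@continuous_comp _ _ _ (fun y : R => 1 + y) (@Num.sqrt R)); last exact: sqrt_continuous.
  by apply: cvgD; [exact: cst_continuous|].
have mG1 : measurable_fun `[h, b] (EFin \o G1).
  by apply/measurable_EFinP; exact: subspace_continuous_measurable_fun.
have mG2 : measurable_fun `[- b, - h] (EFin \o G2).
  by apply/measurable_EFinP; exact: subspace_continuous_measurable_fun.
have I1 : (\int[lam]_(y in `[h, b]) (G1 y)%:E <= (1 / 5)%:E)%E.
  rewrite /G1; under eq_integral do rewrite EFinM.
  rewrite ge0_integralZl_EFin//; last 2 first.
  - by apply/measurable_EFinP; apply: subspace_continuous_measurable_fun => //; exact: within_inv_sqrt.
  - exact: ltW.
  rewrite integral_inv_sqrt// -EFinM lee_fin.
  have : c * (2 * Num.sqrt (1 - h)) = 1 / 5.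
    rewrite /c (_ : 1 + h = 5 ^+ 2 * (1 - h)); last by rewrite /h; field.
    rewrite sqrtrM// sqrtr_sqr ger0_norm//.
    have : 0 < Num.sqrt (1 - h) by rewrite sqrtr_gt0; lra.
    by move=> s0; field; rewrite gt_eqF.
  have : 0 <= c * (2 * Num.sqrt (1 - b)) by apply: mulr_ge0; [exact: ltW|rewrite mulr_ge0 ?sqrtr_ge0].
  by rewrite mulrBr; lra.
have I2 : (\int[lam]_(y in `[(- b)%R, (- h)%R]) (G2 y)%:E <= (1 / 5)%:E)%E.
  by rewrite (integration_by_substitution_oppr (ltW hb) cG2).
apply: (@le_trans _ _ (\int[lam]_(y in `[h, b]) (G1 y)%:E +
    \int[lam]_(y in `[(- b)%R, (- h)%R]) (G2 y)%:E)%E); last first.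
  by apply: (le_trans (leeD I1 I2)); rewrite -EFinD lee_fin; lra.
rewrite [X in (_ <= X + _)%E]integral_mkcond [X in (_ <= _ + X)%E]integral_mkcond -ge0_integralD//; last 4 first.
- by move=> y _; rewrite patchE; case: ifP => // _; rewrite lee_fin.
- by apply/(measurable_restrictT _ _).1.
- by move=> y _; rewrite patchE; case: ifP => // _; rewrite lee_fin.
- by apply/(measurable_restrictT _ _).1.
apply: ge0_le_integral => //.
- by move=> y _; rewrite lee_fin /polar_weight !mulr_ge0// chord_weight_ge0.
- apply/measurable_EFinP; apply: measurable_polar_weight.
- by apply: emeasurable_funD; apply/(measurable_restrictT _ _).1.
move=> y _; rewrite /polar_weight.
have g0 : (0 <= ((fun x : R => (G1 x)%:E) \_ `[h, b]) y + ((fun x : R => (G2 x)%:E) \_ `[(- b)%R, (- h)%R]) y)%E.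
  by apply: adde_ge0; rewrite patchE; case: ifP => // _; rewrite lee_fin.
rewrite !indicE.
case: (boolP (y \in [set y : R | (12 / 13) ^+ 2 < y ^+ 2])); last by rewrite mulr0 mul0r.
case: (boolP (y \in [set y : R | y ^+ 2 + x ^+ 2 < 1])); last by rewrite mulr0.
rewrite !inE/= half_chord_bound -/b !mulr1 => /andP[yb by'] hy.
have [y0|y0] := leP 0 y.
  have hy' := sq _ hy y0.
  rewrite patchE mem_set; last by rewrite /= in_itv/= !ltW.
  rewrite -[leLHS]adde0; apply: leeD.
    by rewrite lee_fin wle// (lt_trans by').
  by rewrite patchE; case: ifP => // _; rewrite lee_fin.
have hy' : h < - y by apply: sq; [rewrite sqrrN|rewrite oppr_ge0 ltW].
rewrite [in X in (_ <= _ + X)%E]patchE [in X in (_ <= _ + X)%E]mem_set; last first.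
  by rewrite /= in_itv/=; lra.
rewrite -[leLHS]add0e; apply: leeD.
  by rewrite patchE; case: ifP => // _; rewrite lee_fin.
rewrite lee_fin (_ : chord_weight y = chord_weight (- y)); last first.
  by rewrite /chord_weight /half_chord sqrrN.
by rewrite (_ : G2 y = G1 (- y)) ?wle//; [lra|rewrite /G1 opprK].
Qed.

End polar_caps.

Section planar_inequality.
Context {R : realType}.
Local Notation lam := (@lebesgue_measure R).
Local Notation lam2 := (lam \x lam)%E.
Local Notation T2 := (measurableTypeR R * measurableTypeR R)%type.
Implicit Types g d e : R -> R -> R.
Local Open Scope ereal_scope.

Definition ge0_meas2 g := (forall x y, (0 <= g x y)%R) /\
  measurable_fun [set: T2] (fun x => g x.1 x.2).

Definition iint g := \int[lam]_x \int[lam]_y (g x y)%:E.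

Lemma ge0_meas2_section g x : ge0_meas2 g -> measurable_fun setT (g x).
Proof. by case=> _ mg; exact: (measurableT_comp mg (pair1_measurable x)). Qed.

Lemma ge0_meas2_swap g : ge0_meas2 g -> ge0_meas2 (fun y x => g x y).
Proof. by case=> g0 mg; split=> //; have := measurableT_comp mg (@measurable_swap _ _ (measurableTypeR R) (measurableTypeR R)). Qed.

Lemma ge0_meas2E g : ge0_meas2 g -> measurable_fun [set: T2] (fun x => (g x.1 x.2)%:E).
Proof. by case=> _ mg; apply/measurable_EFinP. Qed.

Lemma iint_lam2 g : ge0_meas2 g -> \int[lam2]_x (g x.1 x.2)%:E = iint g.
Proof.
move=> gm; have [g0 _] := gm.
rewrite fubini_tonelli1//; first exact: ge0_meas2E.
by move=> x; rewrite lee_fin.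
Qed.

Lemma iint_swap g : ge0_meas2 g -> iint (fun y x => g x y) = iint g.
Proof.
move=> gm; have [g0 _] := gm; apply/esym.
apply: (fubini_tonelli (fun x : T2 => (g x.1 x.2)%:E)).
  exact: ge0_meas2E.
by move=> x; rewrite lee_fin.
Qed.

Lemma measurable_inner g : ge0_meas2 g -> measurable_fun setT (fun x => \int[lam]_y (g x y)%:E).
Proof.
move=> gm; have [g0 _] := gm.
apply: (@measurable_fun_fubini_tonelli_F _ _ _ _ _ lam (fun x : T2 => (g x.1 x.2)%:E)).
  exact: ge0_meas2E.
by move=> x; rewrite lee_fin.
Qed.

Lemma inner_ge0 g x : ge0_meas2 g -> 0 <= \int[lam]_y (g x y)%:E.
Proof. by case=> g0 _; apply: integral_ge0 => y _; rewrite lee_fin. Qed.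

Lemma iint_ge0 g : ge0_meas2 g -> 0 <= iint g.
Proof. by move=> gm; apply: integral_ge0 => x _; exact: inner_ge0. Qed.

Lemma measurable_sec_avg g d : ge0_meas2 g -> ge0_meas2 d ->
  measurable_fun setT (sec_avg g d).
Proof.
move=> gm dm; apply: emeasurable_funD; apply: emeasurable_funM.
- by apply/measurable_EFinP; exact: measurable_indic.
- exact: measurable_inner.
- by apply/measurable_EFinP; exact: measurable_chord_weight.
- exact: measurable_inner.
Qed.

Lemma sec_avg_ge0 g d x : ge0_meas2 g -> ge0_meas2 d -> 0 <= sec_avg g d x.
Proof.
move=> gm dm; apply: adde_ge0; apply: mule_ge0; try exact: inner_ge0.
  by rewrite lee_fin.
by rewrite lee_fin chord_weight_ge0.
Qed.

Lemma ae_neq0 : {ae lam, forall x, (x != 0)%R}.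
Proof.
exists [set 0%R]; split=> //; first exact: lebesgue_measure_set1.
by move=> x /= /negP; rewrite negbK => /eqP.
Qed.

Variables (g d1 d2 : R -> R -> R).
Hypotheses (gm : ge0_meas2 g) (d1m : ge0_meas2 d1) (d2m : ge0_meas2 d2).
Hypothesis gout : forall x y, (1 <= y ^+ 2 + x ^+ 2)%R -> g x y = 0%R.

Let g0 x y : (0 <= g x y)%R. Proof. by case: gm. Qed.

Let central (x : R) : R := \1_[set x : R | x ^+ 2 < (5 / 13) ^+ 2]%R x.

Let mcentral : measurable_fun setT central.
Proof.
apply: measurable_indic.
rewrite (_ : [set x : R | _] = (fun y : R => y ^+ 2)%R @^-1` `]-oo, ((5 / 13) ^+ 2)%R[).
  rewrite -[X in measurable X]setTI.
  suff m : measurable_fun [set: measurableTypeR R] (fun y : R => y ^+ 2)%R by exact: m.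
  exact: measurable_funX.
by apply/seteqP; split=> y /=; rewrite in_itv/=.
Qed.

(** Over the central strip |x| < 5/13 the chords along y have half-length at least 12/13, so the
    weight stays below 13/24 and the average integrates to a multiple of the mass. *)
Lemma central_sec_avg_integral :
  \int[lam]_x ((central x)%:E * sec_avg g d2 x) <= iint d2 + (13 / 24)%:E * iint g.
Proof.
rewrite -ge0_integralZl_EFin//; last 2 first.
- by move=> x _; exact: inner_ge0.
- exact: measurable_inner.
rewrite -ge0_integralD//; last 4 first.
- by move=> x _; exact: inner_ge0.
- exact: measurable_inner.
- by move=> x _; apply: mule_ge0; [rewrite lee_fin divr_ge0|exact: inner_ge0].
- by apply: emeasurable_funM => //; exact: measurable_inner.
apply: ge0_le_integral => //.
- by move=> x _; apply: mule_ge0; [rewrite lee_fin|exact: sec_avg_ge0].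
- by apply: emeasurable_funM; [exact/measurable_EFinP|exact: measurable_sec_avg].
- by apply: emeasurable_funD; [|apply: emeasurable_funM => //]; exact: measurable_inner.
move=> x _; rewrite /central indicE.
have D0 := inner_ge0 x d2m; have M0 := inner_ge0 x gm.
have [xs|_] := boolP (x \in _); last first.
  by rewrite mul0e; apply: adde_ge0 => //; apply: mule_ge0 => //; rewrite lee_fin divr_ge0.
rewrite mul1e; apply: leeD.
  rewrite -[leRHS]mul1e; apply: lee_wpmul2r => //.
  by rewrite lee_fin indicE; case: (_ \in _).
apply: lee_wpmul2r => //; rewrite lee_fin chord_weight_long//.
by move: xs; rewrite inE => /ltW.
Qed.

(** The variation term integrates to at most D1, the integral of [d1]. The mean term is the integral
    of weight(y) g(x, y). For |y| <= 12/13 the weight is at most 13/10. Beyond, g(x, y) is replaced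
    by its bound [sec_avg g d2 x]; the remaining factor integrates in y to at most 2/5 and vanishes
    unless x is central, which adds 2/5 (D2 + 13/24 M). Altogether M gets 13/10 + 13/60 = 91/60. *)
Lemma sec_avg_integral :
  {ae lam, forall x, {ae lam, forall y, (g x y)%:E <= sec_avg g d2 x}} ->
  \int[lam]_y sec_avg (fun y x => g x y) (fun y x => d1 x y) y <=
  iint d1 + (2 / 5)%:E * iint d2 + (91 / 60)%:E * iint g.
Proof.
move=> gS.
have gm' := ge0_meas2_swap gm; have d1m' := ge0_meas2_swap d1m.
rewrite ge0_integralD//; last 4 first.
- by move=> y _; apply: mule_ge0; [rewrite lee_fin|exact: (inner_ge0 y d1m')].
- by apply: emeasurable_funM; [apply/measurable_EFinP; exact: measurable_indic|exact: (measurable_inner d1m')].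
- by move=> y _; apply: mule_ge0; [rewrite lee_fin chord_weight_ge0|exact: (inner_ge0 y gm')].
- by apply: emeasurable_funM; [apply/measurable_EFinP; exact: measurable_chord_weight|exact: (measurable_inner gm')].
rewrite -addeA; apply: leeD.
  rewrite -(iint_swap d1m); apply: ge0_le_integral => //.
  - by move=> y _; apply: mule_ge0; [rewrite lee_fin|exact: (inner_ge0 y d1m')].
  - by apply: emeasurable_funM; [apply/measurable_EFinP; exact: measurable_indic|exact: (measurable_inner d1m')].
  - exact: (measurable_inner d1m').
  move=> y _; rewrite -[leRHS]mul1e; apply: lee_wpmul2r; first exact: (inner_ge0 y d1m').
  by rewrite lee_fin indicE; case: (_ \in _).
pose wg x y := (chord_weight y * g x y)%R.
have wgm : ge0_meas2 wg.
  split; first by move=> x y; rewrite mulr_ge0 ?chord_weight_ge0.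
  apply: measurable_funM; last by case: gm.
  exact: (measurableT_comp measurable_chord_weight measurable_snd).
rewrite [leLHS](_ : _ = iint (fun y x => wg x y)); last first.
  apply: eq_integral => y _; rewrite -ge0_integralZl_EFin//.
  - by move=> x _; rewrite lee_fin.
  - by apply/measurable_EFinP; exact: (ge0_meas2_section y gm').
  - exact: chord_weight_ge0.
rewrite (iint_swap wgm).
have inner_le : {ae lam, forall x, setT x -> \int[lam]_y (wg x y)%:E <=
    (13 / 10)%:E * \int[lam]_y (g x y)%:E + (2 / 5)%:E * ((central x)%:E * sec_avg g d2 x)}.
  apply: ae_imply2 gS (ae_neq0) => x gSx x0 _.
  have S0 := sec_avg_ge0 x gm d2m.
  rewrite -ge0_integralZl_EFin//; last 2 first.
  - by move=> y _; rewrite lee_fin.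
  - by apply/measurable_EFinP; exact: (ge0_meas2_section x gm).
  have pw0 y : (0 <= polar_weight x y)%R.
    by rewrite /polar_weight !mulr_ge0// chord_weight_ge0.
  apply: (@le_trans _ _ (\int[lam]_y ((13 / 10)%:E * (g x y)%:E) +
     \int[lam]_y ((polar_weight x y)%:E * sec_avg g d2 x))); last first.
    apply: leeD => //; rewrite ge0_integralZr//; last 2 first.
    - by apply/measurable_EFinP; exact: measurable_polar_weight.
    - by move=> y _; rewrite lee_fin.
    rewrite muleA -EFinM; apply: lee_wpmul2r => //; exact: polar_weight_integral.
  rewrite -ge0_integralD//; last 4 first.
  - by move=> y _; rewrite -EFinM lee_fin mulr_ge0// divr_ge0.
  - by apply: emeasurable_funM => //; apply/measurable_EFinP; exact: (ge0_meas2_section x gm).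
  - by move=> y _; apply: mule_ge0 => //; rewrite lee_fin.
  - by apply: emeasurable_funM => //; apply/measurable_EFinP; exact: measurable_polar_weight.
  apply: ae_ge0_le_integral => //.
  - by move=> y _; rewrite lee_fin; case: wgm.
  - by apply/measurable_EFinP; exact: (ge0_meas2_section x wgm).
  - by move=> y _; apply: adde_ge0; [rewrite -EFinM lee_fin mulr_ge0// divr_ge0|apply: mule_ge0 => //; rewrite lee_fin].
  - apply: emeasurable_funD; apply: emeasurable_funM => //; apply/measurable_EFinP.
      exact: (ge0_meas2_section x gm).
    exact: measurable_polar_weight.
  apply: ae_imply gSx => y gy _; rewrite /wg.
  have [yh|yh] := leP (y ^+ 2)%R ((12 / 13) ^+ 2)%R.
    rewrite -[leLHS]adde0; apply: leeD.
      by rewrite -EFinM lee_fin ler_wpM2r// chord_weight_central.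
    by apply: mule_ge0 => //; rewrite lee_fin.
  rewrite -[leLHS]add0e; apply: leeD.
    by rewrite -EFinM lee_fin mulr_ge0// divr_ge0.
  have [xy|/gout ->] := ltP (y ^+ 2 + x ^+ 2)%R 1%R; last first.
    by rewrite mulr0; apply: mule_ge0 => //; rewrite lee_fin.
  rewrite /polar_weight !indicE !mem_set// !mulr1 EFinM; apply: lee_wpmul2l => //.
  by rewrite lee_fin chord_weight_ge0.
apply: (@le_trans _ _ (\int[lam]_x ((13 / 10)%:E * \int[lam]_y (g x y)%:E + (2 / 5)%:E * ((central x)%:E * sec_avg g d2 x)))).
  apply: ae_ge0_le_integral => //.
  - by move=> x _; exact: (inner_ge0 x wgm).
  - exact: measurable_inner.
  - move=> x _; apply: adde_ge0; apply: mule_ge0 => //; try exact: (inner_ge0 x gm).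
    by apply: mule_ge0; [rewrite lee_fin|exact: sec_avg_ge0].
  - apply: emeasurable_funD; apply: emeasurable_funM => //; first exact: measurable_inner.
    by apply: emeasurable_funM; [exact/measurable_EFinP|exact: measurable_sec_avg].
have cS0 x : 0 <= (central x)%:E * sec_avg g d2 x.
  by apply: mule_ge0; [rewrite lee_fin|exact: sec_avg_ge0].
have mcS : measurable_fun setT (fun x => (central x)%:E * sec_avg g d2 x).
  by apply: emeasurable_funM; [exact/measurable_EFinP|exact: measurable_sec_avg].
rewrite ge0_integralD//; last 4 first.
- by move=> x _; apply: mule_ge0 => //; exact: (inner_ge0 x gm).
- by apply: emeasurable_funM => //; exact: measurable_inner.
- by move=> x _; apply: mule_ge0.
- by apply: emeasurable_funM.
rewrite !ge0_integralZl_EFin//; last 2 first.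
- by move=> x _; exact: (inner_ge0 x gm).
- exact: measurable_inner.
have := central_sec_avg_integral; have := iint_ge0 gm; have := iint_ge0 d2m.
rewrite -/(iint g); move: (iint g) (iint d2) => M D D0 M0 h.
apply: (@le_trans _ _ ((13 / 10)%:E * M + (2 / 5)%:E * (D + (13 / 24)%:E * M))).
  by apply: leeD => //; apply: lee_wpmul2l.
rewrite ge0_muleDr//; last by apply: mule_ge0.
rewrite addeCA; apply: leeD => //.
by rewrite muleA -EFinM -ge0_muleDl// -EFinD; apply: lee_wpmul2r => //; rewrite lee_fin; lra.
Qed.

End planar_inequality.

Section planar_inequality_conclusion.
Context {R : realType}.
Local Notation lam := (@lebesgue_measure R).
Local Notation T2 := (measurableTypeR R * measurableTypeR R)%type.
Local Open Scope ereal_scope.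

Lemma mule_le_sqr_mean (A B K : \bar R) : 0 <= A -> 0 <= B -> A + B <= 2%:E * K -> A * B <= K * K.
Proof.
case: K => [k| |]; last 2 first.
- by move=> _ _ _; rewrite mulyy leey.
- by move=> A0 B0; rewrite mulrNy gtr0_sg// mul1e leeNy_eq => /eqP; case: A A0 => [a| |]//; case: B B0.
case: A => [a| |]; case: B => [b| |]//.
rewrite -!EFinM -EFinD !lee_fin => a0 b0 abk.
have : (0 <= (a - b) ^+ 2)%R := sqr_ge0 _.
nra.
Qed.

Lemma mean_sum (A B M : \bar R) : 0 <= A -> 0 <= B -> 0 <= M ->
  A + (2 / 5)%:E * B + (91 / 60)%:E * M + (B + (2 / 5)%:E * A + (91 / 60)%:E * M) =
  2%:E * ((7 / 10)%:E * (A + B) + (91 / 60)%:E * M).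
Proof.
move=> A0 B0 M0; have AB0 : 0 <= A + B by exact: adde_ge0.
rewrite ge0_muleDr; [|exact: mule_ge0|exact: mule_ge0].
rewrite addeACA; congr (_ + _); last first.
  by rewrite muleA -ge0_muleDl// -EFinD -EFinM; congr (_%:E * _); ring.
rewrite [B + _]addeC addeACA -[X in X + _ + _]mul1e -[X in _ + (_ + X)]mul1e.
rewrite -!ge0_muleDl// -!EFinD muleA -EFinM ge0_muleDr//.
by congr (_%:E * _ + _%:E * _); lra.
Qed.

(* Loomis-Whitney: g is bounded a.e. both by a function of y and by a function
   of x, so the integral of g^2 is at most the product of their integrals. *)
Lemma planar_ineq (g d1 d2 : R -> R -> R) : ge0_meas2 g -> ge0_meas2 d1 -> ge0_meas2 d2 ->
  (forall x y, (1 <= y ^+ 2 + x ^+ 2)%R -> g x y = 0%R) ->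
  section_lines (fun y x => g x y) (fun y x => d1 x y) -> section_lines g d2 ->
  iint (fun x y => g x y ^+ 2)%R <=
    ((7 / 10)%:E * (iint d1 + iint d2) + (91 / 60)%:E * iint g) *
    ((7 / 10)%:E * (iint d1 + iint d2) + (91 / 60)%:E * iint g).
Proof.
move=> gm d1m d2m gout L1 L2.
set K := (7 / 10)%:E * _ + _.
have gm' := ge0_meas2_swap gm; have d1m' := ge0_meas2_swap d1m; have d2m' := ge0_meas2_swap d2m.
have g0 x y : (0 <= g x y)%R by case: gm.
have sec0 (h : R -> R -> R) (hm : ge0_meas2 h) x y : (0 <= h x y)%R by case: hm.
pose S1 := sec_avg (fun y x => g x y) (fun y x => d1 x y); pose S2 := sec_avg g d2.
have A2 : {ae lam, forall x, {ae lam, forall y, (g x y)%:E <= S2 x}}.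
  by apply: sec_avg_bound => // x; [exact: ge0_meas2_section|exact: ge0_meas2_section|exact: sec0].
have A1 : {ae lam, forall y, {ae lam, forall x, (g x y)%:E <= S1 y}}.
  apply: (@sec_avg_bound _ (fun y x => g x y) (fun y x => d1 x y)) => //.
  - by move=> x; exact: (ge0_meas2_section x gm').
  - by move=> x; exact: (ge0_meas2_section x d1m').
  - by move=> x y; exact: (sec0 _ d1m').
  - by move=> x y h; apply: gout; rewrite addrC.
have F1 := sec_avg_integral gm d1m d2m gout A2.
have F2 := sec_avg_integral gm' d2m' d1m' (fun x y h => gout y x (eq_ind _ (fun r => 1 <= r)%R h _ (addrC _ _))) A1.
rewrite !(iint_swap d1m) !(iint_swap d2m) !(iint_swap gm) in F2.
have S10 y : 0 <= S1 y by exact: sec_avg_ge0.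
have S20 x : 0 <= S2 x by exact: sec_avg_ge0.
have mS1 : measurable_fun setT S1 by exact: measurable_sec_avg.
have mS2 : measurable_fun setT S2 by exact: measurable_sec_avg.
have mg := measurable_inner gm; have mg' := measurable_inner gm'.
apply: (@le_trans _ _ ((\int[lam]_y S1 y) * (\int[lam]_x S2 x))); last first.
  (* A product is at most the square of the mean. The bounds of the two directions add up to 2 K,
     the coefficients 1 and 2/5 of each variation averaging to 7/10. *)
  apply: mule_le_sqr_mean; [exact: integral_ge0|exact: integral_ge0|].
  apply: (le_trans (leeD F1 F2)); rewrite /K.
  have := iint_ge0 gm; have := iint_ge0 d1m; have := iint_ge0 d2m.
  by move=> ? ? ?; rewrite mean_sum.
(* One factor of g^2 is bounded by S2(x) here; after the exchange of the integrals the other is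
   bounded by S1(y). *)
apply: (@le_trans _ _ (\int[lam]_x \int[lam]_y (S2 x * (g x y)%:E))).
  have q2m : ge0_meas2 (fun x y => g x y ^+ 2)%R.
    by split=> [x y|]; [exact: sqr_ge0|apply: measurable_funX; case: gm].
  have msg : measurable_fun [set: T2] (fun x : T2 => S2 x.1 * (g x.1 x.2)%:E).
    apply: emeasurable_funM; first exact: (measurableT_comp mS2 measurable_fst).
    exact: ge0_meas2E.
  apply: ae_ge0_le_integral => //.
  - by move=> x _; exact: (inner_ge0 x q2m).
  - exact: (measurable_inner q2m).
  - by move=> x _; apply: integral_ge0 => y _; apply: mule_ge0 => //; rewrite lee_fin.
  - apply: (@measurable_fun_fubini_tonelli_F _ _ _ _ _ lam (fun x : T2 => S2 x.1 * (g x.1 x.2)%:E)) => //.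
    by move=> x; apply: mule_ge0 => //; rewrite lee_fin.
  apply: ae_imply A2 => x gx _; apply: ae_ge0_le_integral => //.
  - by move=> y _; rewrite lee_fin sqr_ge0.
  - by apply/measurable_EFinP; exact: (ge0_meas2_section x q2m).
  - by move=> y _; apply: mule_ge0 => //; rewrite lee_fin.
  - by apply: emeasurable_funM => //; apply/measurable_EFinP; exact: (ge0_meas2_section x gm).
  apply: ae_imply gx => y gxy _; rewrite expr2 EFinM; apply: lee_wpmul2r => //.
  by rewrite lee_fin.
have msg : measurable_fun [set: T2] (fun x : T2 => S2 x.1 * (g x.1 x.2)%:E).
  apply: emeasurable_funM; first exact: (measurableT_comp mS2 measurable_fst).
  exact: ge0_meas2E.
have sg0 (x : T2) : 0 <= S2 x.1 * (g x.1 x.2)%:E by apply: mule_ge0 => //; rewrite lee_fin.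
rewrite [leLHS](fubini_tonelli (fun x : T2 => S2 x.1 * (g x.1 x.2)%:E) msg sg0) /=.
rewrite -ge0_integralZr//; last by apply: integral_ge0.
apply: ae_ge0_le_integral => //.
- by move=> y _; apply: integral_ge0 => x _; exact: (sg0 (x, y)).
- exact: (@measurable_fun_fubini_tonelli_G _ _ _ _ _ lam (fun x : T2 => S2 x.1 * (g x.1 x.2)%:E)).
- by move=> y _; apply: mule_ge0 => //; apply: integral_ge0.
- by apply: emeasurable_funM.
apply: ae_imply A1 => y gy _.
rewrite -ge0_integralZl//.
apply: ae_ge0_le_integral => //.
- by move=> x _; exact: (sg0 (x, y)).
- by apply: emeasurable_funM => //; apply/measurable_EFinP; exact: (ge0_meas2_section y gm').
- by move=> x _; apply: mule_ge0.
- by apply: emeasurable_funM.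
by apply: ae_imply gy => x gxy _; rewrite muleC; apply: lee_wpmul2r.
Qed.

End planar_inequality_conclusion.

(** * Helical symmetry *)

Section translation.
Context {R : realType}.
Local Notation lam := (@lebesgue_measure R).

Definition translate (a : R) (x : measurableTypeR R) : measurableTypeR R := x + a.

Lemma measurable_translate a : measurable_fun setT (translate a).
Proof. exact: measurable_funD. Qed.

HB.instance Definition _ a := isMeasurableFun.Build _ _ _ _ (translate a) (measurable_translate a).

Lemma lebesgue_measure_translate a (A : set R) : measurable A ->
  pushforward lam (translate a) A = lam A.
Proof.
move=> mA; apply/esym/lebesgue_measure_unique => //= _ [[p q]] _ <-.
rewrite /pushforward (_ : translate a @^-1` _ = [set` `]p - a, q - a]]).
  rewrite !lebesgue_measure_itv/= !lte_fin ltrD2r; case: ifP => // _.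
  by rewrite -!EFinB; congr EFin; ring.
by apply/seteqP; split=> x /=; rewrite !in_itv/= /translate lerBrDr ltrBlDr.
Qed.

Lemma integral_translate a (f : R -> \bar R) : measurable_fun setT f ->
  (forall x, (0 <= f x)%E) -> (\int[lam]_x f (x + a)%R = \int[lam]_x f x)%E.
Proof.
move=> mf f0.
have -> : (\int[lam]_x f x = \int[pushforward lam (translate a)]_x f x)%E.
  by apply: eq_measure_integral => A mA _; exact/esym/lebesgue_measure_translate.
rewrite (ge0_integral_pushforward (measurable_translate a))//.
Qed.

End translation.

Section rotation.
Context {R : realType}.
Local Notation lam := (@lebesgue_measure R).
Local Notation lam2 := (lam \x lam)%E.
Local Notation T2 := (measurableTypeR R * measurableTypeR R)%type.
Implicit Type G : T2 -> \bar R.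
Local Open Scope ereal_scope.

Lemma measurable_linear2 (a b : R) :
  measurable_fun [set: T2] (fun x : T2 => (a * x.1 + b * x.2)%R : measurableTypeR R).
Proof. by apply: measurable_funD; apply: measurable_funM. Qed.

(** A shear translates each horizontal line by a constant, so Tonelli reduces it to translation
    invariance on the line. *)
Lemma integral_shear1 G (a : R) : measurable_fun setT G -> (forall x, 0 <= G x) ->
  \int[lam2]_x G (x.1 + a * x.2, x.2)%R = \int[lam2]_x G x.
Proof.
move=> mG G0.
have mS : measurable_fun [set: T2] (fun x : T2 => ((x.1 + a * x.2)%R, x.2) : T2).
  apply: measurable_fun_pair => //.
  by rewrite (_ : (fun x => _) = (fun x : T2 => 1 * x.1 + a * x.2)%R); [exact: measurable_linear2|apply/funext => x; rewrite mul1r].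
rewrite fubini_tonelli2//; last exact: (measurableT_comp mG mS).
rewrite fubini_tonelli2//; apply: eq_integral => y _; rewrite /fubini_G/=.
apply: (@integral_translate _ (a * y) (fun x => G (x, y))) => //.
exact: (measurableT_comp mG (pair2_measurable y)).
Qed.

Lemma integral_shear2 G (a : R) : measurable_fun setT G -> (forall x, 0 <= G x) ->
  \int[lam2]_x G (x.1, x.2 + a * x.1)%R = \int[lam2]_x G x.
Proof.
move=> mG G0.
have mS : measurable_fun [set: T2] (fun x : T2 => (x.1, (x.2 + a * x.1)%R) : T2).
  apply: measurable_fun_pair => //.
  by rewrite (_ : (fun x => _) = (fun x : T2 => a * x.1 + 1 * x.2)%R); [exact: measurable_linear2|apply/funext => x; rewrite mul1r addrC].
rewrite fubini_tonelli1//; last exact: (measurableT_comp mG mS).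
rewrite fubini_tonelli1//; apply: eq_integral => x _; rewrite /fubini_F/=.
apply: (@integral_translate _ (a * x) (fun y => G (x, y))) => //.
exact: (measurableT_comp mG (pair1_measurable x)).
Qed.

Definition linear2 (a b c d : R) (x : T2) : T2 := ((a * x.1 + b * x.2)%R, (c * x.1 + d * x.2)%R).

Lemma measurable_linear_map a b c d : measurable_fun setT (linear2 a b c d).
Proof. by apply: measurable_fun_pair; exact: measurable_linear2. Qed.

(* A rotation of angle different from pi is a product of three shears; the
   rotation of angle pi is the square of one of angle pi/2. *)
Lemma integral_rotation G (c s : R) : (c ^+ 2 + s ^+ 2 = 1)%R ->
  measurable_fun setT G -> (forall x, 0 <= G x) ->
  \int[lam2]_x G (linear2 c s (- s)%R c x) = \int[lam2]_x G x.
Proof.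
have main : forall G (c s : R), (c ^+ 2 + s ^+ 2 = 1)%R -> (c != -1)%R ->
    measurable_fun setT G -> (forall x, 0 <= G x) ->
    \int[lam2]_x G (linear2 c s (- s)%R c x) = \int[lam2]_x G x.
  (* [a] is the tangent of the half-angle: the two outer shears have factor a, the middle one has
     factor -s. *)
  move=> {}G {}c {}s cs cN mG G0; pose a := (s / (1 + c))%R.
  have cD : (1 + c != 0)%R by rewrite addrC addr_eq0.
  have a1c : (a * (1 + c) = s)%R by rewrite /a divfK.
  have sa : (s * a = 1 - c)%R.
    apply: (mulIf cD); rewrite -mulrA a1c -expr2 (_ : s ^+ 2 = 1 - c ^+ 2)%R; last by move: cs; lra.
    by ring.
  rewrite -(integral_shear1 a mG G0).
  pose G1 (x : T2) := G (x.1 + a * x.2, x.2)%R.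
  have mG1 : measurable_fun setT G1.
    rewrite (_ : G1 = G \o linear2 1 a 0 1); first exact: (measurableT_comp mG (measurable_linear_map _ _ _ _)).
    by apply/funext => x; rewrite /G1 /= /linear2 !mul1r mul0r add0r.
  rewrite -(integral_shear2 (- s)%R mG1 (fun x => G0 _)).
  pose G2 (x : T2) := G1 (x.1, x.2 + - s * x.1)%R.
  have mG2 : measurable_fun setT G2.
    rewrite (_ : G2 = G1 \o linear2 1 0 (- s)%R 1); first exact: (measurableT_comp mG1 (measurable_linear_map _ _ _ _)).
    by apply/funext => x; rewrite /G2 /= /linear2 !mul1r mul0r addr0 addrC.
  rewrite -(integral_shear1 a mG2 (fun x => G0 _)).
  apply: eq_integral => x _; rewrite /G2 /G1 /= /linear2; congr (G (_, _)).
    symmetry; transitivity ((1 - s * a) * x.1 + (2 * a - a * (s * a)) * x.2)%R; first ring.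
    rewrite sa; have -> : (2 * a - a * (1 - c) = a * (1 + c))%R by ring.
    by rewrite a1c; ring.
  symmetry; transitivity (- s * x.1 + (1 - s * a) * x.2)%R; first ring.
  by rewrite sa; ring.
move=> cs mG G0; have [cN|] := eqVneq c (-1)%R; last by move=> cN; exact: main.
have s0 : s = 0%R.
  apply/eqP; rewrite -sqrf_eq0; apply/eqP; move: cs; rewrite cN; lra.
have h : (0 ^+ 2 + 1 ^+ 2 = 1 :> R)%R by rewrite expr0n expr1n add0r.
have nz : (0 != -1 :> R)%R by rewrite eq_sym oppr_eq0 oner_eq0.
rewrite -(main G 0%R 1%R h nz mG G0).
have mG1 : measurable_fun setT (G \o linear2 0 1 (- 1)%R 0).
  exact: (measurableT_comp mG (measurable_linear_map _ _ _ _)).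
rewrite -(main _ 0%R 1%R h nz mG1 (fun x => G0 _)).
apply: eq_integral => x _; rewrite /= /linear2 /= cN s0; congr (G (_, _)); ring.
Qed.

End rotation.

Section helical_slices.
Context {R : realType}.
Local Notation lam := (@lebesgue_measure R).
Local Notation lam2 := (lam \x lam)%E.
Local Notation T2 := (measurableTypeR R * measurableTypeR R)%type.
Local Notation T3 := (R3 (measurableTypeR R)).

Lemma lam_setT_neq0 : lam [set: R] != 0%E.
Proof.
apply/eqP => l0; have : (lam `[0%R, 1%R]%classic <= lam [set: R])%E.
  by apply: le_measure; rewrite ?inE.
by rewrite l0 lebesgue_measure_itv/= lte_fin ltr01 -EFinB subr0 lee_fin ler10.
Qed.

Lemma ae_exists (P : R -> Prop) : {ae lam, forall x, P x} -> exists x, P x.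
Proof.
move=> [N [mN N0 PN]]; apply: contrapT => nP.
have /eqP := lam_setT_neq0; apply.
rewrite (_ : setT = N)//; apply/seteqP; split=> x //= _.
by apply: PN => Px; apply: nP; exists x.
Qed.

Lemma ae_translate (P : R -> Prop) a : {ae lam, forall x, P (a + x)} -> {ae lam, forall x, P x}.
Proof.
move=> [N [mN N0 PN]]; exists (translate (- a) @^-1` N); split.
- by rewrite -[X in measurable X]setTI; exact: measurable_translate.
- by rewrite -N0; exact: lebesgue_measure_translate.
- move=> x /= nPx; apply: PN => /=.
  by rewrite /translate (_ : a + _ = x)//; rewrite addrC subrK.
Qed.

(* Ergodicity of the full translation group of the line. *)
Lemma translation_invariant_cst (J : R -> \bar R) : measurable_fun setT J ->
  (forall z, 0 <= J z)%E ->
  (forall t, {ae lam, forall z, J (z + t) = J z}) -> exists c, {ae lam, forall z, J z = c}.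
Proof.
move=> mJ J0 Jt.
have mJ1 : measurable_fun [set: T2] (fun x : T2 => J (x.1 + x.2)).
  by apply: (measurableT_comp mJ); exact: measurable_funD.
have mJ2 : measurable_fun [set: T2] (fun x : T2 => J x.1) by exact: measurableT_comp.
pose N : set T2 := [set x | J (x.1 + x.2) != J x.1].
have mN : measurable N.
  (* Differences are taken of finite parts, where [fine] sends +oo to 0; the two sets on which
     exactly one of the values is infinite are added. The value -oo is excluded by J >= 0. *)
  rewrite (_ : N = [set x | fine (J (x.1 + x.2)) - fine (J x.1) != 0] `|`
      ([set x | J (x.1 + x.2) != +oo%E] `\` [set x | J x.1 != +oo%E]) `|`
      ([set x | J x.1 != +oo%E] `\` [set x | J (x.1 + x.2) != +oo%E])).
    apply: measurableU; first apply: measurableU.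
    - rewrite (_ : [set _ | _] = (fun x : T2 => fine (J (x.1 + x.2)) - fine (J x.1)) @^-1` (~` [set 0])).
        rewrite -[X in measurable X]setTI.
        suff m : measurable_fun [set: T2] (fun x : T2 => fine (J (x.1 + x.2)) - fine (J x.1)).
          by apply: m => //; exact: measurableC.
        by apply: measurable_funB; apply: measurableT_comp.
      by apply/seteqP; split=> x /= => [/eqP|/eqP].
    - by apply: measurableD; rewrite -[X in measurable X]setTI; exact: emeasurable_neq.
    - by apply: measurableD; rewrite -[X in measurable X]setTI; exact: emeasurable_neq.
  apply/seteqP; rewrite /N; split=> x /=; have := J0 (x.1 + x.2); have := J0 x.1.
    case: (J (x.1 + x.2)) => [a| |]; case: (J x.1) => [b| |]//= _ _.
    - by move=> ab; left; left; rewrite subr_eq0.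
    - by move=> _; left; right; split=> //; rewrite eqxx.
    - by move=> _; right; split=> //; rewrite eqxx.
  case: (J (x.1 + x.2)) => [a| |]; case: (J x.1) => [b| |]//= _ _.
    by case=> [[|[_ []]//]|[_ []]//]; rewrite subr_eq0.
  by rewrite subrr eqxx => -[[|[]]|[]].
have N0 : lam2 N = 0%E.
  rewrite product_measure_ysection//; apply: integral0_eq => t _.
  have [A [mA A0 PA]] := Jt t.
  apply/eqP; rewrite eq_le measure_ge0 andbT -A0; apply: le_measure; rewrite ?inE//.
    exact: measurable_ysection.
  by move=> z; rewrite /ysection/= inE /N/= => /eqP nz; exact: PA.
have : {ae lam2, forall x : T2, J (x.1 + x.2) = J x.1}.
  by exists N; split=> // x /= /eqP.
(* The sections of N at fixed t are null, hence N is; its sections at fixed z are then null for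
   almost every z. For one such z0 the value at z0 + t is J z0 for almost every t. *)
move=> /ae_xsection/ae_exists[z0 hz0]; exists (J z0).
exact: (@ae_translate (fun z => J z = J z0) z0).
Qed.

Lemma crd_sum (x : R3 R) : \sum_(i < 3) crd i x ^+ 2 = x.1.1 ^+ 2 + x.1.2 ^+ 2 + x.2 ^+ 2.
Proof. by rewrite !big_ord_recl big_ord0 addr0 /crd /= addrA. Qed.

Lemma cylinder_screw t (x : R3 R) : cylinder (screw t x) <-> cylinder x.
Proof.
rewrite /cylinder/= /screw /shift3 /rotation /=.
have -> : (cos t * x.1.1 + sin t * x.1.2) ^+ 2 + (- sin t * x.1.1 + cos t * x.1.2) ^+ 2 =
  (cos t ^+ 2 + sin t ^+ 2) * (x.1.1 ^+ 2 + x.1.2 ^+ 2) by ring.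
by rewrite cos2Dsin2 mul1r.
Qed.

Lemma enorm_rotation t (y : R3 R) :
  \sum_(i < 3) crd i (rotation t y) ^+ 2 = \sum_(i < 3) crd i y ^+ 2.
Proof.
rewrite !crd_sum /rotation/=; congr (_ + _).
have -> : (cos t * y.1.1 + sin t * y.1.2) ^+ 2 + (- sin t * y.1.1 + cos t * y.1.2) ^+ 2 =
  (cos t ^+ 2 + sin t ^+ 2) * (y.1.1 ^+ 2 + y.1.2 ^+ 2) by ring.
by rewrite cos2Dsin2 mul1r.
Qed.

(** The screw carries the slice at z to the slice at z + t by a rotation, which preserves plane
    integrals and |u|^2; [H] is a function of |u|^2 alone. So for each t the slice integral is
    invariant under translation by t, up to a null set depending on t, and ergodicity applies. *)
Lemma helical_slice_integral (u : R3 R -> R3 R) (H : T3 -> R) :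
  measurable_fun [set: T3] H -> (forall x, 0 <= H x) ->
  (forall x, ~ cylinder x -> H x = 0) ->
  (forall x y, cylinder x -> cylinder y ->
    \sum_(i < 3) crd i (u x) ^+ 2 = \sum_(i < 3) crd i (u y) ^+ 2 -> H x = H y) ->
  helical u ->
  exists c, {ae lam, forall z, (\int[lam2]_x (H (x, z))%:E = c)%E}.
Proof.
move=> mH H0 Hout Hu hel.
have mHz z : measurable_fun [set: T2] (fun x : T2 => (H (x, z))%:E).
  by apply/measurable_EFinP; exact: (measurableT_comp mH (pair2_measurable z)).
apply: translation_invariant_cst.
  apply: (@measurable_fun_fubini_tonelli_G _ _ T2 _ R (plane_measure R) (fun x : T3 => (H x)%:E)).
    exact/measurable_EFinP.
  by move=> x; rewrite lee_fin.
  by move=> z; apply: integral_ge0 => x _; rewrite lee_fin.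
move=> t; apply: ae_imply (@ae_ysection _ _ T2 _ R (plane_measure R) lam _ (hel t)) => z uz.
have cs := cos2Dsin2 t.
rewrite -(integral_rotation cs (mHz (z + t))); last by move=> x; rewrite lee_fin.
apply: ae_eq_integral => //.
  exact: (measurableT_comp (mHz _) (measurable_linear_map _ _ _ _)).
apply: ae_imply uz => x ux _; congr EFin.
rewrite (_ : (linear2 _ _ _ _ x, z + t) = screw t (x, z))//.
have [xc|xc] := pselect (cylinder ((x, z) : R3 R)).
  apply: Hu => //; first by apply/cylinder_screw.
  by rewrite ux// enorm_rotation.
by rewrite !Hout// => /cylinder_screw.
Qed.

End helical_slices.

Section vector_lines.
Context {R : realType}.
Local Notation lam := (@lebesgue_measure R).

(** The planar inequality is applied to the single function |u|^2, so the bounds on lines are summed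
    over the components first. *)
Lemma section_lines_sum (I : finType) (F V : I -> R -> R -> R) :
  (forall i y, measurable_fun setT (F i y)) -> (forall i y, measurable_fun setT (V i y)) ->
  (forall i, line_bound (fun x y => F i y x) (fun x y => V i y x)) ->
  section_lines (fun y x => \sum_i F i y x ^+ 2) (fun y x => 2 * \sum_i `|F i y x * V i y x|).
Proof.
move=> mF mV FV.
have := ae_forall_count FV; apply: ae_imply => y.
move=> /ae_forall_count; apply: ae_imply => s /ae_forall_count.
apply: ae_imply => t h sy ty.
under eq_integral => x _ do rewrite mulr_sumr -sumEFin.
rewrite ge0_integral_sum//; last first.
- move=> i; apply/measurable_EFinP; apply: measurable_funM => //.
  by apply: measurableT_comp => //; exact: (measurable_funM (mF i y) (mV i y)).
rewrite -!sumEFin -big_split/=; apply: lee_sum => i _.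
have -> : (\int[lam]_x (2 * `|F i y x * V i y x|)%:E = 2%:E * \int[lam]_x `|F i y x * V i y x|%:E)%E.
  under eq_integral do rewrite EFinM.
  rewrite ge0_integralZl_EFin//.
  by apply/measurable_EFinP; apply: measurableT_comp => //; exact: (measurable_funM (mF i y) (mV i y)).
apply: (@le_trans _ _ ((F i y t ^+ 2)%:E + `|F i y t ^+ 2 - F i y s ^+ 2|%:E)%E).
  by rewrite -EFinD lee_fin; have := ler_norm (- (F i y t ^+ 2 - F i y s ^+ 2)); rewrite normrN; lra.
by apply: leeD => //; exact: (h i).
Qed.

End vector_lines.

Section slicing3.
Context {R : realType}.
Local Notation lam := (@lebesgue_measure R).
Local Notation T2 := (measurableTypeR R * measurableTypeR R)%type.
Local Notation T3 := (R3 (measurableTypeR R)).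
Local Open Scope ereal_scope.

Definition slice (h : T3 -> R) (z : R) (x y : R) : R := h (x, y, z).

Lemma slice_meas2 (h : T3 -> R) z : measurable_fun setT h -> (forall x, (0 <= h x)%R) ->
  ge0_meas2 (slice h z).
Proof.
move=> mh h0; split=> [x y|]; first exact: h0.
rewrite (_ : (fun x : T2 => _) = h \o (fun x : T2 => (x, z))).
  exact: (measurableT_comp mh (pair2_measurable z)).
by apply/funext => -[].
Qed.

Lemma slices_integral (h : T3 -> R) : measurable_fun setT h -> (forall x, (0 <= h x)%R) ->
  \int[lebesgue3]_x (h x)%:E = \int[lam]_z iint (slice h z).
Proof.
move=> mh h0.
have mh' : measurable_fun [set: T3] (fun x => (h x)%:E) by exact/measurable_EFinP.
have := @fubini_tonelli2 _ _ T2 _ R (plane_measure R) lam (fun x : T3 => (h x)%:E) mh' _.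
move=> -> ; last by move=> x; rewrite lee_fin.
apply: eq_integral => z _; rewrite -(iint_lam2 (slice_meas2 z mh h0)).
by apply: eq_integral => -[].
Qed.

Lemma measurable_slice_iint (h : T3 -> R) : measurable_fun setT h -> (forall x, (0 <= h x)%R) ->
  measurable_fun setT (fun z => iint (slice h z)).
Proof.
move=> mh h0.
have mh' : measurable_fun [set: T3] (fun x => (h x)%:E) by exact/measurable_EFinP.
rewrite (_ : (fun z => _) = fubini_G (plane_measure R) (fun x : T3 => (h x)%:E)).
  apply: (@measurable_fun_fubini_tonelli_G _ _ T2 _ R (plane_measure R) (fun x : T3 => (h x)%:E)) => //.
apply/funext => z; rewrite -(iint_lam2 (slice_meas2 z mh h0)).
by apply: eq_integral => -[].
Qed.

End slicing3.

Section field_slices.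
Context {R : realType}.
Local Notation lam := (@lebesgue_measure R).
Local Notation T3 := (R3 (measurableTypeR R)).
Variables (u : R3 R -> R3 R) (du : 'I_3 -> 'I_3 -> R3 R -> R).
Hypothesis uH1 : in_H1v u du.

Definition cell_sqr (x : T3) : R := \sum_(i < 3) ((crd i \o u) \_ cell) x ^+ 2.

(** Pointwise bound for the derivative of |u|^2 along x_j, the factor 2 of the chain rule
    included. *)
Definition cell_flux (j : 'I_3) (x : T3) : R :=
  2 * \sum_(i < 3) `|((crd i \o u) \_ cell) x * (du i j \_ cell) x|.

Lemma cell_sqr_ge0 x : 0 <= cell_sqr x.
Proof. by apply: sumr_ge0 => i _; exact: sqr_ge0. Qed.

Lemma cell_flux_ge0 j x : 0 <= cell_flux j x.
Proof. by rewrite mulr_ge0// sumr_ge0. Qed.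

Lemma measurable_u i : measurable_fun [set: T3] ((crd i \o u) \_ cell).
Proof. by apply: L2per_measurable; case: (uH1 i). Qed.

Lemma measurable_du i j : measurable_fun [set: T3] (du i j \_ cell).
Proof. by apply: L2per_measurable; case: (uH1 i) => _ /(_ j)[]. Qed.

Lemma measurable_cell_sqr : measurable_fun setT cell_sqr.
Proof. by apply: measurable_sum => i; apply: measurable_funX; exact: measurable_u. Qed.

Lemma measurable_cell_flux j : measurable_fun setT (cell_flux j).
Proof.
apply: measurable_funM => //; apply: measurable_sum => i; apply: measurableT_comp => //.
by apply: measurable_funM; [exact: measurable_u|exact: measurable_du].
Qed.

(** This is K(z). Being linear in the slice integrals, it integrates in z to the same expression
    over the whole cell, [total_mean]. *)
Definition slice_mean z : \bar R :=
  ((7 / 10)%:E * (iint (slice (cell_flux 0%R) z) + iint (slice (cell_flux 1%R) z)) +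
   (91 / 60)%:E * iint (slice cell_sqr z))%E.

Lemma ae_slice_ineq : {ae lam, forall z, 0 < z < 2 * pi ->
  (iint (fun x y => slice cell_sqr z x y ^+ 2)%R <= slice_mean z * slice_mean z)%E}.
Proof.
have l1 : {ae lam, forall z, forall i : 'I_3, 0 < z < 2 * pi ->
    line_bound (fun x y => ((crd i \o u) \_ cell) (x, y, z)) (fun x y => (du i 0 \_ cell) (x, y, z))}.
  by apply: ae_forall_count => i; have [uL /(_ 0)[dL w]] := uH1 i; exact: slice_lines1.
have l2 : {ae lam, forall z, forall i : 'I_3, 0 < z < 2 * pi ->
    line_bound (fun x y => ((crd i \o u) \_ cell) (y, x, z)) (fun x y => (du i 1 \_ cell) (y, x, z))}.
  by apply: ae_forall_count => i; have [uL /(_ 1)[dL w]] := uH1 i; exact: slice_lines2.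
apply: ae_imply2 l1 l2 => z h1 h2 z2.
have mu i := measurable_u i; have mdu i j := measurable_du i j.
apply: planar_ineq.
- exact: slice_meas2 measurable_cell_sqr cell_sqr_ge0.
- exact: slice_meas2 (measurable_cell_flux 0) (cell_flux_ge0 0).
- exact: slice_meas2 (measurable_cell_flux 1) (cell_flux_ge0 1).
- move=> x y xy; rewrite /slice /cell_sqr big1// => i _; rewrite patchE memNset ?expr0n//=.
  by case=> /=; move: xy; lra.
- have mz (y : R) : measurable_fun [set: R] (fun x : R => ((x, y), z) : T3).
    exact: (measurableT_comp (pair2_measurable z) (pair2_measurable y)).
  apply: (@section_lines_sum _ _ (fun i y x => ((crd i \o u) \_ cell) (x, y, z))
    (fun i y x => (du i 0 \_ cell) (x, y, z))).
  + by move=> i y; exact: (measurableT_comp (mu i) (mz y)).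
  + by move=> i y; exact: (measurableT_comp (mdu i 0) (mz y)).
  + by move=> i; exact: h1.
- have mz (y : R) : measurable_fun [set: R] (fun x : R => ((y, x), z) : T3).
    exact: (measurableT_comp (pair2_measurable z) (pair1_measurable y)).
  apply: (@section_lines_sum _ _ (fun i y x => ((crd i \o u) \_ cell) (y, x, z))
    (fun i y x => (du i 1 \_ cell) (y, x, z))).
  + by move=> i y; exact: (measurableT_comp (mu i) (mz y)).
  + by move=> i y; exact: (measurableT_comp (mdu i 1) (mz y)).
  + by move=> i; exact: h2.
Qed.

End field_slices.

(** * The fourth power of a helical field *)

Section helical_fourth_power.
Context {R : realType}.
Local Notation lam := (@lebesgue_measure R).
Local Notation T3 := (R3 (measurableTypeR R)).
Variables (u : R3 R -> R3 R) (du : 'I_3 -> 'I_3 -> R3 R -> R).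
Hypothesis uH1 : in_H1v u du.

Definition total_mean : \bar R :=
  ((7 / 10)%:E * (\int[lebesgue3]_x (cell_flux u du 0%R x)%:E + \int[lebesgue3]_x (cell_flux u du 1%R x)%:E) +
   (91 / 60)%:E * \int[lebesgue3]_x (cell_sqr u x)%:E)%E.

Let msqr := measurable_cell_sqr uH1.
Let mflux j := measurable_cell_flux uH1 j.
Let sqr0 := @cell_sqr_ge0 R u.
Let flux0 := @cell_flux_ge0 R u du.

Lemma slice_mean_ge0 z : (0 <= slice_mean u du z)%E.
Proof.
have i0 (h : T3 -> R) : measurable_fun [set: T3] h -> (forall x, 0 <= h x) -> (0 <= iint (slice h z))%E.
  by move=> mh h0; apply: iint_ge0; exact: slice_meas2.
by apply: adde_ge0; apply: mule_ge0 => //; [apply: adde_ge0|]; apply: i0.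
Qed.

Lemma measurable_slice_mean : measurable_fun setT (slice_mean u du).
Proof.
apply: emeasurable_funD; apply: emeasurable_funM => //; last exact: measurable_slice_iint.
by apply: emeasurable_funD; apply: measurable_slice_iint.
Qed.

Lemma slice_mean_integral : (\int[lam]_z slice_mean u du z = total_mean)%E.
Proof.
rewrite /total_mean !slices_integral// /slice_mean.
have mi (h : T3 -> R) : measurable_fun [set: T3] h -> (forall x, 0 <= h x) ->
    exists2 f : R -> \bar R, f = (fun z => iint (slice h z)) &
      measurable_fun setT f /\ forall z, (0 <= f z)%E.
  move=> mh h0; exists (fun z => iint (slice h z)) => //.
  by split; [exact: measurable_slice_iint|move=> z; apply: iint_ge0; exact: slice_meas2].
have [f0 e0 [m0 p0]] := mi _ (mflux 0) (flux0 0); have [f1 e1 [m1 p1]] := mi _ (mflux 1) (flux0 1).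
have [f2 e2 [ms ps]] := mi _ msqr sqr0.
rewrite -e0 -e1 -e2.
transitivity (\int[lam]_z ((7 / 10)%:E * (f0 z + f1 z) + (91 / 60)%:E * f2 z))%E.
  by apply: eq_integral => z _; rewrite e0 e1 e2.
have p01 z : (0 <= f0 z + f1 z)%E by exact: adde_ge0.
have m01 : measurable_fun setT (fun z => f0 z + f1 z)%E by exact: emeasurable_funD.
rewrite ge0_integralD//.
- by rewrite !ge0_integralZl_EFin// ge0_integralD.
- by move=> z _; exact: mule_ge0.
- exact: emeasurable_funM.
- by move=> z _; exact: mule_ge0.
- exact: emeasurable_funM.
Qed.

Lemma sqrt_le_of_sqr (c k : \bar R) : (0 <= c)%E -> (0 <= k)%E -> (c <= k * k)%E ->
  ((if c is r%:E then (Num.sqrt r)%:E else +oo) <= k)%E.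
Proof.
case: k => [k| |]// c0 k0; last by case: c c0 => [r| |]; rewrite ?leey.
case: c c0 => [r r0|_|//]; last by rewrite -EFinM leye_eq.
rewrite -EFinM !lee_fin => h; rewrite lee_fin in k0.
by rewrite -(ger0_norm k0) -sqrtr_sqr ler_sqrt ?sqr_ge0// expr2.
Qed.

Lemma cell_sqr2_integral : helical u -> exists2 c : \bar R, (0 <= c)%E &
  (\int[lebesgue3]_x (cell_sqr u x ^+ 2)%:E = (2 * pi)%:E * c)%E /\
  {ae lam, forall z, 0 < z < 2 * pi -> iint (fun x y => slice (cell_sqr u) z x y ^+ 2) = c}.
Proof.
move=> hel.
have pi20 : 0 < 2 * pi :> R by rewrite mulr_gt0// pi_gt0.
pose S (x : T3) := \sum_(i < 3) crd i (u x) ^+ 2.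
(* |u|^4 is taken on the whole cylinder, because the screw motions do not preserve the cell; the two
   restrictions agree for 0 < z < 2 pi. *)
pose H := (fun x => S x ^+ 2) \_ cylinder.
have mH : measurable_fun [set: T3] H.
  apply: (measurable_restrictT _ measurable_cylinder).1; apply: measurable_funX.
  by apply: measurable_sum => i; apply: measurable_funX; case: (uH1 i) => -[].
have H0 x : 0 <= H x by rewrite /H patchE; case: ifP => // _; exact: sqr_ge0.
have Hout x : ~ cylinder x -> H x = 0 by move=> xc; rewrite /H patchE memNset.
have Hu x y : cylinder x -> cylinder y -> S x = S y -> H x = H y.
  by move=> xc yc e; rewrite /H !patchE !mem_set// e.
have [c Jc] := helical_slice_integral mH H0 Hout Hu hel.
have c0 : (0 <= c)%E.
  have [z <-] := ae_exists Jc; apply: integral_ge0 => x _; rewrite lee_fin; exact: H0.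
have q0 x : 0 <= cell_sqr u x ^+ 2 by exact: sqr_ge0.
have mq : measurable_fun [set: T3] (fun x => cell_sqr u x ^+ 2) by exact: measurable_funX.
have sH z x y : 0 < z < 2 * pi -> cell_sqr u (x, y, z) ^+ 2 = H (x, y, z).
  move=> /andP[z0 z2]; rewrite /H patchE /cell_sqr.
  have [xc|xc] := pselect (cylinder ((x, y, z) : T3)).
    rewrite mem_set//; congr (_ ^+ 2); apply: eq_bigr => i _.
    by rewrite patchE mem_set//; split=> //=; rewrite !ltW.
  rewrite memNset// big1 ?expr0n// => i _.
  by rewrite patchE memNset ?expr0n// => -[].
have sc : {ae lam, forall z, 0 < z < 2 * pi ->
    iint (fun x y => slice (cell_sqr u) z x y ^+ 2) = c}.
  apply: ae_imply Jc => z <- z2; rewrite -iint_lam2; last first.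
    exact: (slice_meas2 z mq q0).
  by apply: eq_integral => -[x y] _; rewrite /slice sH.
exists c => //; split=> //.
rewrite slices_integral//.
transitivity (\int[lam]_z ((\1_`]0%R, (2 * pi)%R[ z)%:E * c))%E.
  apply: ae_eq_integral => //.
  - exact: measurable_slice_iint.
  - by apply: emeasurable_funM => //; apply/measurable_EFinP; exact: measurable_indic.
  have ne0 : {ae lam, forall z : R, z != 0 /\ z != 2 * pi}.
    exists [set 0; 2 * pi]; split.
    - by apply: measurableU.
    - by apply: countable_lebesgue_measure0; exact/finite_set_countable/finite_set2.
    - move=> z /= /not_andP[] /negP; rewrite negbK => /eqP ->; by [left|right].
  apply: ae_imply2 sc ne0 => z hz [z0 z2] _; rewrite indicE.
  have [zi|zi] := boolP (z \in _).
    by rewrite mul1e; apply: hz; move: zi; rewrite inE/= in_itv.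
  rewrite mul0e; apply: integral0_eq => x _; apply: integral0_eq => y _.
  rewrite /slice /cell_sqr big1 ?expr0n// => i _.
  rewrite patchE memNset ?expr0n//= => -[_ /= /andP[h1 h2]].
  move: zi; rewrite notin_setE/= in_itv/=; apply; apply/andP.
  by split; rewrite lt_neqAle ?h1 ?h2 andbT// eq_sym.
rewrite ge0_integralZr//; last by apply/measurable_EFinP; exact: measurable_indic.
rewrite integral_indic// setIT; congr (_ * _)%E.
by rewrite -[LHS]/(lam `]0%R, (2 * pi)%R[%classic) lebesgue_measure_itv/= lte_fin pi20 oppr0 addr0.
Qed.

Lemma helical_fourth_power : helical u -> (total_mean < +oo)%E ->
  ((2 * pi)%:E * \int[lebesgue3]_x (cell_sqr u x ^+ 2)%:E <= total_mean * total_mean)%E.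
Proof.
move=> hel tfin; have [c c0 [-> sc]] := cell_sqr2_integral hel.
have pi20 : 0 < 2 * pi :> R by rewrite mulr_gt0// pi_gt0.
(* The square root of c. A priori c may be +oo; then s is too, and finiteness of the total mean will
   exclude it. *)
pose s : \bar R := if c is r%:E then (Num.sqrt r)%:E else +oo%E.
have s0 : (0 <= s)%E by rewrite /s; case: (c) => [r| |] //; rewrite lee_fin sqrtr_ge0.
have : (s * (2 * pi)%:E <= total_mean)%E.
  rewrite -slice_mean_integral.
  have mI : lam `]0%R, (2 * pi)%R[%classic = (2 * pi)%:E.
    by rewrite lebesgue_measure_itv/= lte_fin pi20 -EFinB subr0.
  apply: (@le_trans _ _ (\int[lam]_(z in `]0%R, (2 * pi)%R[) slice_mean u du z)%E); last first.
    apply: ge0_subset_integral => //; first exact: measurable_slice_mean.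
    by move=> z _; exact: slice_mean_ge0.
  rewrite -mI -integral_cst//; apply: ae_ge0_le_integral => //.
  - by move=> z _; exact: slice_mean_ge0.
  - exact: (measurable_funTS measurable_slice_mean).
  apply: ae_imply2 sc (ae_slice_ineq uH1) => z zc zK; rewrite /= in_itv/= => z2.
  by apply: sqrt_le_of_sqr => //; [exact: slice_mean_ge0|rewrite -(zc z2); exact: zK].
move: tfin; have : (0 <= total_mean)%E.
  by rewrite -slice_mean_integral; apply: integral_ge0 => z _; exact: slice_mean_ge0.
case: total_mean => [k| |]// k0 _; rewrite /s; case: (c) c0 => [r| |]//; last first.
  by rewrite gt0_mulye ?lte_fin.
rewrite -!EFinM !lee_fin => r0 h; rewrite lee_fin in k0.
have := sqr_sqrtr r0; have := sqrtr_ge0 r; move: (Num.sqrt r) h => q h q0 <-.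
rewrite (_ : _ * _ = (q * (2 * pi)) ^+ 2); last by ring.
by rewrite -expr2; apply: lerXn2r => //; rewrite nnegrE// mulr_ge0// ltW.
Qed.

End helical_fourth_power.

(** * Norms of the field and the numerical constant *)

Section three_term_bounds.
Context {R : realType}.

Lemma cauchy_schwarz3 (a b c x y z : R) :
  (a * x + b * y + c * z) ^+ 2 <= (a ^+ 2 + b ^+ 2 + c ^+ 2) * (x ^+ 2 + y ^+ 2 + z ^+ 2).
Proof.
rewrite -subr_ge0 (_ : _ - _ = (a * y - b * x) ^+ 2 + (a * z - c * x) ^+ 2 + (b * z - c * y) ^+ 2); last by ring.
by rewrite !addr_ge0// sqr_ge0.
Qed.
Lemma sqr_addr_le (x y : R) : (x + y) ^+ 2 <= 2 * (x ^+ 2 + y ^+ 2).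
Proof. by have := sqr_ge0 (x - y); nra. Qed.
(** Cauchy-Schwarz over the components and (p + q)^2 <= 2 (p^2 + q^2) give the factor 2 (7/5)^2 =
    98/25, just below 4: the value 7/10 leaves almost no room. *)
Lemma flux_sqr_le (a b c a0 b0 c0 a1 b1 c1 : R) :
  (7 / 10 * (2 * (`|a * a0| + (`|b * b0| + `|c * c0|)) + 2 * (`|a * a1| + (`|b * b1| + `|c * c1|)))) ^+ 2 <=
  4 * ((a^+2 + (b^+2 + c^+2)) * ((a0^+2 + a1^+2) + ((b0^+2 + b1^+2) + (c0^+2 + c1^+2)))).
Proof.
rewrite !normrM -(real_normK (num_real a)) -(real_normK (num_real b)) -(real_normK (num_real c)) -(real_normK (num_real a0)) -(real_normK (num_real a1)).
rewrite -(real_normK (num_real b0)) -(real_normK (num_real c0)) -(real_normK (num_real b1)) -(real_normK (num_real c1)).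
move: `|a| `|b| `|c| `|a0| `|b0| `|c0| `|a1| `|b1| `|c1| => {}a {}b {}c {}a0 {}b0 {}c0 {}a1 {}b1 {}c1.
have h1 := cauchy_schwarz3 a b c (a0 + a1) (b0 + b1) (c0 + c1).
have h2 := sqr_addr_le a0 a1; have h3 := sqr_addr_le b0 b1; have h4 := sqr_addr_le c0 c1.
rewrite (_ : (7 / 10 * _) = 7 / 5 * (a * (a0 + a1) + b * (b0 + b1) + c * (c0 + c1))); last by field.
rewrite exprMn.
have A0 : 0 <= a ^+ 2 + b ^+ 2 + c ^+ 2 by rewrite !addr_ge0// sqr_ge0.
have B0 : 0 <= a0^+2 + a1^+2 + ((b0^+2 + b1^+2) + (c0^+2 + c1^+2)) by rewrite !addr_ge0// sqr_ge0.
set B := _ + _ in B0 *; rewrite addrA; move: h1; set A := _ + _ + _ in A0 * => h1.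
have : (a0 + a1) ^+ 2 + (b0 + b1) ^+ 2 + (c0 + c1) ^+ 2 <= 2 * B by rewrite /B; lra.
move=> /(ler_wpM2l A0) h5.
have AB : 0 <= A * B by exact: mulr_ge0.
have := le_trans h1 h5; rewrite mulrCA; lra.
Qed.

End three_term_bounds.

Section norms.
Context {R : realType}.
Local Notation T3 := (R3 (measurableTypeR R)).
Variables (u : R3 R -> R3 R) (du : 'I_3 -> 'I_3 -> R3 R -> R).
Hypothesis uH1 : in_H1v u du.

Lemma big_ord2_lt3 (F : 'I_3 -> R) : \sum_(j < 3 | (j < 2)%N) F j = F 0 + F 1.
Proof.
rewrite big_mkcond !big_ord_recl big_ord0 /= !addr0 (_ : lift _ _ = 1 :> 'I_3)//.
exact/val_inj.
Qed.

Definition cell_grad_sqr (x : T3) : R :=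
  \sum_(i < 3) ((du i 0 \_ cell) x ^+ 2 + (du i 1 \_ cell) x ^+ 2).

Lemma cell_grad_sqr_ge0 x : 0 <= cell_grad_sqr x.
Proof. by apply: sumr_ge0 => i _; rewrite addr_ge0// sqr_ge0. Qed.

Lemma cell_enorm : enorm u \_ cell = Num.sqrt \o cell_sqr u.
Proof.
apply/funext => x; rewrite patchE/= /cell_sqr; case: ifPn => xc.
  by congr Num.sqrt; apply: eq_bigr => i _; rewrite patchE xc.
by rewrite big1 ?sqrtr0// => i _; rewrite patchE (negbTE xc) expr0n.
Qed.

Lemma cell_hgrad_norm : hgrad_norm du \_ cell = Num.sqrt \o cell_grad_sqr.
Proof.
apply/funext => x; rewrite patchE/= /cell_grad_sqr; case: ifPn => xc.
  by congr Num.sqrt; apply: eq_bigr => i _; rewrite big_ord2_lt3 !patchE xc.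
by rewrite big1 ?sqrtr0// => i _; rewrite !patchE (negbTE xc) expr0n addr0.
Qed.

Lemma measurable_cell_grad_sqr : measurable_fun setT cell_grad_sqr.
Proof.
apply: measurable_sum => i.
by apply: measurable_funD; apply: measurable_funX; exact: measurable_du.
Qed.

Lemma measurable_sqrt_comp (h : T3 -> R) :
  measurable_fun setT h -> measurable_fun setT (Num.sqrt \o h).
Proof. by apply: measurableT_comp; apply: continuous_measurable_fun; exact: sqrt_continuous. Qed.

Lemma LpD2_enorm : (LpD 2 (enorm u) `^ 2 = \int[lebesgue3]_x (cell_sqr u x)%:E)%E.
Proof.
rewrite LpD2E; apply: eq_integral => x _; rewrite cell_enorm/= sqr_sqrtr//.
exact: cell_sqr_ge0.
Qed.

Lemma LpD4_enorm : (LpD 4 (enorm u) `^ 4 = \int[lebesgue3]_x (cell_sqr u x ^+ 2)%:E)%E.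
Proof.
rewrite LpDE ?pnatr_eq0//; apply: eq_integral => x _; rewrite cell_enorm/=.
rewrite powR_mulrn// ger0_norm ?sqrtr_ge0// (exprM _ 2 2) sqr_sqrtr//.
exact: cell_sqr_ge0.
Qed.

Lemma LpD2_hgrad : (LpD 2 (hgrad_norm du) `^ 2 = \int[lebesgue3]_x (cell_grad_sqr x)%:E)%E.
Proof.
rewrite LpD2E; apply: eq_integral => x _; rewrite cell_hgrad_norm/= sqr_sqrtr//.
exact: cell_grad_sqr_ge0.
Qed.

Lemma lty_of_sqr (a : \bar R) : (a `^ 2 < +oo)%E -> (a < +oo)%E.
Proof. by case: a => [r| |]//; rewrite ?ltry// poweRyr ?ltxx. Qed.

Lemma LpD2_enorm_lty : (LpD 2 (enorm u) < +oo)%E.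
Proof.
apply: lty_of_sqr; rewrite LpD2_enorm.
have mu i := measurable_u uH1 i.
under eq_integral do rewrite -sumEFin.
rewrite ge0_integral_sum//; last 2 first.
- by move=> i; apply/measurable_EFinP; exact: measurable_funX.
- by move=> i x _; rewrite lee_fin sqr_ge0.
by apply: lte_sum_pinfty => i _; apply: L2per_sqr_lty; case: (uH1 i).
Qed.

Lemma LpD2_hgrad_lty : (LpD 2 (hgrad_norm du) < +oo)%E.
Proof.
apply: lty_of_sqr; rewrite LpD2_hgrad.
have mdu i j := measurable_du uH1 i j.
under eq_integral do rewrite -sumEFin.
rewrite ge0_integral_sum//; last 2 first.
- by move=> i; apply/measurable_EFinP; apply: measurable_funD; exact: measurable_funX.
- by move=> i x _; rewrite lee_fin addr_ge0// sqr_ge0.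
apply: lte_sum_pinfty => i _.
under eq_integral do rewrite EFinD.
rewrite ge0_integralD//; last 4 first.
- by move=> x _; rewrite lee_fin sqr_ge0.
- by apply/measurable_EFinP; exact: measurable_funX.
- by move=> x _; rewrite lee_fin sqr_ge0.
- by apply/measurable_EFinP; exact: measurable_funX.
have dL j : L2per (du i j) by case: (uH1 i) => _ /(_ j)[].
by apply: lte_add_pinfty; exact: L2per_sqr_lty.
Qed.

Lemma flux_le (x : T3) : 7 / 10 * (cell_flux u du 0 x + cell_flux u du 1 x) <=
  2 * ((enorm u \_ cell) x * (hgrad_norm du \_ cell) x).
Proof.
rewrite cell_enorm cell_hgrad_norm/= -sqrtrM; last exact: cell_sqr_ge0.
rewrite -ler_pdivrMl//; set h := 7 / 10 * _.
have h0 : 0 <= 2^-1 * h by rewrite mulr_ge0// /h mulr_ge0// addr_ge0// cell_flux_ge0.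
rewrite -(ger0_norm h0) -sqrtr_sqr ler_sqrt; last by rewrite mulr_ge0// ?cell_sqr_ge0// cell_grad_sqr_ge0.
rewrite exprMn exprVn ler_pdivrMl// /h /cell_flux /cell_sqr /cell_grad_sqr.
rewrite !big_ord_recl !big_ord0 !addr0 -natrX; exact: flux_sqr_le.
Qed.

Lemma LpD_ge0 (p : R) (f : T3 -> R) : (0 <= LpD p f)%E.
Proof. exact: Lnorm_ge0. Qed.

Lemma cell_hoelder : (\int[lebesgue3]_x ((enorm u \_ cell) x * (hgrad_norm du \_ cell) x)%:E
  <= LpD 2 (enorm u) * LpD 2 (hgrad_norm du))%E.
Proof.
have mE : measurable_fun [set: T3] (enorm u \_ cell).
  by rewrite cell_enorm; apply: measurable_sqrt_comp; exact: measurable_cell_sqr uH1.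
have mH : measurable_fun [set: T3] (hgrad_norm du \_ cell).
  by rewrite cell_hgrad_norm; apply: measurable_sqrt_comp; exact: measurable_cell_grad_sqr.
have h2 : 2^-1 + 2^-1 = 1 :> R by lra.
have := @hoelder _ _ _ lebesgue3 _ _ 2 2 mE mH (ltr0Sn _ _) (ltr0Sn _ _) h2.
rewrite Lnorm1 -!restrict_EFin; apply: le_trans.
have mEH := measurable_funM mE mH.
apply: ge0_le_integral => //.
- by move=> x _; rewrite lee_fin cell_enorm cell_hgrad_norm mulr_ge0// sqrtr_ge0.
- exact/measurable_EFinP.
- by apply: measurableT_comp => //; exact/measurable_EFinP.
- by move=> x _; exact: lee_abs.
Qed.

(** Rounding 91/60 up to 2 gives both terms the factor 2; its square divided by 2 pi is the 2 / pi
    of the theorem. *)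
Lemma total_mean_le : (total_mean u du <= 2%:E * (LpD 2 (enorm u) * LpD 2 (hgrad_norm du)) +
  2%:E * LpD 2 (enorm u) `^ 2)%E.
Proof.
have mE : measurable_fun [set: T3] (enorm u \_ cell).
  by rewrite cell_enorm; apply: measurable_sqrt_comp; exact: measurable_cell_sqr uH1.
have mH : measurable_fun [set: T3] (hgrad_norm du \_ cell).
  by rewrite cell_hgrad_norm; apply: measurable_sqrt_comp; exact: measurable_cell_grad_sqr.
have mf j := measurable_cell_flux uH1 j; have f0 := @cell_flux_ge0 R u du.
have EH0 x : 0 <= (enorm u \_ cell) x * (hgrad_norm du \_ cell) x.
  by rewrite cell_enorm cell_hgrad_norm mulr_ge0// sqrtr_ge0.
rewrite /total_mean -LpD2_enorm; apply: leeD; last first.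
  by apply: lee_wpmul2r; [exact: poweR_ge0|rewrite lee_fin; lra].
apply: (@le_trans _ _ (2%:E * \int[lebesgue3]_x ((enorm u \_ cell) x * (hgrad_norm du \_ cell) x)%:E)%E).
  rewrite -ge0_integralD//; last 4 first.
  - by move=> x _; rewrite lee_fin.
  - exact/measurable_EFinP.
  - by move=> x _; rewrite lee_fin.
  - exact/measurable_EFinP.
  rewrite -!ge0_integralZl_EFin//; last 4 first.
  - by move=> x _; rewrite lee_fin.
  - by apply/measurable_EFinP; exact: measurable_funM.
  - by move=> x _; rewrite -EFinD lee_fin addr_ge0.
  - by apply: emeasurable_funD; exact/measurable_EFinP.
  apply: ge0_le_integral => //.
  - by move=> x _; rewrite -EFinD -EFinM lee_fin mulr_ge0// addr_ge0.
  - by apply: emeasurable_funM => //; apply: emeasurable_funD; exact/measurable_EFinP.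
  - by apply: emeasurable_funM => //; apply/measurable_EFinP; exact: measurable_funM.
  - by move=> x _; rewrite -EFinD -!EFinM lee_fin flux_le.
by apply: lee_wpmul2l => //; exact: cell_hoelder.
Qed.

(** N and D are the L^2 norms of the field and of its horizontal gradient, P is the L^4 norm. With N
    = a^2 and D = b^2, the square of a b + a^2 exceeds N D + N^2 = a^2 b^2 + a^4 by the nonnegative
    cross term 2 a^3 b. *)
Lemma fourth_root_le (N D P : R) : 0 <= N -> 0 <= D -> 0 <= P ->
  2 * pi * P ^+ 4 <= (2 * (N * D) + 2 * N ^+ 2) ^+ 2 ->
  P <= (2 / pi) `^ 4^-1 * (N `^ 2^-1 * D `^ 2^-1 + N).
Proof.
move=> N0 D0 P0 h; have pi0 := pi_gt0 R.
have q0 : 0 <= 2 / pi :> R by rewrite divr_ge0// ltW.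
have -> : N `^ 2^-1 = Num.sqrt N by rewrite powR12_sqrt.
have -> : D `^ 2^-1 = Num.sqrt D by rewrite powR12_sqrt.
have := sqr_sqrtr N0; have := sqr_sqrtr D0; have := sqrtr_ge0 N; have := sqrtr_ge0 D.
move: (Num.sqrt N) (Num.sqrt D) => a b b0 a0 eD eN.
have ab0 : 0 <= a * b by exact: mulr_ge0.
rewrite -(@ler_pXn2r _ 4)// ?nnegrE//; last by rewrite mulr_ge0// ?powR_ge0// addr_ge0.
have q4 : ((2 / pi) `^ 4^-1) ^+ 4 = 2 / pi :> R.
  by rewrite -powR_mulrn ?powR_ge0// -powRrM mulVf// powRr1.
rewrite exprMn q4 mulrAC ler_pdivlMr//.
apply: (@le_trans _ _ (2 * (N * D + N ^+ 2) ^+ 2)).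
  move: h; rewrite -mulrDr exprMn; lra.
rewrite ler_pM2l// (exprM _ 2 2); apply: lerXn2r; rewrite ?nnegrE ?sqr_ge0//.
  by rewrite addr_ge0 ?sqr_ge0// mulr_ge0.
rewrite -eD -eN; have : 0 <= a * b * a ^+ 2 by rewrite mulr_ge0 ?sqr_ge0.
by lra.
Qed.

Lemma helical_ladyzhenskaya : helical u ->
  (LpD 4 (enorm u) <= ((2 / pi) `^ (4^-1))%:E *
     (LpD 2 (enorm u) `^ (2^-1) * LpD 2 (hgrad_norm du) `^ (2^-1) + LpD 2 (enorm u)))%E.
Proof.
move=> hel.
have tm := total_mean_le.
have tm0 : (0 <= total_mean u du)%E.
  by rewrite -slice_mean_integral//; apply: integral_ge0 => z _; exact: slice_mean_ge0.
have := LpD_ge0 4 (enorm u); have := LpD4_enorm.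
move: tm; move: (LpD_ge0 2 (enorm u)) (LpD_ge0 2 (hgrad_norm du)) LpD2_enorm_lty LpD2_hgrad_lty.
case: (LpD 2 (enorm u)) => [N| |]//; case: (LpD 2 (hgrad_norm du)) => [D| |]//.
rewrite !lee_fin => N0 D0 _ _ tm.
have tmf : (total_mean u du < +oo)%E by apply: (le_lt_trans tm); rewrite ?poweR_EFin -!EFinM -EFinD ltry.
have := helical_fourth_power uH1 hel tmf => + e4; rewrite -e4.
have pi0 := pi_gt0 R.
case: (LpD 4 (enorm u)) {e4} => [P| |]//; last first.
  rewrite poweRyr ?pnatr_eq0// gt0_muley ?lte_fin ?mulr_gt0//.
  by rewrite leye_eq => /eqP; move: tmf tm0; case: (total_mean u du) => [r| |]//.
move=> h; rewrite lee_fin => P0.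
move: tm; rewrite !poweR_EFin.
rewrite -!EFinM -!EFinD lee_fin => tm; apply: fourth_root_le => //.
case: (total_mean u du) tm0 tm tmf h => [t| |]// t0; rewrite lee_fin => tm _.
rewrite poweR_EFin -!EFinM lee_fin !powR_mulrn// in t0 tm * => h.
rewrite lee_fin in h; apply: (le_trans h); rewrite -expr2; apply: lerXn2r => //.
by rewrite nnegrE (le_trans _ tm).
Qed.

End norms.

(** * The Poincare inequality *)

Section caratheodory.
Context {R : realType} d (T : measurableType d).

Definition grid (n : nat) (y : R) : R := (Num.floor (y * n.+1%:R))%:~R / n.+1%:R.

Lemma grid_cvg (y : R) : grid n y @[n --> \oo] --> y.
Proof.
apply: (@squeeze_cvgr _ _ _ _ (fun n => y - n.+1%:R^-1) (fun=> y)).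
- near=> n; have n0 : 0 < n.+1%:R :> R by rewrite ltr0n.
  have /andP[h1 h2] := floor_itv (y * n.+1%:R).
  rewrite /grid ler_pdivrMr// h1 andbT ler_pdivlMr// mulrBl mulVf ?gt_eqF//.
  by rewrite lerBlDr ltW//; move: h2; rewrite intrD.
- rewrite -[X in _ --> X]subr0; apply: cvgB; [exact: cvg_cst|exact: cvg_harmonic].
- exact: cvg_cst.
Unshelve. all: by end_near. Qed.

(** Replacing y by the grid point below it gives functions that depend on y only through countably
    many intervals, hence jointly measurable; by continuity in y they converge to [h]. *)
Lemma measurable_caratheodory (h : T -> R -> R) :
  (forall y, measurable_fun setT (h ^~ y)) -> (forall x, continuous (h x)) ->
  measurable_fun setT (fun p : T * measurableTypeR R => h p.1 p.2).
Proof.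
move=> mh ch.
apply: (@measurable_fun_cvg _ _ _ setT (fun n (p : T * measurableTypeR R) => h p.1 (grid n p.2))); last first.
  by move=> p _; exact: (cvg_comp _ _ (@grid_cvg p.2) (ch p.1 p.2)).
move=> n _ Y mY; rewrite setTI.
have n0 : 0 < n.+1%:R :> R by rewrite ltr0n.
rewrite (_ : _ @^-1` _ = \bigcup_(k : int) (((h ^~ (k%:~R / n.+1%:R)) @^-1` Y) `*`
    [set` `[k%:~R / n.+1%:R, (k + 1)%:~R / n.+1%:R[])).
  apply: countable_bigcupT_measurable => // k; apply: measurableX; last exact: measurable_itv.
  by rewrite -[X in measurable X]setTI; exact: mh.
apply/seteqP; split => [[x y] /= hY|[x y] [k _ [/= hY]]].
  exists (Num.floor (y * n.+1%:R)) => //; split=> //=.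
  have /andP[h1 h2] := floor_itv (y * n.+1%:R).
  by rewrite in_itv/= ler_pdivrMr// ltr_pdivlMr// h1.
rewrite in_itv/= ler_pdivrMr// ltr_pdivlMr// => /floor_def fk.
by rewrite /grid fk.
Qed.

End caratheodory.

Section interval_poincare.
Context {R : realType}.
Local Notation lam := (@lebesgue_measure R).

Lemma cvg_R3 (T : Type) (F : set_system T) {FF : Filter F} (a b c : T -> R) (x y z : R) :
  a t @[t --> F] --> x -> b t @[t --> F] --> y -> c t @[t --> F] --> z ->
  ((a t, b t, c t) : R3 R) @[t --> F] --> ((x, y, z) : R3 R).
Proof.
move=> ha hb hc.
apply: (@cvg_pair _ _ _ F (nbhs (x, y)) (nbhs z) _ _ _ (fun t => (a t, b t)) c) => //.
exact: (@cvg_pair _ _ _ F (nbhs x) (nbhs y) _ _ _ a b).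
Qed.

Lemma continuous_curve (g : R3 R -> R) (a b c : R -> R) : continuous g ->
  continuous a -> continuous b -> continuous c -> continuous (fun t => g (a t, b t, c t)).
Proof.
move=> cg ca cb cc t.
apply: (cvg_comp (fun t : R => ((a t, b t, c t) : R3 R)) g _ (cg (a t, b t, c t))).
by apply: cvg_R3; [exact: ca|exact: cb|exact: cc].
Qed.

(** The sigma-algebra on triples is a product, so continuity is converted into measurability one
    coordinate at a time. *)
Lemma measurable_R3_continuous (v : R3 R -> R) : continuous v ->
  measurable_fun [set: R3 (measurableTypeR R)] v.
Proof.
move=> cv.
have cid : continuous (fun t : R => t) by move=> t; exact: cvg_id.
have ccst (k : R) : continuous (fun _ : R => k) by move=> t; exact: cvg_cst.
have c3 (x y : R) : continuous (fun t : R => v (x, y, t)).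
  exact: (continuous_curve cv (ccst x) (ccst y) cid).
have c2 (x z : R) : continuous (fun t : R => v (x, t, z)).
  exact: (continuous_curve cv (ccst x) cid (ccst z)).
have c1 (y z : R) : continuous (fun t : R => v (t, y, z)).
  exact: (continuous_curve cv cid (ccst y) (ccst z)).
rewrite (_ : v = (fun p => v (p.1, p.2))); last by apply/funext => -[].
apply: (measurable_caratheodory (h := fun p z => v (p, z))) => [z|[x y] z]; last exact: c3 x y z.
rewrite (_ : (fun p => v (p, z)) = (fun p => v ((p.1, p.2), z))); last by apply/funext => -[].
apply: (measurable_caratheodory (h := fun x y => v (x, y, z))) => [y|x y]; last exact: c2 x z y.
exact: (continuous_measurable_fun (c1 y z)).
Qed.

Local Open Scope ereal_scope.

(** The integral is enlarged from [y, b] to [a, b] so that the bound no longer depends on y except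
    through the left side. *)
Lemma FTC_sqr_le (f d : R -> R) (a b y : R) : (a <= y)%R -> (y < b)%R ->
  (forall t : R, is_derive t 1%R f (d t)) -> continuous d ->
  ((f y ^+ 2)%:E <= (f b ^+ 2)%:E + \int[lam]_(t in `[a, b]) (`|2 * (f t * d t)|)%R%:E)%E.
Proof.
move=> ay yb fd cd.
have cf : continuous f by move=> t; apply/differentiable_continuous/derivable1_diffP; have [] := fd t.
have cg : continuous (fun t => 2 * (f t * d t))%R.
  by move=> t; apply: cvgM; [exact: cvg_cst|apply: cvgM; [exact: cf|exact: cd]].
have dg (t : R) : is_derive t 1%R (fun t => f t ^+ 2)%R (2 * (f t * d t))%R.
  have := fd t => ?; apply: is_derive_eq.
  by rewrite -[LHS]/(f t * d t + f t * d t)%R -mulr2n mulr_natl.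
have ftc : \int[lam]_(t in `[y, b]) (2 * (f t * d t))%R%:E = (f b ^+ 2)%:E - (f y ^+ 2)%:E.
  apply: (@continuous_FTC2 R (fun t => 2 * (f t * d t))%R (fun t => f t ^+ 2)%R y b yb).
  - exact/continuous_subspaceT.
  - split.
    + by move=> t _; have [] := dg t.
    + by apply: cvg_at_right_filter; apply: cvgM; exact: cf.
    + by apply: cvg_at_left_filter; apply: cvgM; exact: cf.
  - by move=> t _; rewrite derive1E; have [_ ->] := dg t.
have mg : measurable_fun setT (fun t => 2 * (f t * d t))%R by exact: continuous_measurable_fun.
have mn : measurable_fun setT (fun t => (`|2 * (f t * d t)|%R)%:E).
  by apply/measurable_EFinP; exact: measurableT_comp.
have h : `|\int[lam]_(t in `[y, b]) (2 * (f t * d t))%R%:E| <= \int[lam]_(t in `[a, b]) (`|2 * (f t * d t)|%R)%:E.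
  apply: (@le_trans _ _ (\int[lam]_(t in `[y, b]) (`|2 * (f t * d t)|%R)%:E)).
    by apply: le_abse_integral => //; apply/measurable_EFinP; exact: measurable_funTS.
  apply: ge0_subset_integral => //; first exact: measurable_funTS.
  by move=> t /=; rewrite !in_itv/= => /andP[/(le_trans ay) -> ->].
apply: le_trans (leeD2l _ h); rewrite ftc -EFinB /= -EFinD lee_fin.
by have := ler_norm (- (f b ^+ 2 - f y ^+ 2)); rewrite normrN; lra.
Qed.

Lemma interval_poincare (f d : R -> R) (s : R) : (0 < s <= 1)%R ->
  (forall t : R, is_derive t 1%R f (d t)) -> continuous d ->
  (\int[lam]_(y in `](- s)%R, s[) (f y ^+ 2)%:E <=
    (4 * s * f s ^+ 2)%:E + 16%:E * \int[lam]_(y in `](- s)%R, s[) (d y ^+ 2)%:E)%E.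
Proof.
move=> /andP[s0 s1] fd cd.
have cf : continuous f by move=> t; apply/differentiable_continuous/derivable1_diffP; have [] := fd t.
have cq (g : R -> R) : continuous g -> continuous (fun t => g t ^+ 2)%R.
  by move=> cg t; apply: cvgM; exact: cg.
have mq (g : R -> R) : continuous g -> measurable_fun setT (fun t => (g t ^+ 2)%:E).
  by move=> cg; apply/measurable_EFinP; apply: continuous_measurable_fun; exact: cq.
have fin (g : R -> R) : continuous g -> exists2 A : R, (0 <= A)%R & 
    \int[lam]_(y in `[(- s)%R, s]) (g y ^+ 2)%:E = A%:E.
  move=> cg.
  have ii : lam.-integrable `[(- s)%R, s] (EFin \o (fun t => g t ^+ 2)%R).
    apply: continuous_compact_integrable; first exact: segment_compact.
    by apply: continuous_subspaceT; exact: cq.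
  have : \int[lam]_(y in `[(- s)%R, s]) (g y ^+ 2)%:E < +oo.
    move/integrableP : ii => -[_]; congr (_ < _); apply: eq_integral => y _ /=.
    by rewrite ger0_norm ?sqr_ge0.
  have : 0 <= \int[lam]_(y in `[(- s)%R, s]) (g y ^+ 2)%:E.
    by apply: integral_ge0 => y _; rewrite lee_fin sqr_ge0.
  rewrite /comp; case: (\int[lam]_(y in `[(- s)%R, s]) (g y ^+ 2)%:E) => [r| |]// r0 _.
  by exists r; rewrite // -lee_fin.
rewrite -!(@integral_itv_bndoo _ (- s)%R s _ true false); do ?exact: measurable_funTS (mq _ _).
have [A A0 eA] := fin f cf; have [B B0 eB] := fin d cd.
rewrite eA eB.
(* From |2 f d| <= f^2 / 4 + 4 d^2. Over an interval of length 2 s <= 2, the term in f^2 contributes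
   at most A / 2, which is absorbed by the left side; doubling what remains gives 4 s and 16. *)
pose K := (4^-1 * A + 4 * B)%R.
have sup y : y \in `[(- s)%R, s] -> (f y ^+ 2 <= f s ^+ 2 + K)%R.
  rewrite in_itv/= => /andP[ys]; rewrite le_eqVlt => /predU1P[->|ys'].
    by rewrite lerDl /K addr_ge0// mulr_ge0.
  rewrite -lee_fin; apply: (le_trans (FTC_sqr_le ys ys' fd cd)); rewrite EFinD leeD2l//.
  rewrite /K EFinD !EFinM -eA -eB -!ge0_integralZl_EFin//; last 4 first.
  - by move=> t _; rewrite lee_fin sqr_ge0.
  - exact: measurable_funTS (mq _ _).
  - by move=> t _; rewrite lee_fin sqr_ge0.
  - exact: measurable_funTS (mq _ _).
  have mZ (k : R) (g : R -> R) : continuous g ->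
      measurable_fun `[(- s)%R, s]%classic (fun t => k%:E * (g t ^+ 2)%:E).
    by move=> cg; apply: measurable_funTS; apply: emeasurable_funM => //; exact: mq.
  have mfd : measurable_fun setT (fun t => (`|2 * (f t * d t)|%R)%:E).
    apply/measurable_EFinP; apply: measurableT_comp => //; apply: measurable_funM => //.
    by apply: measurable_funM; exact: continuous_measurable_fun.
  rewrite -ge0_integralD//; last 4 first.
  - by move=> t _; rewrite mule_ge0// lee_fin sqr_ge0.
  - exact: mZ.
  - by move=> t _; rewrite mule_ge0// lee_fin sqr_ge0.
  - exact: mZ.
  apply: ge0_le_integral => //.
  - exact: measurable_funTS.
  - by apply: emeasurable_funD; exact: mZ.
  move=> t _; rewrite -!EFinM -EFinD lee_fin normrM ger0_norm//.
  by rewrite normrM -(real_normK (num_real (f t))) -(real_normK (num_real (d t)));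
    have := sqr_ge0 (`|f t| - 4 * `|d t|); nra.
have : A%:E <= \int[lam]_(y in `[(- s)%R, s]) (f s ^+ 2 + K)%:E.
  rewrite -eA; apply: ge0_le_integral => //.
  - by move=> t _; rewrite lee_fin sqr_ge0.
  - exact: measurable_funTS (mq _ _).
have ss : (- s < s)%R by lra.
rewrite integral_cst//= lebesgue_measure_itv/= lte_fin ss -EFinB opprK -EFinM -EFinM -EFinD !lee_fin => h.
have : (K * (s + s) <= K * 2)%R by rewrite ler_wpM2l// /K; [rewrite addr_ge0// mulr_ge0|lra].
have : ((f s ^+ 2 + K) * (s + s) = 2 * s * f s ^+ 2 + K * (s + s))%R by ring.
by move: h; rewrite /K; lra.
Qed.

End interval_poincare.

Section arc_substitution.
Context {R : realType}.
Local Notation lam := (@lebesgue_measure R).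

(** The substitution x = cos t covers the upper arc with t in [0, pi]; the bound is enlarged to a
    full turn because the trace condition is stated on the whole circle. *)
Lemma arc_integral_le (G H : R -> R) : continuous G -> measurable_fun setT H ->
  (forall t, 0 <= H t) -> (forall t, 0 <= t <= pi -> G (cos t) * sin t <= H t) ->
  (forall x, 0 <= G x) ->
  (\int[lam]_(x in `](-1)%R, 1%R[) (G x)%:E <= \int[lam]_(t in `[0%R, (2 * pi)%R]) (H t)%:E)%E.
Proof.
move=> cG mH H0 GH G0; have pi0 := pi_gt0 R.
have mG : measurable_fun setT G by exact: continuous_measurable_fun.
rewrite -(@integral_itv_bndoo _ (-1) 1 _ true false); last first.
  by apply: measurable_funTS; exact/measurable_EFinP.
have dcos : derive1 (@cos R) = (fun t => - sin t).
  by apply/funext => t; rewrite derive1E; have [_ ->] := is_derive_cos t.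
have csin : continuous (fun t : R => - sin t) by move=> t; apply: cvgN; exact: continuous_sin.
have s0 (t : R) : 0 <= t <= pi -> 0 <= sin t by exact: sin_ge0_pi.
have sub : (\int[lam]_(x in `[(-1)%R, 1%R]) (G x)%:E =
    \int[lam]_(t in `[0%R, pi]) (G (cos t) * sin t)%:E)%E.
  have := @integration_by_substitution_decreasing R cos G 0 pi (ltW pi0).
  rewrite cos0 cospi dcos => ->.
  - by apply: eq_integral => t _ /=; rewrite opprK.
  - by move=> x y x0 y0; rewrite ltr_cos.
  - by move=> t _; exact: csin.
  - by apply: cvgP; apply: cvg_at_right_filter; exact: csin.
  - by apply: cvgP; apply: cvg_at_left_filter; exact: csin.
  - split=> [t _||]; first exact: derivable_cos.
    + by apply: cvg_at_right_filter; exact: continuous_cos.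
    + by apply: cvg_at_left_filter; exact: continuous_cos.
  - exact: continuous_subspaceT.
rewrite sub; apply: (@le_trans _ _ (\int[lam]_(t in `[0%R, pi]) (H t)%:E)%E).
  apply: ge0_le_integral => //.
  - by move=> t; rewrite /= in_itv/= => tp; rewrite lee_fin mulr_ge0// s0.
  - apply: measurable_funTS; apply/measurable_EFinP; apply: measurable_funM.
      apply: (measurableT_comp mG); apply: continuous_measurable_fun; exact: continuous_cos.
    by apply: continuous_measurable_fun; exact: continuous_sin.
  - by apply: measurable_funTS; exact/measurable_EFinP.
apply: ge0_subset_integral => //.
- by apply: measurable_funTS; exact/measurable_EFinP.
- by move=> t _; rewrite lee_fin.
- move=> t; rewrite /= !in_itv/= => /andP[-> tp]; lra.
Qed.

End arc_substitution.

Section cell_poincare.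
Context {R : realType}.
Local Notation lam := (@lebesgue_measure R).
Local Notation T3 := (R3 (measurableTypeR R)).
Variable v : R3 R -> R.
Hypothesis sv : smooth v.
Local Notation dv := ('D_(basis3 1) v).

Let v_cont : continuous v. Proof. exact: (sv 0).1. Qed.

Let dv_cont : continuous dv. Proof. by have [_ /(_ 1)[_ []]] := sv 1. Qed.

Let v_derive (x z t : R) : is_derive t (1 : R) (fun y => v (x, y, z)) (dv (x, t, z)).
Proof.
have [_ /(_ 1)[/(_ (x, t, z)) dx _]] := sv 1.
have e : (fun h : R => h^-1 *: ((v \o shift (x, t, z)) (h *: basis3 1) - v (x, t, z))) =
         (fun h : R => h^-1 *: (((fun y => v (x, y, z)) \o shift t) (h *: 1) - v (x, t, z))).
  apply/funext => h /=; congr (_ *: (v _ - _)).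
  by rewrite /basis3/= -[LHS]/(h * 0 + x, h * 1 + t, h * 0 + z) !mulr0 !add0r.
apply: DeriveDef; first by rewrite /derivable -e.
by rewrite /derive -e.
Qed.

Let section_cont (g : R3 R -> R) (x z : R) : continuous g -> continuous (fun y => g (x, y, z)).
Proof.
move=> cg; apply: (continuous_curve (a := cst x) (b := id) (c := cst z)) => // t; [exact: cvg_cst|exact: cvg_id|exact: cvg_cst].
Qed.

(** The endpoint term s f(s)^2 of [interval_poincare] at the upper end of the chord. On the arc s is
    sin t, and with the Jacobian sin t it gives sin^2 t <= 1, so the squared boundary values come
    without a weight. *)
Definition arc_height (z x : R) : R := Num.sqrt (1 - x ^+ 2) * v (x, Num.sqrt (1 - x ^+ 2), z) ^+ 2.

Definition boundary_sqr (z t : R) : R := v (cos t, sin t, z) ^+ 2.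

Lemma arc_height_cont z : continuous (arc_height z).
Proof.
have cs : continuous (fun x : R => Num.sqrt (1 - x ^+ 2)).
  move=> x; apply: (continuous_comp (f := fun x : R => 1 - x ^+ 2)); last exact: sqrt_continuous.
  by apply: cvgB; [exact: cvg_cst|apply: cvgM; exact: cvg_id].
move=> x; apply: cvgM; first exact: cs.
have cv : continuous (fun t : R => v (t, Num.sqrt (1 - t ^+ 2), z)).
  apply: (continuous_curve v_cont _ cs) => t; [exact: cvg_id|exact: cvg_cst].
by apply: cvgM; exact: cv.
Qed.

Lemma arc_height_ge0 z x : 0 <= arc_height z x.
Proof. by rewrite mulr_ge0 ?sqrtr_ge0 ?sqr_ge0. Qed.

Lemma measurable_boundary_sqr z : measurable_fun setT (boundary_sqr z).
Proof.
apply: measurable_funX; apply: continuous_measurable_fun.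
apply: (continuous_curve (c := cst z)) => //.
- exact: continuous_cos.
- exact: continuous_sin.
- by move=> t; exact: cvg_cst.
Qed.

Lemma arc_height_integral z : (\int[lam]_(x in `](-1)%R, 1%R[) (arc_height z x)%:E <=
  \int[lam]_(t in `[0%R, (2 * pi)%R]) (boundary_sqr z t)%:E)%E.
Proof.
apply: arc_integral_le.
- exact: arc_height_cont.
- exact: measurable_boundary_sqr.
- by move=> t; exact: sqr_ge0.
- move=> t t0; rewrite /arc_height -sin2cos2 sqrtr_sqr ger0_norm ?sin_ge0_pi//.
  rewrite mulrAC -expr2 -[leRHS]mul1r ler_wpM2r ?sqr_ge0//.
- exact: arc_height_ge0.
Qed.

Lemma cell_section_integral (g : R3 R -> R) x z : continuous g -> 0 <= z <= 2 * pi ->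
  -1 < x < 1 ->
  (\int[lam]_y ((g \_ cell) (x, y, z) ^+ 2)%:E =
   \int[lam]_(y in `](- Num.sqrt (1 - x ^+ 2))%R, (Num.sqrt (1 - x ^+ 2))%R[) (g (x, y, z) ^+ 2)%:E)%E.
Proof.
move=> cg z2 x1; rewrite [RHS]integral_mkcond; apply: eq_integral => y _.
have s0 : 0 <= 1 - x ^+ 2 by nra.
have yE : (y \in `](- Num.sqrt (1 - x ^+ 2))%R, (Num.sqrt (1 - x ^+ 2))%R[) = (x ^+ 2 + y ^+ 2 < 1).
  rewrite in_itv/= -ltr_norml -(@ltr_pXn2r _ 2)// ?nnegrE// ?sqrtr_ge0// sqr_sqrtr//.
  by rewrite real_normK ?num_real// ltrBrDl.
rewrite !patchE; have [xy|xy] := boolP (x ^+ 2 + y ^+ 2 < 1).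
  by rewrite !mem_set//= yE.
rewrite !memNset ?expr0n//=; first by rewrite yE; exact/negP.
by case=> /= h; rewrite h in xy.
Qed.

Local Notation w g := (fun x : T3 => (g \_ cell) x ^+ 2).

Lemma measurable_cell_cont_sqr (g : R3 R -> R) : continuous g -> measurable_fun [set: T3] (w g).
Proof.
move=> /measurable_R3_continuous mg; apply: measurable_funX; apply: measurable_cell_restrict.
exact: measurable_funTS.
Qed.

Lemma section_poincare x z : (\int[lam]_y (slice (w v) z x y)%:E <=
  4%:E * ((arc_height z \_ `](-1)%R, 1%R[) x * \1_`[0%R, (2 * pi)%R] z)%:E +
  16%:E * \int[lam]_y (slice (w dv) z x y)%:E)%E.
Proof.
have r0 : (0 <= 16%:E * \int[lam]_y (slice (w dv) z x y)%:E)%E.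
  by apply: mule_ge0 => //; apply: integral_ge0 => y _; rewrite lee_fin sqr_ge0.
have [z2|z2] := boolP (0 <= z <= 2 * pi); last first.
  rewrite integral0_eq; first by rewrite indicE memNset ?mulr0 ?mule0 ?add0e//= in_itv/=; exact/negP.
  by move=> y _; rewrite /slice patchE memNset ?expr0n//= => -[_ /= h]; rewrite h in z2.
have [x1|x1] := boolP (-1 < x < 1); last first.
  rewrite integral0_eq; first by rewrite patchE memNset ?mul0r ?mule0 ?add0e//= in_itv/=; exact/negP.
  move=> y _; rewrite /slice patchE memNset ?expr0n//= => -[/= h _].
  by move/negP: x1; apply; apply/andP; split; nra.
rewrite indicE mem_set//= ?in_itv//= mulr1 patchE mem_set//= ?in_itv//=.
rewrite /slice !cell_section_integral//.
have s0 : 0 < 1 - x ^+ 2 by nra.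
have s1 : 0 < Num.sqrt (1 - x ^+ 2) <= 1.
  by rewrite sqrtr_gt0 s0/= -[leRHS]sqrtr1 ler_sqrt// gerBl sqr_ge0.
have := interval_poincare s1 (v_derive x z) (section_cont (x := x) (z := z) dv_cont).
by rewrite /arc_height -EFinM [X in _ -> (_ <= X%:E + _)%E]mulrA.
Qed.

Lemma slice_poincare z : (iint (slice (w v) z) <=
  4%:E * \int[lam]_t (((boundary_sqr z \_ `[0%R, (2 * pi)%R]) t * \1_`[0%R, (2 * pi)%R] z)%:E) +
  16%:E * iint (slice (w dv) z))%E.
Proof.
have ma : measurable_fun setT (arc_height z \_ `](-1)%R, 1%R[).
  apply: (measurable_restrictT _ (measurable_itv _)).1; apply: measurable_funTS.
  exact: (continuous_measurable_fun (@arc_height_cont z)).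
have mb : measurable_fun setT (boundary_sqr z \_ `[0%R, (2 * pi)%R]).
  apply: (measurable_restrictT _ (measurable_itv _)).1; apply: measurable_funTS.
  exact: measurable_boundary_sqr.
have a0 x : 0 <= (arc_height z \_ `](-1)%R, 1%R[) x.
  by rewrite patchE; case: ifP => // _; exact: arc_height_ge0.
have b0 x : 0 <= (boundary_sqr z \_ `[0%R, (2 * pi)%R]) x.
  by rewrite patchE; case: ifP => // _; exact: sqr_ge0.
have i0 : 0 <= \1_`[0%R, (2 * pi)%R] z :> R by rewrite indicE ler0n.
have gv : ge0_meas2 (slice (w v) z) := slice_meas2 z (measurable_cell_cont_sqr v_cont) (fun x => sqr_ge0 _).
have gd : ge0_meas2 (slice (w dv) z) := slice_meas2 z (measurable_cell_cont_sqr dv_cont) (fun x => sqr_ge0 _).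
apply: (@le_trans _ _ (\int[lam]_x (4%:E * ((arc_height z \_ `](-1)%R, 1%R[) x * \1_`[0%R, (2 * pi)%R] z)%:E +
  16%:E * \int[lam]_y (slice (w dv) z x y)%:E))%E).
  apply: ge0_le_integral => //.
  - by move=> x _; exact: inner_ge0.
  - exact: measurable_inner.
  - apply: emeasurable_funD; apply: emeasurable_funM => //; last exact: measurable_inner.
    by apply/measurable_EFinP; exact: measurable_funM.
  - by move=> x _; exact: section_poincare.
rewrite ge0_integralD//; last 4 first.
- by move=> x _; rewrite mule_ge0// lee_fin mulr_ge0.
- by apply: emeasurable_funM => //; apply/measurable_EFinP; exact: measurable_funM.
- by move=> x _; rewrite mule_ge0//; exact: inner_ge0.
- by apply: emeasurable_funM => //; exact: measurable_inner.
rewrite !ge0_integralZl_EFin//; last 4 first.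
- by move=> x _; exact: inner_ge0.
- exact: measurable_inner.
- by move=> x _; rewrite lee_fin mulr_ge0.
- by apply/measurable_EFinP; exact: measurable_funM.
apply: leeD2r; apply: lee_wpmul2l => //.
have e (f : R -> R) : measurable_fun setT f -> (forall x, 0 <= f x) ->
    (\int[lam]_x (f x * \1_`[0%R, (2 * pi)%R] z)%:E = (\int[lam]_x (f x)%:E) * (\1_`[0%R, (2 * pi)%R] z)%:E)%E.
  move=> mf f0; rewrite -ge0_integralZr//; first exact/measurable_EFinP.
  by move=> x _; rewrite lee_fin.
rewrite !e//; apply: lee_wpmul2r => //.
have er (f : R -> R) (D : set R) : (\int[lam]_x ((f \_ D) x)%:E = \int[lam]_(x in D) (f x)%:E)%E.
  by rewrite [RHS]integral_mkcond; apply: eq_integral => x _; rewrite !patchE; case: ifP.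
by rewrite !er; exact: arc_height_integral.
Qed.

End cell_poincare.

Section smooth_poincare.
Context {R : realType}.
Local Notation lam := (@lebesgue_measure R).
Local Notation lam2 := (lam \x lam)%E.
Local Notation T2 := (measurableTypeR R * measurableTypeR R)%type.
Local Notation T3 := (R3 (measurableTypeR R)).

(** Kept in the form that occurs in [zero_trace], with the angle first and the height second,
    whereas [bsqr] takes the height first. *)
Definition boundary_norm (v : R3 R -> R) : \bar R :=
  Lnorm lam2 2%:E ((fun tz : R * R => (v (cos tz.1, sin tz.1, tz.2))%:E)
    \_ (`[0, 2 * pi] `*` `[0, 2 * pi])).

Local Notation bsqr v := (fun z t : R =>
  (boundary_sqr v z \_ `[0%R, (2 * pi)%R]) t * \1_`[0%R, (2 * pi)%R] z).

Lemma bsqr_meas2 (v : R3 R -> R) : continuous v -> ge0_meas2 (bsqr v).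
Proof.
move=> cv; split=> [z t|].
  by rewrite patchE indicE; case: ifP => _; rewrite mulr_ge0// ?ler0n ?sqr_ge0.
have mi : measurable_fun setT (\1_`[0%R, (2 * pi)%R] : measurableTypeR R -> R) by exact: measurable_indic.
apply: measurable_funM; last exact: (measurableT_comp mi measurable_fst).
rewrite (_ : (fun x : T2 => _) = (fun x : T2 => boundary_sqr v x.1 x.2 * \1_`[0%R, (2 * pi)%R] x.2)); last first.
  by apply/funext => x; rewrite patchE indicE; case: ifP => _; rewrite ?mulr1 ?mulr0.
apply: measurable_funM; last exact: (measurableT_comp mi measurable_snd).
apply: measurable_funX.
have mc : measurable_fun setT (@cos R : measurableTypeR R -> measurableTypeR R).
  by apply: continuous_measurable_fun; exact: continuous_cos.
have ms : measurable_fun setT (@sin R : measurableTypeR R -> measurableTypeR R).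
  by apply: continuous_measurable_fun; exact: continuous_sin.
have mp : measurable_fun setT (fun x : T2 => ((cos x.2, sin x.2, x.1) : T3)).
  apply: measurable_fun_pair => /=; last exact: measurable_fst.
  by apply: measurable_fun_pair => /=; [exact: (measurableT_comp mc measurable_snd)|exact: (measurableT_comp ms measurable_snd)].
exact: (measurableT_comp (measurable_R3_continuous cv) mp).
Qed.

Lemma boundary_normE (v : R3 R -> R) : continuous v -> (boundary_norm v `^ 2 = iint (bsqr v))%E.
Proof.
move=> cv; have gb := bsqr_meas2 cv.
rewrite -(iint_swap gb) -(iint_lam2 (ge0_meas2_swap gb)).
rewrite /boundary_norm powR_Lnorm//; apply: eq_integral => -[t z] _ /=.
rewrite indicE patchE [in RHS]patchE /boundary_sqr.
rewrite (_ : ((t, z) \in _) = (t \in `[0%R, (2 * pi)%R]%classic) && (z \in `[0%R, (2 * pi)%R]%classic)); last first.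
  by apply/idP/andP => [|[]]; rewrite !inE.
(* Outside its set a restricted function takes the value [point], which is 0 for real numbers. *)
case: (t \in _) => /=; last by rewrite normr0 powR0// -[point]/(0 : R) mul0r.
case: (z \in _) => /=; last by rewrite normr0 powR0// mulr0.
by rewrite powR_mulrn// real_normK ?num_real// mulr1.
Qed.

Lemma smooth_poincare (v : R3 R -> R) : smooth v ->
  (LpD 2 v `^ 2 <= 4%:E * boundary_norm v `^ 2 + 16%:E * LpD 2 ('D_(basis3 1%R) v) `^ 2)%E.
Proof.
move=> sv.
have cv : continuous v by exact: (sv 0).1.
have cdv : continuous ('D_(basis3 1%R) v) by have [_ /(_ 1%R)[_ []]] := sv 1.
have mv := measurable_cell_cont_sqr cv; have mdv := measurable_cell_cont_sqr cdv.
have gb := bsqr_meas2 cv; have b0 z : (0 <= \int[lam]_t (bsqr v z t)%:E)%E by exact: (inner_ge0 z gb).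
have i0 (g : R3 R -> R) z : continuous g -> (0 <= iint (slice (fun x => (g \_ cell) x ^+ 2)%R z))%E.
  move=> cg; apply: iint_ge0.
  exact: slice_meas2 z (measurable_cell_cont_sqr cg) (fun x => sqr_ge0 _).
have mi (g : R3 R -> R) : continuous g ->
    measurable_fun setT (fun z => iint (slice (fun x => (g \_ cell) x ^+ 2)%R z)).
  move=> cg.
  exact: measurable_slice_iint (measurable_cell_cont_sqr cg) (fun x => sqr_ge0 _).
rewrite boundary_normE// !LpD2E !slices_integral//; try by move=> x; exact: sqr_ge0.
rewrite /iint -/(iint _) -ge0_integralZl_EFin//; last exact: measurable_inner.
rewrite -[X in (_ + X)%E]ge0_integralZl_EFin//; last 2 first.
- by move=> z _; exact: i0.
- by exact: mi.
rewrite -ge0_integralD//; last 4 first.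
- by move=> z _; rewrite mule_ge0.
- by apply: emeasurable_funM => //; exact: measurable_inner.
- by move=> z _; rewrite mule_ge0//; exact: i0.
- by apply: emeasurable_funM => //; exact: mi.
apply: ge0_le_integral => //.
- by move=> z _; exact: i0.
- by exact: mi.
- apply: emeasurable_funD; apply: emeasurable_funM => //; first exact: measurable_inner.
  by exact: mi.
- by move=> z _; exact: slice_poincare.
Qed.

End smooth_poincare.

(** * Passage to the limit for fields with zero trace *)

Section trace_poincare.
Context {R : realType}.
Local Notation T3 := (R3 (measurableTypeR R)).

Lemma LpD_triangle (f g : R3 R -> R) : measurable_fun [set: T3] (f \_ cell) ->
  measurable_fun [set: T3] (g \_ cell) ->
  (LpD 2 (fun x => f x + g x)%R <= LpD 2 f + LpD 2 g)%E.
Proof.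
move=> mf mg; rewrite /LpD !restrict_EFin.
rewrite (_ : (fun x => f x + g x) \_ cell = (f \_ cell) \+ (g \_ cell)).
  by apply: minkowski_EFin => //; rewrite ler1n.
by apply/funext => x; rewrite /= !patchE; case: ifP => // _; rewrite addr0.
Qed.

Lemma LpD_opp (f : R3 R -> R) : LpD 2 (fun x => - f x) = LpD 2 f.
Proof.
rewrite /LpD -[RHS]oppe_Lnorm; apply: eq_Lnorm => x.
by rewrite /= !patchE; case: ifP => // _; rewrite oppe0.
Qed.

(** The cross term of (2 b + 4 c)^2 is nonnegative. The inequality between norms, unlike that
    between squares, combines with the triangle inequality. *)
Lemma sqr_le_sum (a b c : \bar R) : (0 <= a)%E -> (0 <= b)%E -> (0 <= c)%E ->
  (a `^ 2 <= 4%:E * b `^ 2 + 16%:E * c `^ 2)%E -> (a <= 2%:E * b + 4%:E * c)%E.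
Proof.
have y2 : (+oo `^ 2 = +oo :> \bar R)%E by rewrite poweRyr.
move=> a0 b0 c0; have [->|by_] := eqVneq b +oo%E.
  by rewrite gt0_muley ?lte_fin// addye ?leey//; case: c c0 => [c| |]// _; rewrite gt0_muley.
have [->|cy] := eqVneq c +oo%E.
  by rewrite (gt0_muley (x := 4%:E)) ?lte_fin// addey ?leey//; case: b b0 {by_} => [b| |]// _; rewrite gt0_muley.
case: b b0 by_ => [b| |]// b0 _; case: c c0 cy => [c| |]// c0 _.
case: a a0 => [a| |]// a0; last by rewrite y2 !poweR_EFin -!EFinM -EFinD leye_eq.
rewrite !lee_fin in a0 b0 c0.
rewrite !poweR_EFin -!EFinM -!EFinD !lee_fin !powR_mulrn// => h.
rewrite -(@ler_pXn2r _ 2)// ?nnegrE ?addr_ge0// ?mulr_ge0//.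
have : 0 <= b * c by exact: mulr_ge0.
by move: h; rewrite !expr2; nra.
Qed.

(** Only norms pass to the limit: the triangle inequality transfers the inequality of the smooth
    approximants to [f] with three errors, from the function, its derivative and the boundary
    values, each tending to 0. *)
Lemma zero_trace_poincare (f : R3 R -> R) (df : 'I_3 -> R3 R -> R) :
  L2per f -> L2per (df 1) -> zero_trace f df -> (LpD 2 f <= 4%:E * LpD 2 (df 1%R))%E.
Proof.
move=> fL dL [v [sv ef /(_ 1) ed eb]].
have mf := L2per_measurable fL; have md := L2per_measurable dL.
have mc (g : R3 R -> R) : continuous g -> measurable_fun [set: T3] (g \_ cell).
  by move=> /measurable_R3_continuous mg; apply: measurable_cell_restrict; exact: measurable_funTS.
have mv n : measurable_fun [set: T3] (v n \_ cell) by apply: mc; exact: ((sv n).1 0).1.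
have mdv n : measurable_fun [set: T3] ('D_(basis3 1%R) (v n) \_ cell).
  by apply: mc; have [_ /(_ 1)[_ []]] := (sv n).1 1.
have mB (g h : R3 R -> R) : measurable_fun [set: T3] (g \_ cell) -> measurable_fun [set: T3] (h \_ cell) ->
    measurable_fun [set: T3] ((fun x => g x - h x) \_ cell).
  move=> mg mh; rewrite (_ : _ \_ _ = (g \_ cell) \- (h \_ cell)); first exact: measurable_funB.
  by apply/funext => x; rewrite /= !patchE; case: ifP => // _; rewrite subr0.
have bound n : (LpD 2 f <= LpD 2 (fun x => v n x - f x)%R + (2%:E * boundary_norm (v n) +
    4%:E * (LpD 2 (fun x => 'D_(basis3 1%R) (v n) x - df 1%R x)%R + LpD 2 (df 1%R))))%E.
  have h1 : (LpD 2 f <= LpD 2 (v n) + LpD 2 (fun x => v n x - f x)%R)%E.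
    rewrite -[X in (_ <= _ + X)%E]LpD_opp.
    have mN : measurable_fun [set: T3] ((fun x => - (v n x - f x)) \_ cell).
      rewrite (_ : _ \_ _ = (fun x => - ((fun x => v n x - f x) \_ cell) x)).
        by apply: measurableT_comp => //; exact: mB.
      by apply/funext => x; rewrite !patchE; case: ifP => // _; rewrite oppr0.
    have := LpD_triangle (mv n) mN; apply: le_trans.
    by rewrite le_eqVlt; apply/orP; left; apply/eqP; congr (LpD 2 _); apply/funext => x; ring.
  have h2 := sqr_le_sum (LpD_ge0 _ _) (Lnorm_ge0 _ _ _) (LpD_ge0 _ _) (smooth_poincare (sv n).1).
  have h3 : (LpD 2 ('D_(basis3 1%R) (v n)) <= LpD 2 (fun x => 'D_(basis3 1%R) (v n) x - df 1%R x)%R + LpD 2 (df 1%R))%E.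
    have := LpD_triangle (mB _ _ (mdv n) md) md; apply: le_trans.
    by rewrite le_eqVlt; apply/orP; left; apply/eqP; congr (LpD 2 _); apply/funext => x; ring.
  rewrite addeC; apply: (le_trans h1); apply: leeD2r; apply: (le_trans h2).
  by apply: leeD2l; apply: lee_wpmul2l.
have c4 : (4%:E * (LpD 2 (fun x => 'D_(basis3 1%R) (v n) x - df 1%R x)%R + LpD 2 (df 1%R)))%E @[n --> \oo] --> (4%:E * (0 + LpD 2 (df 1%R)))%E.
  by apply: cvgeZl => //; apply: cvgeD => //; exact: cvg_cst.
have c2 : (2%:E * boundary_norm (v n))%E @[n --> \oo] --> (2%:E * 0)%E by exact: cvgeZl.
rewrite add0e in c4; rewrite mule0 in c2.
have cD (a b : nat -> \bar R) l : (0 <= l)%E -> a n @[n --> \oo] --> 0%E ->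
    b n @[n --> \oo] --> l -> (a n + b n)%E @[n --> \oo] --> l.
  by move=> l0 ha hb; rewrite -[l]add0e; apply: cvgeD => //; rewrite ge0_adde_def ?inE.
have L0 : (0 <= 4%:E * LpD 2 (df 1%R))%E by rewrite mule_ge0// LpD_ge0.
by apply: (cvge_ge _ (cD _ _ _ L0 ef (cD _ _ _ L0 c2 c4))) => //; near=> n; exact: bound.
Unshelve. all: by end_near. Qed.

End trace_poincare.

Section vector_poincare.
Context {R : realType}.
Variables (u : R3 R -> R3 R) (du : 'I_3 -> 'I_3 -> R3 R -> R).
Hypothesis uH1 : in_H1v u du.

Lemma poweR2_le (a b : \bar R) : (0 <= a)%E -> (0 <= b)%E -> (a `^ 2 <= b `^ 2)%E = (a <= b)%E.
Proof.
case: a => [a| |]//; case: b => [b| |]//; rewrite ?poweRyr ?poweR_EFin ?leey ?leye_eq//.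
by rewrite !lee_fin => a0 b0; rewrite !powR_mulrn// ler_pXn2r.
Qed.

(** The squared inequalities add up over the components with the constant 16 = 4^2; the derivatives
    along x1 only enlarge the right side. *)
Lemma vector_poincare : zero_trace_v u du ->
  (LpD 2 (enorm u) <= 4%:E * LpD 2 (hgrad_norm du))%E.
Proof.
move=> tr.
have mu i := measurable_u uH1 i; have mdu i j := measurable_du uH1 i j.
rewrite -poweR2_le ?mule_ge0 ?LpD_ge0// poweRM ?LpD_ge0// LpD2_enorm LpD2_hgrad.
have -> : (4%:E `^ 2 = 16%:E :> \bar R)%E by rewrite poweR_EFin powR_mulrn//; congr (_%:E); ring.
under eq_integral do rewrite -sumEFin.
rewrite ge0_integral_sum//; last 2 first.
- by move=> i; apply/measurable_EFinP; exact: measurable_funX.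
- by move=> i x _; rewrite lee_fin sqr_ge0.
apply: (@le_trans _ _ (16%:E * \int[lebesgue3]_x (\sum_(i < 3) ((du i 1 \_ cell) x ^+ 2)%:E))%E); last first.
  apply: lee_wpmul2l => //; apply: ge0_le_integral => //.
  - by move=> x _; apply: sume_ge0 => i _; rewrite lee_fin sqr_ge0.
  - by apply: emeasurable_sum => i; apply/measurable_EFinP; exact: measurable_funX.
  - by apply/measurable_EFinP; exact: measurable_cell_grad_sqr uH1.
  - move=> x _; rewrite sumEFin lee_fin; apply: ler_sum => i _.
    by rewrite lerDr sqr_ge0.
rewrite ge0_integral_sum//; last 2 first.
- by move=> i; apply/measurable_EFinP; exact: measurable_funX.
- by move=> i x _; rewrite lee_fin sqr_ge0.
rewrite ge0_sume_distrr; last by move=> i _; apply: integral_ge0 => x _; rewrite lee_fin sqr_ge0.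
apply: lee_sum => i _; have [uL dL] := uH1 i.
rewrite -!LpD2E (_ : 16%:E = 4%:E `^ 2)%E; last first.
  by rewrite poweR_EFin powR_mulrn//; congr (_%:E); ring.
rewrite -poweRM ?LpD_ge0// poweR2_le ?mule_ge0 ?LpD_ge0//.
exact: zero_trace_poincare (dL 1).1 (tr i).
Qed.

(** From N <= 4 D one gets sqrt N <= 2 sqrt D, hence N <= 2 sqrt N sqrt D: the bracket of the first
    estimate is at most (1 + 2) sqrt N sqrt D. *)
Lemma helical_ladyzhenskaya_zero_trace : helical u -> zero_trace_v u du ->
  (LpD 4 (enorm u) <= (3 * (2 / pi) `^ (4^-1))%:E *
     (LpD 2 (enorm u) `^ (2^-1) * LpD 2 (hgrad_norm du) `^ (2^-1)))%E.
Proof.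
move=> hel tr; apply: (le_trans (helical_ladyzhenskaya uH1 hel)).
rewrite [X in (_ <= X%:E * _)%E]mulrC EFinM -muleA; apply: lee_wpmul2l.
  by rewrite lee_fin powR_ge0.
have := vector_poincare tr.
move: (LpD_ge0 2 (enorm u)) (LpD_ge0 2 (hgrad_norm du)) (LpD2_enorm_lty uH1) (LpD2_hgrad_lty uH1).
case: (LpD 2 (enorm u)) => [N| |]//; case: (LpD 2 (hgrad_norm du)) => [D| |]//.
rewrite !lee_fin => N0 D0 _ _; rewrite !powR12_sqrt// => ND.
have ND' : Num.sqrt N <= 2 * Num.sqrt D.
  rewrite (_ : 2 = Num.sqrt 4); last by rewrite (_ : 4 = 2 ^+ 2) ?sqrtr_sqr ?ger0_norm//; ring.
  by rewrite -sqrtrM// ler_sqrt// mulr_ge0.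
have := ler_wpM2l (sqrtr_ge0 N) ND'; rewrite -expr2 sqr_sqrtr//; lra.
Qed.

End vector_poincare.

Theorem lemma2p3 (R : realType) :
  (forall (u : R3 R -> R3 R) (du : 'I_3 -> 'I_3 -> R3 R -> R),
    in_H1v u du -> helical u ->
    (LpD 4 (enorm u) <=
      ((2 / pi) `^ (4^-1))%:E *
      (LpD 2 (enorm u) `^ (2^-1) * LpD 2 (hgrad_norm du) `^ (2^-1)
       + LpD 2 (enorm u)))%E)
  /\
  (exists C : R, 0 < C /\
    forall (u : R3 R -> R3 R) (du : 'I_3 -> 'I_3 -> R3 R -> R),
    in_H1v u du -> helical u -> zero_trace_v u du ->
    (LpD 4 (enorm u) <=
      C%:E * (LpD 2 (enorm u) `^ (2^-1) * LpD 2 (hgrad_norm du) `^ (2^-1)))%E).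
Proof.
split; first by move=> u du; exact: helical_ladyzhenskaya.
exists (3 * (2 / pi) `^ (4^-1)); split.
  by rewrite mulr_gt0// powR_gt0// divr_gt0// pi_gt0.
by move=> u du; exact: helical_ladyzhenskaya_zero_trace.
Qed.
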